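(* Let $d\ge 1$ and let $V:\mathbb{R}^d\to\mathbb{R}_{\ge 0}$ be continuous and $\mathbb{Z}^d$-periodic. For every irrational $\theta\in(0,1)$, $$\mu(A_\theta)\le \mu(B_\theta).$$
   Context: For $\theta\in(0,1)$, the discrete Schrödinger operator $A_\theta:\ell_2(\theta\mathbb{Z}^d)\to\ell_2(\theta\mathbb{Z}^d)$ is $$A_\theta f(k\theta)=\Big(2d\,f(k\theta)-\sum_{j\sim k}f(j\theta)\Big)+V(k\theta)f(k\theta),\qquad k\in\mathbb{Z}^d,$$ where $j\sim k$ means that $j,k\in\mathbb{Z}^d$ are nearest neighbours, i.e. $j-k=\pm e_i$ for some coordinate vector $e_i$. It is bounded and self-adjoint. $\mu(A_\theta)$ denotes the infimum of its spectrum (ground state energy); equivalently $$\mu(A_\theta)=\inf_{f\in\ell_2(\theta\mathbb{Z}^d),\,\|f\|=1}\Big(\sum_{\{j,k\}:\,j\sim k}(f(k\theta)-f(j\theta))^2+\sum_{k\in\mathbb{Z}^d}V(k\theta)f(k\theta)^2\Big),$$ the first sum being over unordered pairs of neighbours. The semiclassical Schrödinger operator $B_\theta:H^2(\mathbb{R}^d)\to L^2(\mathbb{R}^d)$ is $B_\theta g=-\theta^2\Delta g+Vg$ (unbounded, self-adjoint, nonnegative), and $\mu(B_\theta)$ is the infimum of its spectrum; equivalently $$\mu(B_\theta)=\inf_{g\in H^2(\mathbb{R}^d),\,\|g\|=1}\int_{\mathbb{R}^d}\theta^2\|\nabla g(x)\|^2+V(x)g(x)^2\,dx.$$ *)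

(* Defs.v *)
From HB Require Import structures.
From mathcomp Require Import all_boot all_order all_algebra.
From mathcomp Require Import all_classical all_reals all_analysis.

Set Implicit Arguments.
Unset Strict Implicit.
Unset Printing Implicit Defensive.

Import Order.TTheory GRing.Theory Num.Theory.
Import numFieldNormedType.Exports.

Local Open Scope classical_set_scope.
Local Open Scope ring_scope.

(* Points of R^d are row vectors; on them we put the sigma-algebra generated by
   the coordinates, as the library does for tuples. It is the Borel
   sigma-algebra. *)
Definition rV_display : measure_display -> measure_display.
Proof. exact. Qed.

Section measurable_rV.
Context (R : realType) (n : nat).

Definition rV_coord (i : 'I_n) (v : 'rV[R]_n) : measurableTypeR R := v ord0 i.

Let rV_set0 : g_sigma_preimage rV_coord set0.
Proof. exact: sigma_algebra0. Qed.

Let rV_setC A : g_sigma_preimage rV_coord A -> g_sigma_preimage rV_coord (~` A).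
Proof. exact: sigma_algebraC. Qed.

Let rV_bigcup (F : (set 'rV[R]_n)^nat) :
  (forall i, g_sigma_preimage rV_coord (F i)) ->
  g_sigma_preimage rV_coord (\bigcup_i (F i)).
Proof. exact: sigma_algebra_bigcup. Qed.

HB.instance Definition _ := @isMeasurable.Build (rV_display default_measure_display)
  'rV[R]_n (g_sigma_preimage rV_coord) rV_set0 rV_setC rV_bigcup.

Lemma measurable_rV_coord (i : 'I_n) : measurable_fun [set: 'rV[R]_n] (rV_coord i).
Proof.
move=> _ Y mY; rewrite setTI; apply: sub_sigma_algebra => /=.
rewrite -bigcup_seq/=; exists i => /=; first by rewrite mem_index_enum.
by exists Y => //; rewrite setTI.
Qed.

Lemma measurable_fun_rV d (T : measurableType d) (f : T -> 'rV[R]_n) :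
  (forall i, measurable_fun [set: T] (rV_coord i \o f)) ->
  measurable_fun [set: T] f.
Proof.
move=> mf _ A mA.
suff : preimage_set_system setT f (g_sigma_preimage rV_coord) `<=` measurable.
  by apply; exists A.
rewrite -g_sigma_preimage_comp.
apply: smallest_sub; first exact: sigma_algebra_measurable.
move=> B; rewrite -bigcup_seq => -[i _ [C mC <-]].
exact: mf.
Qed.

End measurable_rV.

(* Lebesgue measure on R^n, as an iterated product measure. *)
Section lebesgue_measure_rV.
Context (R : realType).

Definition rV_cons n (p : measurableTypeR R * 'rV[R]_n) : 'rV[R]_n.+1 :=
  row_mx (p.1)%:M p.2.

Definition rV_uncons n (v : 'rV[R]_n.+1) : measurableTypeR R * 'rV[R]_n :=
  (v ord0 ord0, \row_j v ord0 (lift ord0 j)).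

Lemma rV_cons0 n (p : measurableTypeR R * 'rV[R]_n) : rV_cons p ord0 ord0 = p.1.
Proof.
rewrite /rV_cons (_ : ord0 = lshift n (ord0 : 'I_1)); last exact/val_inj.
by rewrite (row_mxEl (p.1)%:M p.2) mxE eqxx mulr1n.
Qed.

Lemma rV_consS n (p : measurableTypeR R * 'rV[R]_n) j :
  rV_cons p ord0 (lift ord0 j) = p.2 ord0 j.
Proof.
rewrite /rV_cons (_ : lift ord0 j = rshift 1 j); last exact/val_inj.
by rewrite (row_mxEr (p.1)%:M p.2).
Qed.

Lemma rV_consK n : cancel (@rV_cons n) (@rV_uncons n).
Proof.
move=> p; rewrite /rV_uncons rV_cons0 [RHS]surjective_pairing; congr pair.
by apply/rowP => j; rewrite mxE rV_consS.
Qed.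

Lemma rV_unconsK n : cancel (@rV_uncons n) (@rV_cons n).
Proof.
move=> v; apply/rowP => j; case: (unliftP ord0 j) => [k|] ->.
  by rewrite rV_consS mxE.
by rewrite rV_cons0.
Qed.

Lemma measurable_rV_cons n : measurable_fun setT (@rV_cons n).
Proof.
apply: measurable_fun_rV => j; case: (unliftP ord0 j) => [k|] ->.
  rewrite (_ : _ \o _ = rV_coord k \o snd).
    by apply: measurableT_comp => //; exact: measurable_rV_coord.
  by apply/funext => p; rewrite /= /rV_coord rV_consS.
rewrite (_ : _ \o _ = fst); first exact: measurable_fst.
by apply/funext => p; rewrite /= /rV_coord rV_cons0.
Qed.

Lemma measurable_rV_uncons n : measurable_fun setT (@rV_uncons n).
Proof.
apply/measurable_fun_pairP; split; first exact: (measurable_rV_coord ord0).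
apply: measurable_fun_rV => j.
rewrite (_ : _ \o _ = rV_coord (lift ord0 j)); first exact: measurable_rV_coord.
by apply/funext => v; rewrite /= /rV_coord mxE.
Qed.

Section step.
Context (n : nat) (m : {sigma_finite_measure set 'rV[R]_n -> \bar R}).

Definition rV_step : set 'rV[R]_n.+1 -> \bar R :=
  pushforward (@lebesgue_measure R \x m)%E (@rV_cons n).

Let rV_step0 : rV_step set0 = 0%E.
Proof. by rewrite /rV_step /pushforward preimage_set0 measure0. Qed.

Let rV_step_ge0 A : (0 <= rV_step A)%E.
Proof. by rewrite /rV_step /pushforward; exact: measure_ge0. Qed.

Let rV_step_sigma_additive : semi_sigma_additive rV_step.
Proof.
move=> F mF tF mUF; rewrite /rV_step /pushforward preimage_bigcup.
apply: measure_semi_sigma_additive.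
- by move=> k; rewrite -[X in measurable X]setTI; exact: measurable_rV_cons.
- apply/trivIsetP => /= i j _ _ ij; rewrite -preimage_setI.
  by move/trivIsetP : tF => /(_ _ _ _ _ ij) ->//; rewrite preimage_set0.
- rewrite -preimage_bigcup -[X in measurable X]setTI.
  exact: measurable_rV_cons.
Qed.

HB.instance Definition _ :=
  isMeasure.Build _ _ _ rV_step rV_step0 rV_step_ge0 rV_step_sigma_additive.

Let rV_step_sigma_finite : sigma_finite setT rV_step.
Proof.
have /sigma_finiteP[F [TF ndF Foo]] := sigma_finiteT (@lebesgue_measure R).
have /sigma_finiteP[G [TG ndG Goo]] := sigma_finiteT m.
exists (fun k => @rV_uncons n @^-1` (F k `*` G k)).
  rewrite -preimage_bigcup [X in _ @^-1` X](_ : _ = setT) ?preimage_setT//.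
  apply/seteqP; split => // -[x y] _.
  have [i _ Fix] : (\bigcup_i F i) x by rewrite -TF.
  have [j _ Gjy] : (\bigcup_i G i) y by rewrite -TG.
  exists (maxn i j) => //; split => /=.
    by move: x Fix; exact/subsetPset/ndF/leq_maxl.
  by move: y Gjy; exact/subsetPset/ndG/leq_maxr.
move=> k; have [[mF Fk] [mG Gk]] := (Foo k, Goo k); split.
  rewrite -[X in measurable X]setTI.
  by apply: measurable_rV_uncons => //; exact: measurableX.
rewrite /rV_step /pushforward -comp_preimage.
rewrite (_ : _ \o _ = id); last by apply/funext => p /=; rewrite rV_consK.
by rewrite preimage_id product_measure1E// lte_mul_pinfty// ge0_fin_numE.
Qed.

HB.instance Definition _ :=
  Measure_isSigmaFinite.Build _ _ _ rV_step rV_step_sigma_finite.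

End step.

Fixpoint lebesgue_rV n : {sigma_finite_measure set 'rV[R]_n -> \bar R} :=
  match n with
  | 0 => @dirac _ 'rV[R]_0 0 R
  | n'.+1 => rV_step (lebesgue_rV n')
  end.

End lebesgue_measure_rV.
Arguments lebesgue_rV {R} n.

(* Weak derivatives of functions on R^d, along a list s of coordinate
   directions: the multi-index alpha corresponds to any list in which each i
   occurs alpha_i times. *)
Section sobolev.
Context (R : realType) (d : nat).
Implicit Types (f g w phi : 'rV[R]_d -> R) (s : seq 'I_d).

Definition pderiv s phi : 'rV[R]_d -> R :=
  foldr (fun i f => 'D_(delta_mx ord0 i) f) phi s.

Definition smooth phi := forall s,
  continuous (pderiv s phi) /\
  forall i x, derivable (pderiv s phi) x (delta_mx ord0 i).

Definition test_function phi :=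
  smooth phi /\ compact (closure [set x | phi x != 0]).

Definition L2 : set ('rV[R]_d -> R) := [set f | f \in Lfun (lebesgue_rV d) 2%:E].

Definition L2norm f : \bar R := 'N[lebesgue_rV d]_2%:E[EFin \o f].

Definition weak_deriv s g w := forall phi, test_function phi ->
  \int[lebesgue_rV d]_x (g x * pderiv s phi x) =
  (-1) ^+ size s * \int[lebesgue_rV d]_x (w x * phi x).

Definition sobolev k : set ('rV[R]_d -> R) :=
  [set g | L2 g /\
    forall s, (size s <= k)%N -> exists2 w, L2 w & weak_deriv s g w].

End sobolev.

(* Spectrum of an operator on a real Hilbert space of functions. The Hilbert
   space is H modulo its vectors of norm 0 (for L^2: modulo equality almost
   everywhere), and the possibly unbounded operator is given by its graph
   [op f u], read "f is in the domain and u represents its image". A point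
   lambda is in the resolvent set when the operator minus lambda is a bijection
   from its domain onto H with bounded inverse. The scalars are real: the
   spectrum of a self-adjoint operator is real, and real scalars see all of it.
   The infimum is taken in the extended reals. *)
Section spectrum.
Context (R : realType) (T : Type).
Variables (H : set (T -> R)) (nrm : (T -> R) -> \bar R).
Variable op : (T -> R) -> (T -> R) -> Prop.

Definition op_sub (lambda : R) (f v : T -> R) : Prop :=
  exists2 u, op f u & v = (fun x => u x - lambda * f x).

Definition resolvent_set : set R := [set lambda |
  [/\ forall f v, op_sub lambda f v -> nrm v = 0%E -> nrm f = 0%E,
      forall h, H h -> exists f v, op_sub lambda f v /\ nrm (v \- h) = 0%E
    & exists C : R, forall f v, op_sub lambda f v ->
        (nrm f <= C%:E * nrm v)%E]].

Definition spectrum : set R := ~` resolvent_set.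

Definition inf_spectrum : \bar R := ereal_inf (EFin @` spectrum).

End spectrum.

Section schrodinger.
Context (R : realType) (d : nat) (V : 'rV[R]_d -> R) (theta : R).

(* A function f on the lattice theta Z^d is represented by k |-> f (k theta),
   for k in Z^d. *)
Definition lattice_point (k : 'rV[int]_d) : 'rV[R]_d := theta *: map_mx intr k.

Definition l2norm (f : 'rV[int]_d -> R) : \bar R :=
  sqrte (\esum_(k in [set: 'rV[int]_d]) ((f k) ^+ 2)%:E)%E.

Definition l2 : set ('rV[int]_d -> R) := [set f | (l2norm f < +oo)%E].

Definition discrete_schrodinger (f : 'rV[int]_d -> R) (k : 'rV[int]_d) : R :=
  ((2 * d)%:R * f k -
     \sum_(i < d) (f (k + delta_mx ord0 i) + f (k - delta_mx ord0 i)))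
  + V (lattice_point k) * f k.

Definition A_graph (f u : 'rV[int]_d -> R) :=
  l2 f /\ u = discrete_schrodinger f.

Definition mu_A : \bar R := inf_spectrum l2 l2norm A_graph.

(* [lap i] is the weak second derivative of g in direction i. *)
Definition B_graph (g u : 'rV[R]_d -> R) :=
  sobolev 2 g /\
  exists lap : 'I_d -> 'rV[R]_d -> R,
    (forall i, L2 (lap i) /\ weak_deriv [:: i; i] g (lap i)) /\
    u = (fun x => - theta ^+ 2 * (\sum_(i < d) lap i x) + V x * g x).

Definition mu_B : \bar R := inf_spectrum (@L2 R d) (@L2norm R d) B_graph.

End schrodinger.

(* Main.v *)
(* Let m be the bottom of the quadratic form of the lattice operator on finitely
   supported functions; m is an approximate eigenvalue, so mu(A_theta) <= m. By
   density of the orbit of an irrational theta modulo 1 and continuity of V, the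
   same lower bound m holds with V(k theta) replaced by V(x + k theta), for every
   x in R^d. Applying it to k |-> g(x + k theta), cut off to large cubes, and
   integrating over x gives, for every g in L^2(R^d),
     m |g|^2 <= sum_i |g(. + theta e_i) - g|^2 + <V g, g>.
   Since |g(. + h e_i) - g| / h increases when h is halved, the operators obtained
   from B_theta by replacing second derivatives by second differences of step
   theta / 2^n are all bounded below by m. Letting n tend to infinity, the form of
   B_theta is bounded below by m on H^2, and for lambda < m the solutions of the
   discretized equations converge weakly to a solution of (B_theta - lambda) u = f.
   Hence every lambda < m is in the resolvent set of B_theta. *)
Require Import Defs.
From mathcomp Require Import all_boot all_order all_algebra finmap.
From mathcomp Require Import all_classical all_reals all_analysis.
From mathcomp Require Import measurable_realfun ring lra.
Set Implicit Arguments.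
Unset Strict Implicit.
Unset Printing Implicit Defensive.
Import Order.TTheory GRing.Theory Num.Theory.
Import numFieldNormedType.Exports.
Local Open Scope classical_set_scope.
Local Open Scope ring_scope.

(** * Forms on real vector spaces *)

(** For [lambda] to be in the resolvent set of B_theta, the lower bound is needed on the whole
    domain, an H^2 known only through weak derivatives, and so is surjectivity, which symmetry alone
    would not give. Surjectivity comes from the discretized operators: they are bounded, so each
    equation is solved by a Riesz argument, and their bound from below does not depend on the step.
    The second differences of the solutions stay bounded because V is bounded and because commuting
    differences satisfy |Lap_h u|^2 = sum_ij |D_i D_j u|^2. On the domain, the second difference of
    g at a coarse step is an average of second differences at fine steps, so its norm is at most
    that of the weak second derivative, and weak compactness identifies the limit. Halving the step
    serves both arguments, since a quotient at step 2h is a weighted mean of translates of the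
    quotient at step h. Elements of L^2 stay functions rather than classes, so forms are only
    semidefinite and equality in L^2 is stated as a vanishing squared norm. *)

Section inner_product.
Context (R : realType) (V : lmodType R).
Implicit Types (H : set V) (a b : V -> V -> R) (u v w : V).

(** A semidefinite form on a subset [H] of an ambient module of functions. The laws are asked on [H]
    only, because sums and integrals take default values outside it. *)
Record inner_product H a : Prop := InnerProduct {
  ip_mem0 : H 0;
  ip_memD : forall u v, H u -> H v -> H (u + v);
  ip_memZ : forall c u, H u -> H (c *: u);
  ipC : forall u v, H u -> H v -> a u v = a v u;
  ipDl : forall u v w, H u -> H v -> H w -> a (u + v) w = a u w + a v w;
  ipZl : forall c u v, H u -> H v -> a (c *: u) v = c * a u v;
  ip_ge0 : forall u, H u -> 0 <= a u u }.

Definition ip_complete H a := forall u : nat -> V, (forall n, H (u n)) ->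
  (forall e : R, 0 < e -> exists N, forall n m, (N <= n)%N -> (N <= m)%N ->
     a (u n - u m) (u n - u m) <= e) ->
  exists2 l, H l & forall e : R, 0 < e -> exists N, forall n, (N <= n)%N ->
     a (u n - l) (u n - l) <= e.

(** The case [C = 0] does occur, the forms being semidefinite; the polynomial is then affine and
    must be constant. *)
Lemma discriminant_le (A B C : R) :
  0 <= C -> (forall t, 0 <= A + 2 * B * t + C * t ^+ 2) -> B ^+ 2 <= A * C.
Proof.
move=> C0 h; have [C00|Cn0] := eqVneq C 0; last first.
  have {}C0 : 0 < C by rewrite lt_def Cn0.
  have := h (- B / C).
  rewrite (_ : _ + _ = A - B ^+ 2 / C); last by field.
  by rewrite subr_ge0 ler_pdivrMr.
have [->|Bn0] := eqVneq B 0; first by rewrite C00 mulr0 expr0n.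
(* This value of t makes A + 2 B t equal to -1. *)
have := h (- (A + 1) / (2 * B)).
rewrite C00 mul0r addr0 (_ : _ + _ = -1); last by field.
lra.
Qed.

Section basic.
Context H a (ia : inner_product H a).
Local Notation mD := (ip_memD ia).
Local Notation mZ := (ip_memZ ia).

Lemma ip_memN u : H u -> H (- u).
Proof. by move=> hu; rewrite -scaleN1r; exact: mZ. Qed.

Lemma ip_memB u v : H u -> H v -> H (u - v).
Proof. by move=> hu hv; apply: mD => //; exact: ip_memN. Qed.

Lemma ip_mem_sum I (r : seq I) (P : pred I) (F : I -> V) :
  (forall i, P i -> H (F i)) -> H (\sum_(i <- r | P i) F i).
Proof. by move=> h; elim/big_ind : _ => //; [exact: ip_mem0 ia|exact: mD]. Qed.

Lemma ip0l v : H v -> a 0 v = 0.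
Proof. by move=> hv; rewrite -(scale0r v) (ipZl ia)// mul0r. Qed.

Lemma ipDr u v w : H u -> H v -> H w -> a u (v + w) = a u v + a u w.
Proof.
move=> hu hv hw; rewrite (ipC ia)//; last exact: mD.
by rewrite (ipDl ia)// (ipC ia hv hu) (ipC ia hw hu).
Qed.

Lemma ipZr c u v : H u -> H v -> a u (c *: v) = c * a u v.
Proof.
move=> hu hv; rewrite (ipC ia)//; last exact: mZ.
by rewrite (ipZl ia)// (ipC ia hv hu).
Qed.

Lemma ipNl u v : H u -> H v -> a (- u) v = - a u v.
Proof. by move=> hu hv; rewrite -scaleN1r (ipZl ia)// mulN1r. Qed.

Lemma ipNr u v : H u -> H v -> a u (- v) = - a u v.
Proof. by move=> hu hv; rewrite -scaleN1r ipZr// mulN1r. Qed.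

Lemma ipBl u v w : H u -> H v -> H w -> a (u - v) w = a u w - a v w.
Proof. by move=> hu hv hw; rewrite (ipDl ia)// ?ipNl//; exact: ip_memN. Qed.

Lemma ipBr u v w : H u -> H v -> H w -> a u (v - w) = a u v - a u w.
Proof. by move=> hu hv hw; rewrite ipDr// ?ipNr//; exact: ip_memN. Qed.

Lemma ip_suml I (r : seq I) (P : pred I) (F : I -> V) v :
  (forall i, P i -> H (F i)) -> H v ->
  a (\sum_(i <- r | P i) F i) v = \sum_(i <- r | P i) a (F i) v.
Proof.
move=> hF hv; have : H (\sum_(i <- r | P i) F i) by exact: ip_mem_sum.
elim: r => [|i r IH]; first by rewrite !big_nil ip0l.
rewrite !big_cons; case: ifPn => // Pi _.
have hs : H (\sum_(j <- r | P j) F j) by exact: ip_mem_sum.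
by rewrite (ipDl ia) ?IH//; exact: hF.
Qed.

Lemma ip_sumr I (r : seq I) (P : pred I) (F : I -> V) v :
  (forall i, P i -> H (F i)) -> H v ->
  a v (\sum_(i <- r | P i) F i) = \sum_(i <- r | P i) a v (F i).
Proof.
move=> hF hv; rewrite (ipC ia)//; last exact: ip_mem_sum.
by rewrite ip_suml//; apply: eq_bigr => i Pi; rewrite (ipC ia)//; exact: hF.
Qed.

Lemma ip_sqD u v : H u -> H v ->
  a (u + v) (u + v) = a u u + 2 * a u v + a v v.
Proof.
move=> hu hv; have huv := mD hu hv.
by rewrite (ipDl ia)// !ipDr// (ipC ia hv hu); ring.
Qed.

Lemma ip_sqB u v : H u -> H v ->
  a (u - v) (u - v) = a u u - 2 * a u v + a v v.
Proof.
move=> hu hv; have hn := ip_memN hv.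
by rewrite ip_sqD// !ipNr// ipNl//; ring.
Qed.

Lemma ip_sqZ c u : H u -> a (c *: u) (c *: u) = c ^+ 2 * a u u.
Proof. by move=> hu; rewrite (ipZl ia) ?ipZr//; [ring|exact: mZ]. Qed.

Lemma cauchy_schwarz u v : H u -> H v -> (a u v) ^+ 2 <= a u u * a v v.
Proof.
move=> hu hv; apply: discriminant_le; first exact: ip_ge0 ia _ hv.
move=> t; have htv := mZ t hv.
have := ip_ge0 ia (mD hu htv); rewrite ip_sqD// ip_sqZ// ipZr//.
by congr (0 <= _); ring.
Qed.

Lemma ip_parallelogram u v : H u -> H v ->
  a (u - v) (u - v) + a (u + v) (u + v) = 2 * a u u + 2 * a v v.
Proof. by move=> hu hv; rewrite ip_sqB// ip_sqD//; ring. Qed.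

Lemma ip_sqD_le u v : H u -> H v ->
  a (u + v) (u + v) <= 2 * a u u + 2 * a v v.
Proof.
move=> hu hv; rewrite -ip_parallelogram//.
by have := ip_ge0 ia (ip_memB hu hv); lra.
Qed.

End basic.

Section riesz.
Context H a (ia : inner_product H a) (ca : ip_complete H a).
Local Notation mD := (ip_memD ia).
Local Notation mZ := (ip_memZ ia).

Lemma le_epsilonM (x K : R) : (forall e : R, 0 < e -> x <= e * K) -> x <= 0.
Proof.
move=> h; rewrite leNgt; apply/negP => x0.
have K0 : 0 < K by have := h 1 ltr01; lra.
have e0 : 0 < x / (2 * K) by rewrite divr_gt0// mulr_gt0.
have := h _ e0; rewrite (_ : _ / _ * _ = x / 2); first by lra.
by field; rewrite gt_eqF.
Qed.

(* A minimizing sequence of [a u u - 2 L u] is Cauchy by the parallelogram law. *)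
Lemma riesz_representation (L : V -> R) (C : R) : 0 <= C ->
  (forall u v, H u -> H v -> L (u + v) = L u + L v) ->
  (forall c u, H u -> L (c *: u) = c * L u) ->
  (forall u, H u -> (L u) ^+ 2 <= C * a u u) ->
  exists2 l, H l & forall v, H v -> L v = a l v.
Proof.
move=> C0 LD LZ LC; pose J u := a u u - 2 * L u.
(* 2 |L u| <= 2 sqrt (C * a u u) <= C + a u u. *)
have Jlb u : H u -> - C <= J u.
  move=> hu; rewrite /J; have au0 := ip_ge0 ia hu; have {}LC := LC _ hu.
  rewrite leNgt; apply/negP => h; have h1 : a u u + C < 2 * L u by lra.
  have h2 : (a u u + C) ^+ 2 < (2 * L u) ^+ 2.
    by rewrite ltrXn2r//; lra.
  have := sqr_ge0 (a u u - C); nra.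
pose S := [set J u | u in H].
have S0 : S !=set0 by exists (J 0); exists 0 => //; exact: ip_mem0 ia.
have Slb : has_lbound S by exists (- C) => _ [u hu <-]; exact: Jlb.
have Sinf : has_inf S by [].
pose j := inf S.
have jle u : H u -> j <= J u by move=> hu; apply: ge_inf => //; exists u.
have /choice[v hv] n : exists v, H v /\ J v < j + n.+1%:R^-1.
  have n0 : 0 < n.+1%:R^-1 :> R by rewrite invr_gt0.
  by have [_ [v hv <-] Jv] := inf_adherent n0 Sinf; exists v.
have Hv n : H (v n) := (hv n).1.
have Jv n : J (v n) < j + n.+1%:R^-1 := (hv n).2.
have invlt (e : R) : 0 < e -> exists N, forall n, (N <= n)%N -> n.+1%:R^-1 <= e.
  move=> e0; have [N _ NP] := near_infty_natSinv_lt (PosNum e0).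
  by exists N => n Nn; exact/ltW/(NP n Nn).
have [e e0|l hl lP] := ca Hv.
  (* Since [J] at the midpoint is at least [j], the parallelogram law bounds the squared distance by
     2/(n+1) + 2/(m+1). *)
  have [N NP] := invlt (e / 4) ltac:(by lra).
  exists N => n m Nn Nm.
  have := jle _ (mZ 2^-1 (mD (Hv n) (Hv m))).
  rewrite /J (ip_sqZ ia) ?LZ ?LD //; try exact: mD.
  have := ip_parallelogram ia (Hv n) (Hv m).
  have := Jv n; have := Jv m; rewrite /J.
  have := NP _ Nn; have := NP _ Nm.
  rewrite expr2.
  move: (a (v n + v m) (v n + v m)) (a (v n - v m) (v n - v m)) => x y.
  move: (n.+1%:R^-1) (m.+1%:R^-1) => p q.
  lra.
exists l => // w hw; apply/eqP; rewrite -subr_eq0 -sqrf_eq0 eq_le sqr_ge0 andbT.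
(* The 4 comes from (x + y)^2 <= 2 x^2 + 2 y^2, both squares being at most [e * a w w]. *)
apply: (@le_epsilonM _ (4 * a w w)) => e e0.
have [N1 N1P] := invlt e e0; have [N2 N2P] := lP e e0.
pose n := maxn N1 N2.
have {}N1P := N1P n (leq_maxl _ _); have {}N2P := N2P n (leq_maxr _ _).
(* [v n] minimizes [J] up to 1/(n+1), so [J (v n + t *: w) - J (v n)] plus this error is a
   nonnegative quadratic polynomial in t. *)
have h1 : (a (v n) w - L w) ^+ 2 <= n.+1%:R^-1 * a w w.
  apply: discriminant_le; first exact: ip_ge0 ia _ hw.
  move=> t; have := jle _ (mD (Hv n) (mZ t hw)).
  have := Jv n; rewrite /J (ip_sqD ia) ?(ip_sqZ ia) ?(ipZr ia) ?LD ?LZ//; try exact: mZ.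
  move: (a (v n) w) (L w) (n.+1%:R^-1) (a w w) => x y p q; rewrite !expr2; lra.
have h2 : (a (v n) w - a l w) ^+ 2 <= a (v n - l) (v n - l) * a w w.
  by rewrite -(ipBl ia)//; apply: (cauchy_schwarz ia) => //; exact: (ip_memB ia).
have aw := ip_ge0 ia hw.
have h3 : n.+1%:R^-1 * a w w <= e * a w w by rewrite ler_wpM2r.
have h4 : a (v n - l) (v n - l) * a w w <= e * a w w by rewrite ler_wpM2r.
have := sqr_ge0 ((a (v n) w - L w) + (a (v n) w - a l w)).
move: h1 h2 h3 h4; rewrite !expr2.
move: (a (v n) w) (L w) (a l w) (n.+1%:R^-1) => x y z p.
move: (a w w) (a (v n - l) (v n - l)) aw => q r aw; nra.
Qed.

End riesz.

Section bounded_forms.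
Context H a (ia : inner_product H a) (ca : ip_complete H a).

(** As [b] is symmetric, this is the Riesz theorem for [b] itself: the two bounds make [b] and [a]
    equivalent, so completeness passes from [a] to [b]. *)
Lemma lax_milgram b (delta K : R) f : inner_product H b -> 0 < delta ->
  (forall u, H u -> delta * a u u <= b u u) ->
  (forall u, H u -> b u u <= K * a u u) -> H f ->
  exists2 u, H u & forall v, H v -> b u v = a f v.
Proof.
move=> ib d0 lob upb hf.
have cb : ip_complete H b.
  move=> u hu cu; have [e e0|l hl lP] := ca hu.
    have [N NP] := cu (delta * e) ltac:(by rewrite mulr_gt0).
    exists N => n m Nn Nm; have := lob _ (ip_memB ia (hu n) (hu m)).
    by have := NP _ _ Nn Nm => h1 h2; rewrite -(ler_pM2l d0) (le_trans h2).
  exists l => // e e0; pose K' := Num.max K 1.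
  have K'0 : 0 < K' by rewrite lt_max ltr01 orbT.
  have [N NP] := lP (e / K') ltac:(by rewrite divr_gt0).
  exists N => n Nn; have hB := ip_memB ia (hu n) hl.
  apply: (le_trans (upb _ hB)); apply: (@le_trans _ _ (K' * a (u n - l) (u n - l))).
    by rewrite ler_wpM2r ?le_max ?lexx//; exact: (ip_ge0 ia).
  by rewrite -ler_pdivlMl// mulrC NP.
have C0 : 0 <= a f f / delta by rewrite divr_ge0 ?(ltW d0)//; exact: (ip_ge0 ia).
have [] := @riesz_representation _ _ ib cb (a f) _ C0.
- by move=> u v hu hv; rewrite (ipDr ia).
- by move=> c u hu; rewrite (ipZr ia).
- move=> u hu; apply: (le_trans (cauchy_schwarz ia hf hu)).
  rewrite -mulrA; apply: ler_wpM2l; first exact: ip_ge0 ia _ hf.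
  by rewrite ler_pdivlMl// lob.
by move=> l hl lP; exists l => // v hv; rewrite lP.
Qed.

(** Along an ultrafilter every bounded real sequence converges, so all pairings converge at once,
    and their limit is a bounded functional represented by some [l]. Pairing with [l] itself gives
    (a l l)^2 <= C * a l l. *)
Lemma weak_limit (F : set_system nat) (UF : UltraFilter F) (u : nat -> V) C :
  (forall n, H (u n)) -> (forall n, a (u n) (u n) <= C) ->
  exists l, [/\ H l, a l l <= C &
    forall v, H v -> a (u n) v @[n --> F] --> a l v].
Proof.
move=> hu uC; have PF := @ultra_proper _ _ UF.
have C0 : 0 <= C by rewrite (le_trans _ (uC 0%N))//; exact: ip_ge0 ia _ (hu 0%N).
have sqb v n : H v -> (a (u n) v) ^+ 2 <= C * a v v.
  move=> hv; apply: (le_trans (cauchy_schwarz ia (hu n) hv)).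
  by rewrite ler_wpM2r//; exact: (ip_ge0 ia).
have cvgv v : H v -> cvg (a (u n) v @[n --> F]).
  move=> hv; pose M : R := Num.sqrt (C * a v v).
  have bn n : a (u n) v \in `[- M, M].
    by rewrite in_itv/= -ler_norml -sqrtr_sqr ler_wsqrtr// sqb.
  have FM : (a (u n) v @[n --> F]) `[- M, M]%classic.
    by apply: (@filterE _ F) => n; exact: bn.
  have [p [_ pP]] := @segment_compact _ (- M) M _ _ FM.
  apply/cvg_ex; exists p => B Bp.
  have [//|FB] := in_ultra_setVsetC (fun n => B (a (u n) v)) UF.
  by have [? []] := pP (~` B) B FB Bp.
pose L v := lim (a (u n) v @[n --> F]).
have LP v : H v -> a (u n) v @[n --> F] --> L v by move/cvgv.
have [l hl lP] : exists2 l, H l & forall v, H v -> L v = a l v.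
  apply: (@riesz_representation _ _ ia ca L C) => //.
  - move=> v w hv hw; apply/cvg_lim => //.
    rewrite (_ : (fun n => _) = (fun n => a (u n) v + a (u n) w)); last first.
      by apply/funext => n; rewrite (ipDr ia).
    by apply: cvgD; exact: LP.
  - move=> c v hv; apply/cvg_lim => //.
    rewrite (_ : (fun n => _) = (fun n => c * a (u n) v)); last first.
      by apply/funext => n; rewrite (ipZr ia).
    by apply: cvgM; [exact: cvg_cst|exact: LP].
  - move=> v hv; have LvP : a (u n) v ^+ 2 @[n --> F] --> L v ^+ 2.
      by rewrite expr2; apply: cvgM; exact: LP.
    rewrite -(cvg_lim _ LvP)//; apply: limr_le; first by apply/cvg_ex; exists (L v ^+ 2).
    by apply: nearW => n; exact: sqb.
exists l; split => //; last by move=> v hv; rewrite -lP//; exact: LP.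
have al := ip_ge0 ia hl.
have : (a l l) ^+ 2 <= C * a l l.
  rewrite -[in X in X ^+ 2 <= _]lP//.
  have LvP : a (u n) l ^+ 2 @[n --> F] --> L l ^+ 2.
    by rewrite expr2; apply: cvgM; exact: LP.
  rewrite -(cvg_lim _ LvP)//; apply: limr_le; first by apply/cvg_ex; exists (L l ^+ 2).
  by apply: nearW => n; exact: sqb.
by have [->|a0] := eqVneq (a l l) 0; rewrite // expr2 ler_pM2r// lt_def a0.
Qed.

End bounded_forms.
End inner_product.

Section bottom_of_form.
Context (R : realType) (V : lmodType R) (H : set V) (a : V -> V -> R).
Context (ia : inner_product H a).

(* The infimum m of the form is an approximate eigenvalue: Cauchy-Schwarz for the
   nonnegative form of A - m bounds |(A - m) f|^2 by the form at f. *)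
Lemma bottom_of_form (A : V -> V) (K : R) :
  (forall f, H f -> H (A f)) ->
  (forall f g, H f -> H g -> A (f + g) = A f + A g) ->
  (forall c f, H f -> A (c *: f) = c *: A f) ->
  (forall f g, H f -> H g -> a (A f) g = a f (A g)) ->
  (forall f, H f -> 0 <= a (A f) f <= K * a f f) ->
  (exists2 f, H f & a f f = 1) ->
  exists m : R, (forall f, H f -> m * a f f <= a (A f) f) /\
    (forall e : R, 0 < e -> exists f, [/\ H f, a f f = 1 &
       a (A f - m *: f) (A f - m *: f) <= e]).
Proof.
move=> HA AD AZ AC A0K [f0 Hf0 f01].
have mD := ip_memD ia; have mZ := ip_memZ ia.
pose S := [set a (A f) f | f in [set f | H f /\ a f f = 1]].
have S0 : S !=set0 by exists (a (A f0) f0); exists f0.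
have Slb : lbound S 0 by move=> _ [f [Hf _] <-]; have /andP[] := A0K _ Hf.
have Sinf : has_inf S by split => //; exists 0.
pose m := inf S.
have m0 : 0 <= m by apply: lb_le_inf.
have mle f : H f -> m * a f f <= a (A f) f.
  move=> Hf; have [->|fn0] := eqVneq (a f f) 0.
    by rewrite mulr0; have /andP[] := A0K _ Hf.
  have f_gt0 : 0 < a f f by rewrite lt_def fn0; exact: ip_ge0 ia _ Hf.
  pose s := (Num.sqrt (a f f))^-1.
  have s2 : s ^+ 2 = (a f f)^-1 by rewrite exprVn sqr_sqrtr// ltW.
  rewrite -ler_pdivlMr// mulrC -s2.
  rewrite (_ : s ^+ 2 * a (A f) f = a (A (s *: f)) (s *: f)); last first.
    have HAf := HA _ Hf.
    by rewrite AZ// (ipZl ia) ?(ipZr ia)//; [ring|exact: mZ].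
  apply: ge_inf; first by exists 0.
  exists (s *: f) => //; split; first exact: mZ.
  by rewrite (ip_sqZ ia)// s2 mulVf.
exists m; split => //; pose b u v := a (A u - m *: u) v.
have HB u : H u -> H (A u - m *: u).
  by move=> Hu; apply: (ip_memB ia) => //; [exact: HA|exact: mZ].
have bE u v : H u -> H v -> b u v = a (A u) v - m * a u v.
  move=> Hu Hv; rewrite /b (ipBl ia) ?(ipZl ia)//; [exact: HA|exact: mZ].
have ib : inner_product H b.
  split => //; first exact: ip_mem0 ia.
  - by move=> u v Hu Hv; rewrite !bE// AC// (ipC ia Hu (HA _ Hv)) (ipC ia Hu Hv).
  - move=> u v w Hu Hv Hw; have Huv := mD _ _ Hu Hv.
    rewrite !bE// AD// (ipDl ia (HA _ Hu) (HA _ Hv))// (ipDl ia Hu Hv Hw); ring.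
  - move=> c u v Hu Hv; have Hcu := mZ c _ Hu.
    rewrite !bE// AZ// (ipZl ia _ (HA _ Hu) Hv) (ipZl ia _ Hu Hv); ring.
  - by move=> u Hu; rewrite bE// subr_ge0 mle.
have bK u : H u -> b u u <= K * a u u.
  move=> Hu; rewrite bE//; have /andP[_ AK] := A0K _ Hu.
  have : 0 <= m * a u u by rewrite mulr_ge0//; exact: (ip_ge0 ia).
  by lra.
have K0 : 0 <= K by have /andP[] := A0K _ Hf0; rewrite f01 mulr1; exact: le_trans.
have bsq u : H u -> a (A u - m *: u) (A u - m *: u) <= K * b u u.
  move=> Hu; pose v := A u - m *: u; have Hv : H v := HB _ Hu.
  have h : a v v ^+ 2 <= b u u * b v v := cauchy_schwarz ib Hu Hv.
  rewrite -/v; change (a v v <= K * b u u).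
  have [->|v0] := eqVneq (a v v) 0; first by rewrite mulr_ge0//; exact: (ip_ge0 ib).
  have v_gt0 : 0 < a v v by rewrite lt_def v0; exact: (ip_ge0 ia).
  rewrite -(ler_pM2r v_gt0) -expr2 (le_trans h)//.
  rewrite [leRHS](_ : _ = b u u * (K * a v v)); last by ring.
  by apply: ler_wpM2l; [exact: (ip_ge0 ib)|exact: bK].
move=> e e0; pose K' := K + 1; have K'0 : 0 < K' by rewrite /K'; lra.
have eK : 0 < e / K' by rewrite divr_gt0.
have [_ [f [Hf f1] <-] fe] := inf_adherent eK Sinf.
exists f; split => //; apply: (le_trans (bsq _ Hf)).
have b0 : 0 <= b f f by exact: (ip_ge0 ib).
apply: (@le_trans _ _ (K' * b f f)); first by rewrite ler_wpM2r// /K'; lra.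
rewrite -ler_pdivlMl// mulrC bE// f1 mulr1 lerBlDl.
exact: ltW.
Qed.

End bottom_of_form.

(** * The lattice operator on finitely supported functions *)

Section pointwise.
Context (R : realType) (T : Type).
Implicit Types f g : T -> R^o.

Lemma addfE f g x : (f + g) x = (f x : R) + g x. Proof. by []. Qed.
Lemma oppfE f x : (- f) x = - (f x : R). Proof. by []. Qed.
Lemma scalefE c f x : (c *: f) x = c * (f x : R). Proof. by []. Qed.
Definition pointE := (addfE, oppfE, scalefE).

End pointwise.

Section finite_support.
Context (R : realType) (I : choiceType).
Implicit Types f g h : I -> R^o.

(** The values lie in [R^o], so that functions form an [lmodType]. [bottom_of_form] asks for no
    completeness, hence finite supports suffice, and every sum over the lattice is finite. *)
Definition finsupp : set (I -> R^o) := [set f | finite_set [set k | f k != 0]].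

Definition fdot f g : R := \sum_(k \in [set: I]) (f k * g k : R).

Lemma finsupp_sub f g : finsupp f -> (forall k, f k = 0 -> g k = 0) ->
  finsupp g.
Proof.
move=> ff fg; apply: sub_finite_set ff => k /=.
by apply: contraNN => /eqP fk; rewrite fg.
Qed.

Lemma finsuppP f : finsupp f -> exists s : {fset I}, forall k, k \notin s -> f k = 0.
Proof.
move=> ff; exists (fset_set [set k | f k != 0]) => k.
by rewrite in_fset_set// notin_setE /= => /negP; rewrite negbK => /eqP.
Qed.

Lemma finsuppI f (s : {fset I}) : (forall k, k \notin s -> f k = 0) -> finsupp f.
Proof.
move=> fs; apply: (@sub_finite_set _ _ [set` s]) => // k /=.
by apply: contraNT => /fs ->.
Qed.

Lemma finsuppD f g : finsupp f -> finsupp g -> finsupp (f + g).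
Proof.
move=> /finsuppP[s sf] /finsuppP[t tg]; apply: (@finsuppI _ (s `|` t)%fset) => k.
by rewrite in_fsetU negb_or => /andP[/sf fk /tg gk]; rewrite /GRing.add/= fk gk addr0.
Qed.

Lemma fsumD (F G : I -> R) : finsupp F -> finsupp G ->
  \sum_(k \in [set: I]) (F k + G k) =
  \sum_(k \in [set: I]) F k + \sum_(k \in [set: I]) G k.
Proof.
move=> /finsuppP[s sF] /finsuppP[t tG].
rewrite !(@fsbigTE _ _ _ _ (s `|` t)%fset) ?big_split// => k;
  rewrite in_fsetU negb_or => /andP[/sF Fk /tG Gk] //.
by rewrite Fk Gk addr0.
Qed.

Lemma finsuppMl f g : finsupp f -> finsupp (fun k => f k * g k : R).
Proof. by move=> ff; apply: finsupp_sub ff _ => k ->; rewrite mul0r. Qed.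

Lemma finsupp_inner_product : inner_product finsupp fdot.
Proof.
split.
- by apply: (@finsuppI _ fset0).
- exact: finsuppD.
- by move=> c u fu; apply: finsupp_sub fu _ => k uk; rewrite /GRing.scale/= uk scaler0.
- by move=> u v _ _; apply: eq_fsbigr => k _; rewrite mulrC.
- move=> u v w fu fv fw; rewrite /fdot -fsumD; try exact: finsuppMl.
  by apply: eq_fsbigr => k _; rewrite mulrDl.
- move=> c u v fu fv; rewrite /fdot mulr_fsumr; apply: eq_fsbigr => k _.
  by rewrite mulrA.
- by move=> u fu; apply: fsumr_ge0 => k _; exact: sqr_ge0.
Qed.

Lemma fdot_comp (h k : I -> I) f g : cancel h k -> cancel k h ->
  fdot (f \o h) g = fdot f (g \o k).
Proof.
move=> hK kK; rewrite /fdot (reindex_fsbigT k); last by exists h.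
by apply: eq_fsbigr => i _ /=; rewrite kK.
Qed.

Lemma finsupp_comp (h k : I -> I) f : cancel h k -> cancel k h ->
  finsupp f -> finsupp (f \o h).
Proof.
move=> hK kK /finsuppP[s sf]; apply: (@finsuppI _ (k @` s)%fset) => i ki.
apply: sf; apply: contra ki => his; apply/imfsetP; by exists (h i) => //=; rewrite hK.
Qed.

End finite_support.

Section discrete.
Context (R : realType) (d : nat).
Local Notation Zd := 'rV[int]_d.
Implicit Types (f g : Zd -> R^o) (W : Zd -> R).

Definition shift (e : Zd) f : Zd -> R^o := fun k => f (k + e).

Definition potential W f : Zd -> R^o := fun k => W k * f k.

(** [W] is an arbitrary function on the lattice: besides [V] on theta Z^d, the argument uses the
    restriction of [V] to each translate x + theta Z^d. *)
Definition discrete_operator W f : Zd -> R^o :=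
  (2 * d)%:R *: f
  - \sum_(i < d) (shift (delta_mx ord0 i) f + shift (- delta_mx ord0 i) f)
  + potential W f.

Local Notation H := (@finsupp R Zd).
Local Notation ia := (@finsupp_inner_product R Zd).

Lemma finsupp_shift e f : H f -> H (shift e f).
Proof.
by apply: (@finsupp_comp _ _ (fun k => k + e) (fun k => k - e)) => k;
   rewrite ?addrK ?subrK.
Qed.

Lemma fdot_shift e f g : fdot (shift e f) g = fdot f (shift (- e) g).
Proof.
by apply: (@fdot_comp _ _ (fun k => k + e) (fun k => k - e)) => k;
   rewrite ?addrK ?subrK.
Qed.

Lemma finsupp_potential W f : H f -> H (potential W f).
Proof. by move=> ff; apply: finsupp_sub ff _ => k; rewrite /potential => ->; rewrite mulr0. Qed.

Lemma fdot_potential W f g : fdot (potential W f) g = fdot f (potential W g).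
Proof. by apply: eq_fsbigr => k _; rewrite /potential mulrCA mulrA. Qed.

Let Hs f (i : 'I_d) : H f ->
  H (shift (delta_mx ord0 i) f + shift (- delta_mx ord0 i) f).
Proof. by move=> Hf; apply: finsuppD; exact: finsupp_shift. Qed.

Lemma finsupp_discrete W f : H f -> H (discrete_operator W f).
Proof.
move=> Hf; apply: finsuppD; last exact: finsupp_potential.
apply: (ip_memB ia); first exact: (ip_memZ ia).
by apply: (ip_mem_sum ia) => i _; exact: Hs.
Qed.

Lemma fdot_discrete W f g : H f -> H g -> fdot (discrete_operator W f) g =
  (2 * d)%:R * fdot f g - \sum_(i < d) (fdot (shift (delta_mx ord0 i) f) g
     + fdot (shift (- delta_mx ord0 i) f) g) + fdot (potential W f) g.
Proof.
move=> Hf Hg; have HZ := ip_memZ ia (2 * d)%:R Hf.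
have HW := finsupp_potential W Hf.
have HS : H (\sum_(i < d) (shift (delta_mx ord0 i) f + shift (- delta_mx ord0 i) f)).
  by apply: (ip_mem_sum ia) => i _; exact: Hs.
rewrite (ipDl ia)//; last exact: (ip_memB ia).
rewrite (ipBl ia)// (ipZl ia)//; congr (_ - _ + _).
rewrite (ip_suml ia)//; last by move=> i _; exact: Hs.
by apply: eq_bigr => i _; rewrite (ipDl ia)//; exact: finsupp_shift.
Qed.

Lemma discrete_operator_symmetric W f g : H f -> H g ->
  fdot (discrete_operator W f) g = fdot f (discrete_operator W g).
Proof.
move=> Hf Hg; rewrite [RHS](ipC ia)//; last exact: finsupp_discrete.
rewrite !fdot_discrete// (ipC ia Hf Hg) fdot_potential.
rewrite [fdot f _](ipC ia)//; last exact: finsupp_potential.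
congr (_ - _ + _); apply: eq_bigr => i _.
rewrite [in LHS]fdot_shift [X in _ + X = _]fdot_shift opprK addrC.
by congr (_ + _); apply: (ipC ia) => //; exact: finsupp_shift.
Qed.

Lemma discrete_operatorE W f k : discrete_operator W f k =
  (2 * d)%:R * f k - \sum_(i < d) (f (k + delta_mx ord0 i) + f (k - delta_mx ord0 i))
  + W k * f k.
Proof. by congr (_ - _ + _); rewrite fct_sumE. Qed.

Lemma discrete_operatorD W f g :
  discrete_operator W (f + g) = discrete_operator W f + discrete_operator W g.
Proof.
apply/funext => k; rewrite addfE !discrete_operatorE.
rewrite (eq_bigr (fun i => (f (k + delta_mx ord0 i) + f (k - delta_mx ord0 i)) +
  (g (k + delta_mx ord0 i) + g (k - delta_mx ord0 i)))); last first.
  by move=> i _; rewrite addrACA.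
rewrite big_split/= addfE.
by move: (\sum_(i < d) _) (\sum_(i < d) _) (f k) (g k) => x y p q; ring.
Qed.

Lemma discrete_operatorZ W c f :
  discrete_operator W (c *: f) = c *: discrete_operator W f.
Proof.
apply/funext => k; rewrite scalefE !discrete_operatorE.
rewrite (eq_bigr (fun i => c * (f (k + delta_mx ord0 i) + f (k - delta_mx ord0 i)))); last first.
  by move=> i _; rewrite mulrDr.
rewrite -mulr_sumr scalefE.
by move: (\sum_(i < d) _) (f k) => x p; ring.
Qed.

Lemma fdot_shift_le e f : H f -> `|fdot (shift e f) f| <= fdot f f.
Proof.
move=> Hf; have Hs1 := finsupp_shift e Hf; have f0 := ip_ge0 ia Hf.
rewrite -(@ler_pXn2r _ 2)// ?nnegrE// real_normK ?num_real//.
rewrite (le_trans (cauchy_schwarz ia Hs1 Hf))// fdot_shift expr2.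
rewrite (_ : shift _ _ = f)//; apply/funext => k; by rewrite /shift subrK.
Qed.

(** The diagonal contributes 2d, and each of the 2d shifts, being unitary, at most 1 in absolute
    value. *)
Lemma discrete_form_bounds W M f : (forall k, 0 <= W k <= M) -> H f ->
  0 <= fdot (discrete_operator W f) f <= (4 * d%:R + M) * fdot f f.
Proof.
move=> WM Hf; rewrite fdot_discrete//.
have Wf : 0 <= fdot (potential W f) f <= M * fdot f f.
  apply/andP; split.
    apply: fsumr_ge0 => k _; rewrite /potential -mulrA mulr_ge0 ?sqr_ge0//.
    by have /andP[] := WM k.
  rewrite -subr_ge0 -(ipZl ia)// -(ipBl ia)//; last exact: finsupp_potential.
    apply: fsumr_ge0 => k _; rewrite !pointE /potential -mulrBl -mulrA.
    by rewrite mulr_ge0 ?sqr_ge0// subr_ge0; have /andP[] := WM k.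
  exact: (ip_memZ ia).
have := ler_norm_sum (index_enum 'I_d) (fun i => fdot (shift (delta_mx ord0 i) f) f
     + fdot (shift (- delta_mx ord0 i) f) f) xpredT.
set s := \sum_(i < d) _; set t := \sum_(i < d) _ => st.
have : t <= \sum_(i < d) (2 * fdot f f).
  apply: ler_sum => i _; rewrite (le_trans (ler_normD _ _))//.
  have := fdot_shift_le (delta_mx ord0 i) Hf.
  have := fdot_shift_le (- delta_mx ord0 i) Hf.
  by lra.
rewrite sumr_const card_ord -mulr_natl natrM => tf.
have := ler_norm s; have := ler_norm (- s); rewrite normrN.
move: Wf => /andP[]; lra.
Qed.

Lemma l2normE f : H f -> l2norm f = (Num.sqrt (fdot f f))%:E.
Proof.
move=> Hf; rewrite /l2norm.
pose S := [set k | f k != 0].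
rewrite (_ : esum _ _ = (fdot f f)%:E)//.
transitivity (\esum_(k in S) ((f k) ^+ 2)%:E)%E.
  rewrite [RHS]esum_mkcond; apply: eq_esum => k _; case: ifPn => //.
  by rewrite notin_setE /S/= => /negP; rewrite negbK => /eqP ->; rewrite expr0n.
rewrite esum_fset//; last by move=> k _; rewrite lee_fin sqr_ge0.
rewrite fsbig_finite// sumEFin; congr EFin.
rewrite /fdot (@fsbigTE _ _ _ _ (fset_set S)) => [|k]; first by [].
by rewrite in_fset_set// notin_setE /S/= => /negP; rewrite negbK => /eqP ->; rewrite mulr0.
Qed.

End discrete.

Section bottom.
Context (R : realType) (d : nat).

(** A bound [C] on the inverse of A_theta - m is contradicted by normalized finitely supported [f]
    with (A_theta - m) f small, so [m] lies in the spectrum. *)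
Lemma mu_A_le_form (V : 'rV[R]_d -> R) (theta M : R) :
  (forall x, 0 <= V x <= M) -> exists m : R,
  (mu_A V theta <= m%:E)%E /\
  forall f, finsupp f ->
    m * fdot f f <= fdot (discrete_operator (V \o lattice_point theta) f) f.
Proof.
move=> VM; set W := V \o _; have ia := @finsupp_inner_product R 'rV[int]_d.
have [||||||m [mle mapp]] := @bottom_of_form R _ _ _ ia (discrete_operator W) (4 * d%:R + M).
- exact: finsupp_discrete.
- by move=> f g _ _; exact: discrete_operatorD.
- by move=> c f _; exact: discrete_operatorZ.
- exact: discrete_operator_symmetric.
- by move=> f Hf; apply: discrete_form_bounds => // k; exact: VM.
- exists (fun k => (k == 0)%:R); first by apply: (@finsuppI _ _ _ [fset 0]%fset) => k; rewrite in_fset1 => /negbTE ->.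
  rewrite /fdot (@fsbigTE _ _ _ _ [fset 0]%fset) => [|k]; last by rewrite in_fset1 => /negbTE ->; rewrite mul0r.
  by rewrite big_seq_fset1 eqxx mulr1.
exists m; split => //; apply: ereal_inf_lbound; exists m => // -[_ _ [C CP]].
have HB f : finsupp f -> finsupp (discrete_operator W f - m *: f).
  by move=> Hf; apply: (ip_memB ia); [exact: finsupp_discrete|exact: (ip_memZ ia)].
have C2 f : finsupp f -> Num.sqrt (fdot f f) <=
   C * Num.sqrt (fdot (discrete_operator W f - m *: f) (discrete_operator W f - m *: f)).
  move=> Hf; have := CP f (discrete_operator W f - m *: f).
  rewrite !l2normE//; last exact: HB.
  rewrite -EFinM lee_fin; apply; exists (discrete_schrodinger V theta f).
    by split => //; rewrite /l2/= l2normE// ltry.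
  by apply/funext => k; rewrite !pointE discrete_operatorE.
(* The residual then has norm at most 1/(2(|C| + 1)), so [C] times it stays below 1, the norm of
   [f]. *)
pose e : R := (2 * (`|C| + 1)) ^- 2.
have C1 : 0 < 2 * (`|C| + 1) by rewrite mulr_gt0// ltr_pwDr.
have [|f [Hf f1 fe]] := mapp e; first by rewrite invr_gt0 exprn_gt0.
have := C2 _ Hf; rewrite f1 sqrtr1.
have : Num.sqrt (fdot (discrete_operator W f - m *: f) (discrete_operator W f - m *: f))
   <= (2 * (`|C| + 1))^-1.
  rewrite (le_trans (ler_wsqrtr fe))// /e -exprVn sqrtr_sqr ger0_norm// invr_ge0 ltW//.
have := sqrtr_ge0 (fdot (discrete_operator W f - m *: f) (discrete_operator W f - m *: f)).
move: (Num.sqrt _) => s s0 sle C1s.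
have := ler_norm C; have := normr_ge0 C => nC0 nC.
have : C * s <= `|C| * (2 * (`|C| + 1))^-1.
  by rewrite (@le_trans _ _ (`|C| * s))// ?ler_wpM2r// ler_wpM2l.
move=> /(le_trans C1s); rewrite leNgt => /negP; apply.
rewrite ltr_pdivrMr// mul1r; lra.
Qed.

End bottom.

(** * Density of the orbit of theta and translated potentials *)

Section density.
Context (R : realType) (theta : R) (theta_irr : irrational theta).

(** Otherwise the group generated by 1 and theta is discrete, hence consists of the multiples of its
    least positive element [c]; then theta is a quotient of two integers. *)
Lemma irrational_small_combination (e : R) : 0 < e ->
  exists n m : int, 0 < n%:~R * theta + m%:~R < e.
Proof.
move=> e0; apply: contrapT => noS.
pose S := [set s : R | 0 < s /\ exists n m : int, s = n%:~R * theta + m%:~R].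
have Se s : S s -> e <= s.
  move=> [s0 [n [m sE]]]; rewrite leNgt; apply/negP => se; apply: noS.
  by exists n, m; rewrite -sE s0.
have S1 : S 1 by split => //; exists 0, 1; rewrite mul0r add0r.
have Sinf : has_inf S by split; [exists 1|exists e].
pose c := inf S; have ec : e <= c by apply: lb_le_inf => //; exists 1.
have c0 : 0 < c by exact: lt_le_trans ec.
have cS s : S s -> c <= s by move=> Ss; apply: ge_inf => //; exists e.
have SB s t : S s -> S t -> t < s -> S (s - t).
  move=> [_ [n [m ->]]] [_ [n' [m' ->]]] ts; split; first by rewrite subr_gt0.
  by exists (n - n'), (m - m'); rewrite !intrB; ring.
(* If the infimum were not attained, two distinct elements of [S] within [e] of [c] would have a
   difference in [S] smaller than [e]. *)
have Sc : S c.
  have [s Ss sce] := inf_adherent e0 Sinf.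
  have := cS _ Ss; rewrite le_eqVlt => /orP[/eqP -> //|cs].
  have [|t St tsc] := @inf_adherent _ S (s - c) _ Sinf; first by rewrite subr_gt0.
  have ts : t < s by move: tsc; rewrite -/c; lra.
  have := Se _ (SB _ _ Ss St ts); have := cS _ St; move: sce; rewrite -/c; lra.
(* Euclidean division by [c]: a nonzero remainder would be an element of [S] below [c]. *)
have mult n m : exists a : int, n%:~R * theta + m%:~R = a%:~R * c.
  pose g := n%:~R * theta + m%:~R.
  exists (Num.floor (g / c)); rewrite -/g.
  have := floor_le_tmp (g / c); have := lt_succ_floor (g / c).
  rewrite ler_pdivlMr// ltr_pdivrMr// intrD mulrDl mul1r.
  set a := Num.floor _ => ga ag; apply/eqP; rewrite eq_le ag andbT leNgt.
  apply/negP => gt; have /cS : S (g - a%:~R * c); last by lra.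
  split; first by rewrite subr_gt0.
  move: Sc => [_ [n' [m' ->]]]; exists (n - a * n'), (m - a * m').
  by rewrite /g !intrB !intrM; ring.
have [a] := mult 0 1; rewrite mul0r add0r => aE.
have [b] := mult 1 0; rewrite mul1r addr0 => bE.
have a0 : 0 < a.
  by rewrite -(ltr0z R) -(pmulr_lgt0 _ c0) -aE.
apply: theta_irr; apply/rationalP; exists b, `|a|%N.
have -> : `|a|%N%:R = a%:~R :> R by rewrite -{2}(gtz0_abs a0).
have an0 : a%:~R != 0 :> R by rewrite intr_eq0 gt_eqF.
apply: (mulIf an0); rewrite mulfVK//.
by rewrite bE mulrAC -mulrA -aE mulr1.
Qed.

(** [x] is rounded down to a multiple of a combination [s] with 0 < s < e. *)
Lemma irrational_dense (x e : R) : 0 < e ->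
  exists n m : int, `|theta * n%:~R + m%:~R - x| < e.
Proof.
move=> /irrational_small_combination[n [m /andP[s0 se]]].
pose s := n%:~R * theta + m%:~R; pose a := Num.floor (x / s).
have := floor_le_tmp (x / s); have := lt_succ_floor (x / s).
rewrite ler_pdivlMr// ltr_pdivrMr// intrD mulrDl mul1r -/a -/s => h1 h2.
exists (a * n), (a * m).
rewrite (_ : theta * _ + _ = a%:~R * s); last by rewrite /s !intrM; ring.
by rewrite ltr_norml; apply/andP; split; rewrite -?/s in se; lra.
Qed.

(** The coordinates of the lattice point can be chosen independently, so the one-dimensional
    statement is used in each. *)
Lemma irrational_dense_rV d (x : 'rV[R]_d) (e : R) : 0 < e ->
  exists n p : 'rV[int]_d,
    ball x e (theta *: map_mx intr n + map_mx intr p).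
Proof.
move=> e0; have /choice[n nP] j := irrational_dense (x ord0 j) e0.
have /choice[p np] := nP.
exists (\row_j n j), (\row_j p j); split => // i j.
by rewrite /ball/= !mxE ord1 distrC; exact: np.
Qed.

End density.

Section shifted_form.
Context (R : realType) (d : nat) (V : 'rV[R]_d -> R) (V_cont : continuous V).
Context (V_per : forall (x : 'rV[R]_d) (k : 'rV[int]_d), V (x + map_mx intr k) = V x).
Context (theta : R) (theta_irr : irrational theta).
Local Notation ia := (@finsupp_inner_product R 'rV[int]_d).

Lemma near_seq (T : eqType) (F : set_system 'rV[R]_d) {FF : Filter F}
   (P : T -> 'rV[R]_d -> Prop) (s : seq T) :
  (forall k, \forall y \near F, P k y) ->
  \forall y \near F, forall k, k \in s -> P k y.
Proof.
move=> FP; elim: s => [|k s IH]; first exact: nearW.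
near=> y; move=> j; rewrite in_cons => /orP[/eqP ->|js].
  by near: y; exact: FP.
by move: j js; near: y.
Unshelve. all: by end_near. Qed.

Lemma fdot_discreteB (W W' : 'rV[int]_d -> R) f : finsupp f ->
  fdot (discrete_operator W f) f - fdot (discrete_operator W' f) f =
  fdot (potential W f) f - fdot (potential W' f) f.
Proof. by move=> Hf; rewrite !fdot_discrete//; ring. Qed.

(** The difference part commutes with shifts, so shifting [f] amounts to shifting the potential the
    other way. *)
Lemma discrete_form_shift (W : 'rV[int]_d -> R) f n : finsupp f ->
  fdot (discrete_operator W (shift (- n) f)) (shift (- n) f) =
  fdot (discrete_operator (fun k => W (k + n)) f) f.
Proof.
move=> Hf; rewrite [RHS](_ : _ = fdot (shift n (discrete_operator W (shift (- n) f))) f).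
  by rewrite [RHS]fdot_shift.
congr fdot; apply/funext => k; have kn : k + n - n = k by rewrite addrK.
rewrite /shift !discrete_operatorE kn.
congr (_ - _ + _); apply: eq_bigr => i _.
by congr (f _ + f _); rewrite addrAC addrK.
Qed.

(** Only the finitely many values of V(x + theta k) with k in the support of [f] matter. By density
    and periodicity some [n] makes all of them [e]-close to V(theta (k + n)); the two forms then
    differ by at most [e * fdot f f], and the second is the original form at a shift of [f]. *)
Lemma shifted_form (m : R) :
  (forall f, finsupp f ->
    m * fdot f f <= fdot (discrete_operator (V \o lattice_point theta) f) f) ->
  forall x f, finsupp f ->
    m * fdot f f <=
    fdot (discrete_operator (fun k => V (x + lattice_point theta k)) f) f.
Proof.
move=> hm x f Hf; rewrite -subr_le0; apply: (@le_epsilonM _ _ (fdot f f)) => e e0.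
have [s fs] := finsuppP Hf.
have : \forall y \near x, forall k, k \in enum_fset s ->
    `|V (x + lattice_point theta k) - V (y + lattice_point theta k)| < e.
  apply: (@near_seq _ (nbhs x) _ (fun k y => `|V (x + lattice_point theta k) -
    V (y + lattice_point theta k)| < e)) => k.
  have : {for x, continuous (V \o (fun y => y + lattice_point theta k))}.
    apply: continuous_comp; last exact: V_cont.
    by apply: (@cvgD _ _ _ (nbhs x) _ id (cst _) x); [exact: cvg_id|exact: cvg_cst].
  by move=> /cvgrPdist_lt; exact.
move=> /nbhs_ballP[e1 /= e10 he1].
have [n [p npx]] := irrational_dense_rV theta_irr x e10.
have {}he1 k : k \in enum_fset s -> `|V (x + lattice_point theta k) -
    V (lattice_point theta (k + n))| < e.
  move=> /(he1 _ npx); rewrite (_ : _ + _ + _ =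
     lattice_point theta (k + n) + map_mx intr p) ?V_per//.
  by apply/rowP => j; rewrite !mxE intrD; ring.
have := hm _ (finsupp_shift (- n) Hf).
rewrite discrete_form_shift// fdot_shift opprK.
rewrite [shift n _](_ : _ = f); last by apply/funext => k; rewrite /shift addrK.
set W' := fun k => _.
move=> h; rewrite lerBlDr (le_trans h)// -lerBlDr fdot_discreteB//.
rewrite -(ipBl ia) -?(ipZl ia)//; try exact: finsupp_potential.
rewrite -subr_ge0 -(ipBl ia)//; last 2 first.
- exact: (ip_memZ ia).
- by apply: (ip_memB ia); exact: finsupp_potential.
apply: fsumr_ge0 => k _; rewrite !pointE /potential -mulrBl.
have [ks|ks] := boolP (k \in s); last by rewrite fs// mulr0.
rewrite -mulrBl -mulrA mulr_ge0 ?sqr_ge0// subr_ge0.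
rewrite (le_trans (ler_norm _))// distrC; apply/ltW/he1.
exact: ks.
Qed.

End shifted_form.

(** * Lebesgue measure on row vectors *)

Section rV_measure.
Context (R : realType).

Lemma lebesgue_measure_shift (a : R) (A : set (measurableTypeR R)) : measurable A ->
  lebesgue_measure ((fun x : measurableTypeR R => x + a : measurableTypeR R) @^-1` A) = lebesgue_measure A.
Proof.
have ma : measurable_fun setT (fun x : measurableTypeR R => x + a : measurableTypeR R).
  by apply: measurable_funD => //; exact: measurable_cst.
move=> mA; symmetry.
apply: (@lebesgue_measure_unique R (pushforward (@lebesgue_measure R) _)) => //=.
move=> _ [[b c]] _ <-.
rewrite /pushforward (_ : _ @^-1` _ = `]b - a, c - a]%classic); last first.
  by apply/seteqP; split => x /=; rewrite !in_itv/= ltrBlDr lerBrDr.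
rewrite !lebesgue_measure_itv/= !lte_fin ltrD2r.
by case: ifP => // _; rewrite -!EFinD; congr EFin; ring.
Qed.

Lemma measurable_rV_coordP n (i : 'I_n) :
  measurable_fun [set: 'rV[R]_n] (fun x => x ord0 i).
Proof. exact: measurable_rV_coord. Qed.

Lemma measurable_rV_shift n (a : 'rV[R]_n) : measurable_fun [set: 'rV[R]_n] (fun x : 'rV[R]_n => x + a : 'rV[R]_n).
Proof.
apply: measurable_fun_rV => i.
rewrite (_ : _ \o _ = (fun x : 'rV[R]_n => x ord0 i + a ord0 i)).
  by apply: measurable_funD => //; exact: measurable_rV_coordP.
by apply/funext => x; rewrite /= /rV_coord mxE.
Qed.

(** Under [rV_cons] a translation acts separately on the first coordinate and on the tail, and a
    product measure is determined by its values on rectangles. *)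
Lemma lebesgue_rV_shift n (a : 'rV[R]_n) A : measurable A ->
  lebesgue_rV n ((fun x : 'rV[R]_n => x + a) @^-1` A) = lebesgue_rV n A.
Proof.
elim: n a A => [|n IH] a A mA.
  by congr (lebesgue_rV 0 _); apply/seteqP; split => x /=; rewrite !thinmx0.
rewrite /= /rV_step /pushforward.
pose a0 := a ord0 ord0; pose a' : 'rV[R]_n := \row_j a ord0 (lift ord0 j).
pose S (p : measurableTypeR R * 'rV[R]_n) : measurableTypeR R * 'rV[R]_n :=
  (p.1 + a0, p.2 + a').
have mS : measurable_fun setT S.
  apply/measurable_fun_pairP; split.
    by apply: measurable_funD => //; exact: measurable_cst.
  exact: (measurableT_comp (measurable_rV_shift a')).
have mB : measurable (rV_cons (n:=n) @^-1` A).
  by rewrite -[X in measurable X]setTI; exact: measurable_rV_cons.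
rewrite (_ : _ @^-1` _ = S @^-1` (rV_cons (n:=n) @^-1` A)); last first.
  have E p : rV_cons p + a = rV_cons (S p).
    apply/rowP => j; rewrite mxE; case: (unliftP ord0 j) => [k|] ->.
      by rewrite !rV_consS !mxE.
    by rewrite !rV_cons0.
  by apply/seteqP; split => p /=; rewrite E.
symmetry.
apply: (@product_measure_unique _ _ _ _ _ _ _ (pushforward (@lebesgue_measure R \x lebesgue_rV n)%E S)) => //.
move=> B C mB' mC; rewrite /= /pushforward.
rewrite (_ : _ @^-1` _ = ((fun x => x + a0) @^-1` B) `*` ((fun x => x + a') @^-1` C)); last first.
  by apply/seteqP; split.
rewrite product_measure1E ?IH//.
- by congr (_ * _)%E; exact: lebesgue_measure_shift.
- rewrite -[X in measurable X]setTI.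
  by apply: measurable_funD => //; exact: measurable_cst.
- by rewrite -[X in measurable X]setTI; exact: measurable_rV_shift.
Qed.

(** Boxes have finite measure, generate the sigma-algebra, are stable under intersection, and their
    indicators are limits of test functions; the proof that test functions are total rests on these
    four facts. *)
Definition open_box n (a b : 'I_n -> R) : set 'rV[R]_n :=
  [set x | forall i, a i < x ord0 i < b i].

Lemma measurable_open_box n (a b : 'I_n -> R) : measurable (open_box a b).
Proof.
rewrite (_ : open_box a b = \bigcap_(i in [set: 'I_n])
    ((fun x : 'rV[R]_n => x ord0 i) @^-1` `]a i, b i[%classic)).
  apply: fin_bigcap_measurable => // i _; rewrite -[X in measurable X]setTI.
  by apply: measurable_rV_coordP => //; exact: measurable_itv.
by apply/seteqP; split => x /= h i; have := h i; rewrite /= ?in_itv/=; [move=> + _|exact].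
Qed.

Lemma lebesgue_rV_box n (M : R) :
  (lebesgue_rV n (@open_box n (fun=> - M)%R (fun=> M)) < +oo)%E.
Proof.
elim: n => [|n IH].
  by rewrite /= diracE; case: (_ \in _); rewrite ltry.
rewrite /= /rV_step /pushforward.
rewrite (_ : _ @^-1` _ = `]- M, M[%classic `*` open_box (fun=> - M) (fun=> M)); last first.
  apply/seteqP; split => -[x y] /=.
    move=> h; split; first by have := h ord0; rewrite rV_cons0 in_itv.
    by move=> i; have := h (lift ord0 i); rewrite rV_consS.
  rewrite in_itv/= => -[h1 h2] j; case: (unliftP ord0 j) => [k|] ->.
    by rewrite rV_consS; exact: h2.
  by rewrite rV_cons0.
rewrite product_measure1E//; last exact: measurable_open_box.
have itv : (lebesgue_measure (`](- M)%R, M%R[%classic : set R) < +oo)%E.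
  by rewrite lebesgue_measure_itv/=; case: ifP => _; rewrite ?ltry// -EFinN -EFinD ltry.
by apply: lte_mul_pinfty => //; rewrite ge0_fin_numE//; exact: itv.
Qed.

(** The half-space a < x_i is the union of boxes keeping the endpoint a in coordinate i while all
    other bounds go to infinity. *)
Lemma measurable_rV_generated n : @measurable _ 'rV[R]_n =
  <<s [set A | exists a b : 'I_n -> R, A = open_box a b] >>.
Proof.
apply/seteqP; split; last first.
  apply: smallest_sub; first exact: sigma_algebra_measurable.
  by move=> _ [a [b ->]]; exact: measurable_open_box.
set G := [set A | _]; apply: smallest_sub; first exact: smallest_sigma_algebra.
move=> A; rewrite -bigcup_seq => -[i _ [B mB <-]].
have : measurable_fun [set: g_sigma_algebraType G] (fun x : g_sigma_algebraType G => x ord0 i).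
  apply: (measurability _ (RGenOInfty.measurableE R)).
  move=> _ [_ [a ->] <-]; rewrite setTI.
  rewrite (_ : _ @^-1` _ = \bigcup_N open_box
    (fun j => if j == i then a else - N%:R) (fun j => N%:R)).
    by apply: bigcup_measurable => N _; apply: sub_sigma_algebra; eexists; eexists.
  apply/seteqP; split => x /=; last first.
    by move=> [N _ /(_ i)]; rewrite eqxx in_itv/= andbT => /andP[].
  rewrite in_itv/= andbT => ax.
  pose M := \sum_j `|x ord0 j|.
  have xM j : `|x ord0 j| <= M by rewrite /M (bigD1 j)//= lerDl sumr_ge0.
  have [N MN] : exists N : nat, M < N%:R by exists (Num.bound M); apply: archi_boundP; exact: sumr_ge0.
  exists N => // j; have := le_lt_trans (xM j) MN.
  rewrite ltr_norml => /andP[h1 h2]; rewrite h2 andbT.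
  by case: eqP => [->|_]; [exact: ax|exact: h1].
by move=> /(_ measurableT B mB).
Qed.

(* [f] is the pointwise limit of its values at the rounded points of a grid. *)
Lemma measurable_rV_continuous n (f : 'rV[R]_n -> R) : continuous f ->
  measurable_fun [set: 'rV[R]_n] f.
Proof.
move=> cf; pose g (N : nat) (x : 'rV[R]_n) : 'rV[R]_n :=
  \row_j ((Num.floor (N.+1%:R * x ord0 j))%:~R / N.+1%:R).
apply: (@measurable_fun_cvg _ _ _ _ (fun N => f \o g N)).
  move=> N _ Y mY; rewrite setTI.
  (* [f \o g N] is constant on each cell, so a preimage is a countable union of cells. *)
  pose cell (k : 'rV[int]_n) := \bigcap_(j in [set: 'I_n])
    ((fun x : 'rV[R]_n => Num.floor (N.+1%:R * x ord0 j)) @^-1` [set k ord0 j]).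
  rewrite (_ : _ @^-1` _ = \bigcup_(k in [set: 'rV[int]_n]) (if `[< Y (f (\row_j ((k ord0 j)%:~R / N.+1%:R))) >] then cell k else set0)).
    apply: countable_bigcupT_measurable => // k; case: ifP => // _.
    apply: fin_bigcap_measurable => // j _.
    rewrite (_ : _ @^-1` _ = (fun x : 'rV[R]_n => x ord0 j) @^-1`
       `[(k ord0 j)%:~R / N.+1%:R, (k ord0 j + 1)%:~R / N.+1%:R [%classic).
      rewrite -[X in measurable X]setTI.
      by apply: measurable_rV_coordP => //; exact: measurable_itv.
    apply/seteqP; split => x /=; rewrite in_itv/= ler_pdivrMr// ltr_pdivlMr// mulrC.
      by move=> <-; rewrite floor_le_tmp lt_succ_floor.
    by move=> /floor_def.
  apply/seteqP; split => x /=.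
    move=> Yx; exists (\row_j Num.floor (N.+1%:R * x ord0 j)) => //.
    rewrite (_ : \row_j _ = g N x); last by apply/rowP => j; rewrite !mxE.
    rewrite ifT; last exact/asboolP.
    by move=> j /= _; rewrite mxE.
  move=> [k _]; case: ifP => // /asboolP Yk; move=> xk.
  rewrite (_ : g N x = \row_j ((k ord0 j)%:~R / N.+1%:R))//.
  by apply/rowP => j; rewrite !mxE; have /= -> := xk j.
move=> x _; apply: (@cvg_comp _ _ _ (fun N => g N x) f _ (nbhs x)); last exact: cf.
apply/cvg_ballP => e e0; have [N _ NP] := near_infty_natSinv_lt (PosNum e0).
exists N => // M NM; split => // i j; rewrite ord1 /ball/= mxE.
have := NP M NM => /=.
have M0 : 0 < M.+1%:R :> R by [].
rewrite -{1}(mulfK (lt0r_neq0 M0) (x ord0 j)) -mulrBl normrM.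
rewrite [X in _ * X]gtr0_norm ?invr_gt0// [_ * M.+1%:R]mulrC => h.
rewrite (le_lt_trans _ h)// ler_piMl ?invr_ge0//.
have := floor_le_tmp (M.+1%:R * x ord0 j); have := lt_succ_floor (M.+1%:R * x ord0 j).
rewrite intrD ler_norml; lra.
Qed.

End rV_measure.

(** * Square-integrable functions *)

Section square_integrable.
Context (d : measure_display) (T : measurableType d) (R : realType).
Context (mu : {measure set T -> \bar R}).
Implicit Types f g h : T -> R^o.

Definition Lsq : set (T -> R^o) := [set f : T -> R | f \in Lfun mu 2%:E].

Definition ip f g : R := \int[mu]_x ((f x : R) * g x).

Lemma Lnorm2E (f : T -> R) :
  'N[mu]_2%:E[EFin \o f]%E = sqrte (\int[mu]_x ((f x) ^+ 2)%:E)%E.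
Proof.
rewrite -poweR12_sqrt; last by apply: integral_ge0 => x _; rewrite lee_fin sqr_ge0.
rewrite unlock; congr (_ `^ _)%E; apply: eq_integral => x _.
by rewrite /= powR_mulrn// real_normK// num_real.
Qed.

Lemma Lfun2P (f : T -> R) : f \in Lfun mu 2%:E <->
  measurable_fun [set: T] f /\ (\int[mu]_x ((f x) ^+ 2)%:E < +oo)%E.
Proof.
have E : finite_norm mu 2%:E f <-> (\int[mu]_x ((f x) ^+ 2)%:E < +oo)%E.
  rewrite /finite_norm Lnorm2E.
  have : (0 <= \int[mu]_x ((f x) ^+ 2)%:E)%E.
    by apply: integral_ge0 => x _; rewrite lee_fin sqr_ge0.
  by case: (\int[mu]_x _)%E => [r| |]//=; rewrite !ltry.
split; rewrite inE.
  move=> /andP[]; rewrite inE/= => mf; rewrite inE/= => ff.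
  by split => //; exact/E.
by move=> [mf fi]; apply/andP; split; rewrite inE//=; exact/E.
Qed.

Lemma LsqP f : Lsq f <-> measurable_fun [set: T] (f : T -> R) /\
  (\int[mu]_x ((f x : R) ^+ 2)%:E < +oo)%E.
Proof. exact: Lfun2P. Qed.

Lemma Lsq_measurable f : Lsq f -> measurable_fun [set: T] (f : T -> R).
Proof. by move=> /LsqP[]. Qed.

Lemma Lsq_le f g : measurable_fun [set: T] (f : T -> R) -> Lsq g ->
  (forall x, `|f x : R| <= `|g x : R|) -> Lsq f.
Proof.
move=> mf /LsqP[mg gi] fg; apply/LsqP; split => //; apply: le_lt_trans gi.
apply: ge0_le_integral => //.
- by move=> x _; rewrite lee_fin; exact: sqr_ge0.
- by apply/measurable_EFinP; exact: measurable_funX.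
- by apply/measurable_EFinP; exact: measurable_funX.
- move=> x _; rewrite lee_fin -[leLHS]real_normK ?num_real//.
  by rewrite -[leRHS]real_normK ?num_real// lerXn2r// nnegrE.
Qed.

Lemma integrable_ip f g : Lsq f -> Lsq g ->
  mu.-integrable [set: T] (EFin \o (fun x => (f x : R) * g x)).
Proof. by move=> Hf Hg; apply/Lfun1_integrable; exact: Lfun2_mul_Lfun1. Qed.

Lemma LsqD f g : Lsq f -> Lsq g -> Lsq (f + g).
Proof.
move=> Hf Hg; have [_ H] := @Lfun_addr_closed _ _ _ mu _ (lee1n 2).
exact: H.
Qed.

Lemma LsqZ c f : Lsq f -> Lsq (c *: f).
Proof.
move=> Hf; have -> : c *: f = (fun x => (f x : R) * c).
  by apply/funext => x; rewrite scalefE mulrC.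
by apply: (@Lfun_scale _ _ _ mu f c 2) => //; rewrite ler1n.
Qed.

Lemma Lsq0 : Lsq 0.
Proof.
apply/LsqP; split; first exact: measurable_cst.
rewrite (eq_integral (cst 0%E)) ?integral0 ?ltry// => x _.
by rewrite /GRing.zero/= expr0n.
Qed.

Lemma Lsq_inner_product : inner_product Lsq ip.
Proof.
split.
- exact: Lsq0.
- exact: LsqD.
- exact: LsqZ.
- by move=> u v _ _; apply: eq_Rintegral => x _; rewrite mulrC.
- move=> u v w Hu Hv Hw; rewrite /ip -RintegralD//; last 2 first.
  + exact: integrable_ip.
  + exact: integrable_ip.
  by apply: eq_Rintegral => x _; rewrite addfE mulrDl.
- move=> c u v Hu Hv; rewrite /ip -RintegralZl//; last exact: integrable_ip.
  by apply: eq_Rintegral => x _; rewrite scalefE mulrA.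
- by move=> u Hu; apply: Rintegral_ge0 => x _; exact: sqr_ge0.
Qed.

Lemma ip_EFin f : Lsq f -> (\int[mu]_x ((f x : R) ^+ 2)%:E)%E = (ip f f)%:E.
Proof.
move=> Hf; rewrite /ip /Rintegral fineK//.
exact: integrable_fin_num (integrable_ip Hf Hf).
Qed.

Lemma ip_sq_le f g : Lsq f -> Lsq g -> (forall x, `|f x : R| <= `|g x : R|) ->
  ip f f <= ip g g.
Proof.
move=> Hf Hg fg; rewrite -lee_fin -!ip_EFin//; apply: ge0_le_integral => //.
- by move=> x _; rewrite lee_fin; exact: sqr_ge0.
- by apply/measurable_EFinP; apply: measurable_funX; exact: Lsq_measurable Hf.
- by apply/measurable_EFinP; apply: measurable_funX; exact: Lsq_measurable Hg.
- move=> x _; rewrite lee_fin -[leLHS]real_normK ?num_real//.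
  by rewrite -[leRHS]real_normK ?num_real// lerXn2r// nnegrE.
Qed.

Lemma Lnorm2_ip f : Lsq f ->
  'N[mu]_2%:E[EFin \o (f : T -> R)]%E = (Num.sqrt (ip f f))%:E.
Proof. by move=> Hf; rewrite Lnorm2E ip_EFin. Qed.

End square_integrable.

(** * Completeness of L^2 *)

Section completeness.
Context (d : measure_display) (T : measurableType d) (R : realType).
Context (mu : {measure set T -> \bar R}).
Local Notation Lsq := (@Lsq d T R mu).
Local Notation ip := (@ip d T R mu).
Local Notation ia := (@Lsq_inner_product d T R mu).

(** The weight 4^k forces increments of size at most sqrt(G) 2^-k, a summable series. *)
Lemma cvg_of_weighted_increments (v : nat -> R) (G : R) :
  (forall k, 4 ^+ k * (v k.+1 - v k) ^+ 2 <= G) -> cvgn v.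
Proof.
move=> vG; have G0 : 0 <= G by rewrite (le_trans _ (vG 0%N))// mulr_ge0 ?sqr_ge0.
have incr k : `|telescope v k| <= geometric (Num.sqrt G) 2^-1 k.
  rewrite /telescope/= -(@ler_pXn2r _ 2)// ?nnegrE ?mulr_ge0 ?sqrtr_ge0 ?exprn_ge0//.
  rewrite real_normK ?num_real// exprMn sqr_sqrtr// -exprM mulnC exprM.
  have := vG k; rewrite -ler_pdivlMl ?exprn_gt0// => /le_trans; apply.
  by rewrite mulrC -exprVn expr2 -invfM -natrM.
suff : cvgn (series (telescope v)).
  move=> cs; rewrite (_ : v = fun n => v 0%N + series (telescope v) n).
    by apply: is_cvgD => //; exact: is_cvg_cst.
  by apply/funext => n; rewrite -eq_sum_telescope.
apply: normed_cvg; apply: (series_le_cvg _ _ incr) => //.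
  by move=> n; rewrite /geometric/= mulr_ge0 ?sqrtr_ge0 ?exprn_ge0.
by apply: is_cvg_geometric_series; rewrite gtr0_norm ?invf_lt1 ?ltr1n.
Qed.

Lemma ip_ae_eq f g h k : Lsq f -> Lsq g -> Lsq h -> Lsq k ->
  {ae mu, forall x, f x = g x} -> {ae mu, forall x, h x = k x} ->
  ip f h = ip g k.
Proof.
move=> Hf Hg Hh Hk fg hk; rewrite /ip /Rintegral; congr fine.
apply: ae_eq_integral => //.
- exact: measurable_int (integrable_ip Hf Hh).
- exact: measurable_int (integrable_ip Hg Hk).
- by apply: filterS2 fg hk => x fgx hkx _; rewrite fgx hkx.
Qed.

(* Along a subsequence the squared increments, weighted by 4^k, are summable almost
   everywhere, so the subsequence converges geometrically there. *)
Lemma Lsq_complete : ip_complete Lsq ip.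
Proof.
move=> u Hu cu.
(* The factor 16^-k leaves 4^-k after multiplication by the weight 4^k, which is still summable. *)
have /choice[N0 N0P] k : exists N, forall n m, (N <= n)%N -> (N <= m)%N ->
    ip (u n - u m) (u n - u m) <= 16 ^- k :> R.
  by apply: cu; rewrite invr_gt0 exprn_gt0.
pose N k := (\sum_(i < k.+1) N0 i)%N.
have N0N k : (N0 k <= N k)%N by rewrite /N big_ord_recr leq_addl.
have NS k : (N k <= N k.+1)%N by rewrite /N [X in (_ <= X)%N]big_ord_recr leq_addr.
have Nmono k j : (k <= j)%N -> (N k <= N j)%N by apply: (homo_leq (leqnn) leq_trans).
pose v k := u (N k).
have Hv k : Lsq (v k) by exact: Hu.
have HvB k : Lsq (v k.+1 - v k) by apply: (ip_memB ia).
pose g k x : \bar R := (4 ^+ k * (v k.+1 x - v k x : R) ^+ 2)%:E.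
have g0 k x : (0 <= g k x)%E.
  by rewrite lee_fin; apply: mulr_ge0; [exact: exprn_ge0|exact: sqr_ge0].
have mg k : measurable_fun [set: T] (g k).
  apply/measurable_EFinP; apply: measurable_funM; first exact: measurable_cst.
  by apply: measurable_funX; apply: measurable_funB; exact: Lsq_measurable.
pose G x := (\sum_(0 <= k <oo) g k x)%E.
have mG : measurable_fun [set: T] G.
  by apply: ge0_emeasurable_sum => // k x _ _; exact: g0.
have intG : (\int[mu]_x G x < +oo)%E.
  rewrite /G integral_nneseries//.
  apply: (@le_lt_trans _ _ (\sum_(0 <= k <oo) (4 ^- k)%:E)%E).
    apply: lee_nneseries => k _ //; first by move=> _; apply: integral_ge0 => x _; exact: g0.
    rewrite (eq_integral (fun x => (4 ^+ k)%:E * ((((v k.+1 - v k) x : R) ^+ 2)%:E))%E) => [|x _]; last first.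
      by rewrite /g EFinM.
    rewrite ge0_integralZl//; last 2 first.
    - apply/measurable_EFinP; apply: measurable_funX; exact: Lsq_measurable (HvB k).
    - by move=> x _; rewrite lee_fin sqr_ge0.
    rewrite ip_EFin// -EFinM lee_fin.
    apply: (@le_trans _ _ (4 ^+ k * 16 ^- k)).
      apply: ler_wpM2l; first exact: exprn_ge0.
      by apply: N0P; [exact: leq_trans (N0N k) (NS k)|exact: N0N].
    by rewrite (_ : 16 = 4 * 4 :> R) ?exprMn ?invfM ?mulrA ?mulfV ?mul1r// -natrM.
  apply: (@le_lt_trans _ _ (\sum_(0 <= k <oo) (2 / (2 ^ (k + 0.+1))%:R : R)%:E)%E).
    apply: lee_nneseries => k _; first by move=> _; rewrite lee_fin invr_ge0 exprn_ge0.
    rewrite lee_fin addn1 expnS natrM invfM mulrA mulfV// mul1r natrX.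
    by rewrite lef_pV2 ?posrE ?exprn_gt0// lerXn2r ?nnegrE// ler_nat.
  have /cvg_lim -> // := @cvg_geometric_eseries_half R 2 0.
  by rewrite ltry.
have iG : mu.-integrable [set: T] G.
  apply/integrableP; split => //; apply: le_lt_trans intG.
  rewrite le_eqVlt; apply/orP; left; apply/eqP; apply: eq_integral => x _.
  by rewrite gee0_abs//; apply: nneseries_ge0 => k _ _; exact: g0.
have [B [mB B0 GB]] := integrable_ae measurableT iG.
have Acvg x : ~ B x -> cvgn (fun k => v k x : R).
  move=> nBx; have fG : G x \is a fin_num.
    by apply: contrapT => h; apply: nBx; apply: GB => /= /(_ I).
  apply: (@cvg_of_weighted_increments _ (fine (G x))) => k.
  rewrite -lee_fin fineK//; apply: le_trans (nneseries_lim_ge k.+1 _); last first.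
    by move=> j _ _; exact: g0.
  rewrite big_nat_recr//= leeDr//; apply: sume_ge0 => j _; exact: g0.
(* Set to 0 on the null set [B], the sequence converges everywhere, which makes [l] measurable as a
   pointwise limit. *)
pose w k : T -> R^o := fun x => \1_(~` B) x * v k x.
have wE k x : ~ B x -> w k x = v k x.
  by move=> nBx; rewrite /w indicE mem_set// mul1r.
pose l : T -> R^o := fun x => limn (fun k => w k x : R).
have wl x : (w k x : R) @[k --> \oo] --> (l x : R).
  have [Bx|nBx] := pselect (B x).
    rewrite /l (_ : (fun k => w k x) = cst (0 : R)); first by apply/cvg_ex; exists 0; exact: cvg_cst.
    by apply/funext => k; rewrite /w indicE memNset ?mul0r//= => /(_ Bx).
  rewrite /l (_ : (fun k => w k x) = (fun k => v k x)); first exact: Acvg.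
  by apply/funext => k; exact: wE.
have mw k : measurable_fun setT (w k : T -> R).
  apply: measurable_funM; last exact: Lsq_measurable.
  by apply: measurable_indic; exact: measurableC.
have Hw k : Lsq (w k).
  apply: (@Lsq_le _ _ _ mu _ (v k)) => // x.
  rewrite /w normrM indicE; case: (_ \in _); rewrite ?normr1 ?mul1r// normr0 mul0r//.
have ipw n k : ip (u n - w k) (u n - w k) = ip (u n - v k) (u n - v k).
  have E : {ae mu, forall x, (u n - w k) x = (u n - v k) x}.
    exists B; split => // x /=; apply: contra_notP => nBx.
    by rewrite !pointE wE.
  by apply: ip_ae_eq => //; apply: (ip_memB ia).
have ml : measurable_fun setT (l : T -> R).
  by apply: measurable_fun_cvg mw _ => x _; exact: wl.
(* Fatou's lemma carries the Cauchy estimate along the subsequence over to the limit. *)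
have ipl n k : (N k <= n)%N ->
    (\int[mu]_x (((u n - l) x : R) ^+ 2)%:E <= (16 ^- k : R)%:E)%E.
  move=> Nn; pose q j x : \bar R := (((u n - w (j + k)%N) x : R) ^+ 2)%:E.
  rewrite (eq_integral (fun x => limn_einf (q ^~ x))) => [|x _]; last first.
    have cq : q j x @[j --> \oo] --> (((u n - l) x : R) ^+ 2)%:E.
      apply: cvg_EFin; first exact: nearW.
      have cw : (u n x - w (j + k)%N x : R) @[j --> \oo] --> (u n x - l x : R).
        by apply: cvgB; [exact: cvg_cst|rewrite (cvg_shiftn k (fun j => w j x : R)); exact: wl].
      by rewrite expr2 /=; apply: cvgM; exact: cw.
    by rewrite is_cvg_limn_einfE ?(cvg_lim _ cq)//; apply/cvg_ex; eexists; exact: cq.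
  apply: le_trans; first apply: fatou => //.
  - move=> j; apply/measurable_EFinP; apply: measurable_funX.
    by apply: Lsq_measurable; apply: (ip_memB ia).
  - by move=> j x _; rewrite lee_fin; exact: sqr_ge0.
  rewrite limn_einf_lim; apply: lime_le; first exact: is_cvg_einfs.
  apply: nearW => j; apply: (@le_trans _ _ (\int[mu]_x q j x)%E).
    by apply: ereal_inf_lbound; exists j => //=.
  rewrite ip_EFin ?ipw ?lee_fin; last by apply: (ip_memB ia).
  apply: N0P; first exact: leq_trans (N0N k) Nn.
  by apply: leq_trans (N0N k) _; apply: Nmono; exact: leq_addl.
have HlB n k : (N k <= n)%N -> Lsq (u n - l).
  move=> Nn; apply/LsqP; split.
    by apply: measurable_funB => //; exact: Lsq_measurable.
  by apply: le_lt_trans (ipl _ _ Nn) _; rewrite ltry.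
have Hl : Lsq l.
  rewrite (_ : l = u (N 0%N) - (u (N 0%N) - l)); last by rewrite opprB addrC subrK.
  by apply: (ip_memB ia) => //; exact: (HlB _ 0%N).
exists l => // e e0.
have [k ke] : exists k, 16 ^- k <= e.
  have [k _ kP] := near_infty_natSinv_lt (PosNum e0).
  exists k; apply: le_trans (ltW (kP k (leqnn k))).
  by rewrite lef_pV2 ?posrE ?exprn_gt0// -natrX ler_nat ltn_expl.
exists (N k) => n Nn; apply: le_trans ke.
by rewrite -lee_fin -ip_EFin; [exact: ipl|exact: HlB Nn].
Qed.

End completeness.

(** * Translations and bounded multipliers on L^2 *)

Section translations.
Context (R : realType) (d : nat).
Local Notation mu := (@lebesgue_rV R d).
Local Notation Lsq := (Lsq mu).
Local Notation ip := (ip mu).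
Local Notation ia := (@Lsq_inner_product _ _ _ mu).
Implicit Types (f g : 'rV[R]_d -> R^o) (a : 'rV[R]_d).

Definition tau a f : 'rV[R]_d -> R^o := fun x => f (x + a).

Lemma integral_tau (F : 'rV[R]_d -> \bar R) a :
  measurable_fun [set: 'rV[R]_d] F -> (forall x, 0 <= F x)%E ->
  (\int[mu]_x F (x + a)%R = \int[mu]_x F x)%E.
Proof.
move=> mF F0; have ms := measurable_rV_shift a.
rewrite -[LHS](@ge0_integral_pushforward _ _ _ _ _ _ ms mu setT F)//.
apply: eq_measure_integral => A mA _.
exact: lebesgue_rV_shift.
Qed.

Lemma Lsq_tau a f : Lsq f -> Lsq (tau a f).
Proof.
move=> /LsqP[mf fi]; apply/LsqP; split.
  exact: (measurableT_comp mf (measurable_rV_shift a)).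
rewrite (@integral_tau (fun x => ((f x : R) ^+ 2)%:E) a)//.
- by apply/measurable_EFinP; exact: measurable_funX.
- by move=> x; rewrite lee_fin; exact: sqr_ge0.
Qed.

Lemma tauD a f g : tau a (f + g) = tau a f + tau a g. Proof. by []. Qed.
Lemma tau0 f : tau 0 f = f.
Proof. by apply/funext => x; rewrite /tau addr0. Qed.
Lemma tau_tau a b f : tau a (tau b f) = tau (a + b) f.
Proof. by apply/funext => x; rewrite /tau addrA. Qed.

Lemma ip_sq_tau a f : Lsq f -> ip (tau a f) (tau a f) = ip f f.
Proof.
move=> Hf; apply: EFin_inj; rewrite -!ip_EFin//; last exact: Lsq_tau.
rewrite -[RHS](integral_tau a)//.
- by apply/measurable_EFinP; apply: measurable_funX; exact: Lsq_measurable Hf.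
- by move=> x; rewrite lee_fin; exact: sqr_ge0.
Qed.

(** By polarization: [integral_tau] concerns nonnegative integrands, hence squares come before
    products. *)
Lemma ip_tau a f g : Lsq f -> Lsq g -> ip (tau a f) (tau a g) = ip f g.
Proof.
move=> Hf Hg; have Hfg := LsqD Hf Hg.
have := ip_sq_tau a Hfg; rewrite tauD !(ip_sqD ia)//; try exact: Lsq_tau.
by rewrite !ip_sq_tau//; lra.
Qed.

Lemma ip_tauC a f g : Lsq f -> Lsq g -> ip (tau a f) g = ip f (tau (- a) g).
Proof.
move=> Hf Hg; rewrite -(ip_tau (- a))//; last exact: Lsq_tau.
by rewrite tau_tau addNr tau0.
Qed.

Definition mulop (W : 'rV[R]_d -> R) f : 'rV[R]_d -> R^o := fun x => W x * f x.

Lemma mulopD W f g : mulop W (f + g) = mulop W f + mulop W g.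
Proof. by apply/funext => x; rewrite /mulop !addfE mulrDr. Qed.

Lemma mulopZ W c f : mulop W (c *: f) = c *: mulop W f.
Proof. by apply/funext => x; rewrite /mulop !scalefE mulrCA. Qed.

Section bounded_multiplier.
Context (W : 'rV[R]_d -> R) (M : R).
Context (mW : measurable_fun [set: 'rV[R]_d] W) (WM : forall x, 0 <= W x <= M).

Lemma Lsq_mulop f : Lsq f -> Lsq (mulop W f).
Proof.
move=> Hf; apply: (@Lsq_le _ _ _ _ _ (M *: f)); last 2 first.
- exact: LsqZ.
- move=> x; rewrite scalefE /mulop !normrM ler_wpM2r//.
  have /andP[W0 W1] := WM x; rewrite !ger0_norm//; exact: le_trans W1.
by apply: measurable_funM => //; exact: Lsq_measurable Hf.
Qed.

Lemma ip_mulopC f g : ip (mulop W f) g = ip f (mulop W g).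
Proof. by apply: eq_Rintegral => x _; rewrite /mulop mulrCA mulrA. Qed.

Lemma ip_mulop_le f : Lsq f -> ip (mulop W f) f <= M * ip f f.
Proof.
move=> Hf; rewrite -subr_ge0 -(ipZl ia)// -(ipBl ia)//; last 2 first.
- exact: LsqZ.
- exact: Lsq_mulop.
apply: Rintegral_ge0 => x _; rewrite !pointE /mulop -mulrBl -mulrA.
apply: mulr_ge0; last exact: sqr_ge0.
by rewrite subr_ge0; have /andP[] := WM x.
Qed.

End bounded_multiplier.

End translations.

(** * From the lattice form to the form on L^2 *)

Section has_integral.
Context (d : measure_display) (T : measurableType d) (R : realType).
Context (mu : {measure set T -> \bar R}).

(** Integrability and value travel together, so that a long linear combination can be integrated
    term by term without separate side conditions. *)
Definition has_integral (F : T -> R) (r : R) :=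
  mu.-integrable [set: T] (EFin \o F) /\ \int[mu]_x F x = r.

Lemma has_integral_ip f g : Lsq mu f -> Lsq mu g ->
  has_integral (fun x => (f x : R) * g x) (ip mu f g).
Proof. by move=> Hf Hg; split => //; exact: integrable_ip. Qed.

Lemma has_integralD F G r s : has_integral F r -> has_integral G s ->
  has_integral (fun x => F x + G x) (r + s).
Proof.
move=> [iF <-] [iG <-]; split; last exact: RintegralD.
exact: (@integrableD _ _ _ mu setT measurableT (EFin \o F) (EFin \o G)).
Qed.

Lemma has_integralZ c F r : has_integral F r ->
  has_integral (fun x => c * F x) (c * r).
Proof.
move=> [iF <-]; split; last exact: RintegralZl.
exact: (@integrableZl _ _ _ mu setT measurableT c (EFin \o F)).
Qed.

Lemma has_integral0 : has_integral (fun=> 0) 0.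
Proof.
split; last by rewrite /Rintegral integral0.
exact: integrable0.
Qed.

Lemma has_integral_sum (I : Type) (s : seq I) (P : pred I)
    (F : I -> T -> R) (r : I -> R) :
  (forall i, P i -> has_integral (F i) (r i)) ->
  has_integral (fun x => \sum_(i <- s | P i) F i x) (\sum_(i <- s | P i) r i).
Proof.
move=> h; elim: s => [|i s IH].
  by rewrite big_nil; under eq_fun do rewrite big_nil; exact: has_integral0.
rewrite big_cons; under eq_fun do rewrite big_cons.
by case: ifPn => // Pi; apply: has_integralD => //; exact: h.
Qed.

Lemma has_integral_ge0 F r : has_integral F r -> (forall x, 0 <= F x) -> 0 <= r.
Proof. by move=> [_ <-] F0; apply: Rintegral_ge0 => x _. Qed.

End has_integral.

Section cube.
Context (d N : nat).
Local Notation cube := {ffun 'I_d -> 'I_N.+1}.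

Definition cube_point (k : cube) : 'rV[int]_d := \row_i (k i : nat)%:Z.

Definition in_cube (j : 'rV[int]_d) := [forall i, 0 <= j ord0 i < N.+1%:Z].

Lemma in_cube_point k : in_cube (cube_point k).
Proof. by apply/forallP => i; rewrite mxE ltz_nat ltn_ord. Qed.

Lemma cube_point_inj : injective cube_point.
Proof.
move=> k l /rowP kl; apply/ffunP => i; apply/val_inj.
by have := kl i; rewrite !mxE => -[].
Qed.

Lemma in_cubeP j : in_cube j -> exists k, j = cube_point k.
Proof.
move=> /forallP jN; exists [ffun i => inord `|j ord0 i|%N].
apply/rowP => i; rewrite mxE ffunE; have /andP[j0 jlt] := jN i.
rewrite inordK; first by rewrite gez0_abs.
by rewrite -ltz_nat gez0_abs.
Qed.

Lemma in_cube_succ k i : in_cube (cube_point k + delta_mx ord0 i) = (k i != ord_max).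
Proof.
apply/forallP/idP => [/(_ i)|ki j].
  rewrite !mxE !eqxx/= -PoszD ltz_nat addn1 ltnS => h.
  by apply: contraTneq h => ->; rewrite ltnn.
rewrite !mxE eqxx/=; case: eqP => [->|_]; last by rewrite addr0 ltz_nat ltn_ord.
rewrite -PoszD ltz_nat addn1 ltnS /=.
by rewrite ltn_neqAle -ltnS ltn_ord andbT; apply: contra ki => /eqP ki; apply/eqP/val_inj.
Qed.

Lemma fsum_cube (R : realType) (F : 'rV[int]_d -> R) :
  (forall j, ~~ in_cube j -> F j = 0) ->
  \sum_(j \in [set: 'rV[int]_d]) F j = \sum_(k : cube) F (cube_point k).
Proof.
move=> F0; transitivity (\sum_(j \in cube_point @` [set: cube]) F j).
  apply/esym/fsbig_widen => // j [_ /= nj]; apply: F0.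
  by apply/negP => /in_cubeP[k jk]; apply: nj; exists k.
rewrite fsbig_image; last by move=> k l _ _; exact: cube_point_inj.
rewrite [RHS]fsbig_seq ?index_enum_uniq//.
rewrite (_ : [set` index_enum _] = setT)//.
by apply/seteqP; split => k //= _; rewrite mem_index_enum.
Qed.

(** By [in_cube_succ] these are the points whose neighbour in direction i leaves the cube. *)
Lemma card_cube_face i : (#|[pred k : cube | k i == ord_max]| * N.+1 = #|{: cube}|)%N.
Proof.
rewrite (_ : #|_| = #|family (fun j : 'I_d => if j == i then pred1 (ord_max : 'I_N.+1) else predT)|); last first.
  apply: eq_card => k; rewrite !inE; apply/eqP/familyP => [ki j|/(_ i)].
    by case: eqP => [->|//]; rewrite inE ki.
  by rewrite eqxx inE => /eqP.
rewrite card_family card_ffun !card_ord foldrE big_map big_enum/=.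
rewrite (bigD1 i)//= eqxx card1 mul1n.
rewrite (eq_bigr (fun=> N.+1)); last by move=> j /negbTE ->; rewrite card_ord.
rewrite prod_nat_const (_ : #|_| = d.-1); last by rewrite cardC1 card_ord.
by rewrite -expnSr prednK//; case: d i => // -[].
Qed.

End cube.

Section continuous_form.
Context (R : realType) (d : nat) (V : 'rV[R]_d -> R) (M theta m : R).
Context (mV : measurable_fun [set: 'rV[R]_d] V) (VM : forall x, 0 <= V x <= M).
Context (shifted : forall x f, finsupp f -> m * fdot f f <=
  fdot (discrete_operator (fun k => V (x + lattice_point theta k)) f) f).
Local Notation mu := (@lebesgue_rV R d).
Local Notation Lsq := (Lsq mu).
Local Notation ip := (ip mu).
Local Notation ia := (@Lsq_inner_product _ _ _ mu).
Local Notation e_ i := (delta_mx ord0 i).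

(* The lattice inequality for the function k |-> g (x + theta k) cut off to a cube. *)
Lemma cube_form (N : nat) (g : 'rV[R]_d -> R^o) (x : 'rV[R]_d) :
  0 <= \sum_(k : {ffun 'I_d -> 'I_N.+1})
   (let y := x + lattice_point theta (cube_point k) in
    ((2 * d)%:R - m) * ((g y : R) * g y) + (V y * g y) * g y
    - 2 * \sum_(i < d | k i != ord_max) (g (y + theta *: e_ i) : R) * g y).
Proof.
pose f : 'rV[int]_d -> R^o := fun j =>
  if in_cube N j then g (x + lattice_point theta j) else 0.
have fz j : ~~ in_cube N j -> f j = 0 by rewrite /f => /negbTE ->.
have Hf : finsupp f.
  apply: (@finsuppI _ _ _ [fset cube_point k | k in {: {ffun 'I_d -> 'I_N.+1}}]%fset) => j.
  move=> nj; apply: fz; apply: contra nj => /in_cubeP[k ->].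
  by apply/imfsetP; exists k.
have fi := @finsupp_inner_product R 'rV[int]_d.
have := shifted x Hf; rewrite -subr_ge0 fdot_discrete//.
(* The two shifts are adjoint, so backward neighbours contribute as much as forward ones; hence the
   factor 2. *)
have sym i : fdot (shift (- e_ i) f) f = fdot (shift (e_ i) f) f.
  rewrite fdot_shift opprK; apply: (ipC fi) => //; exact: finsupp_shift.
rewrite (eq_bigr (fun i => 2 * fdot (shift (e_ i) f) f)) => [|i _]; last first.
  by rewrite sym; ring.
rewrite -mulr_sumr.
have E1 : fdot f f = \sum_(k : {ffun 'I_d -> 'I_N.+1})
    (g (x + lattice_point theta (cube_point k)) : R) * g (x + lattice_point theta (cube_point k)).
  rewrite /fdot (@fsum_cube d N) => [|j /fz ->]; last by rewrite mulr0.
  by apply: eq_bigr => k _; rewrite /f in_cube_point.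
have E2 W : fdot (potential W f) f = \sum_(k : {ffun 'I_d -> 'I_N.+1})
    W (cube_point k) * g (x + lattice_point theta (cube_point k)) * g (x + lattice_point theta (cube_point k)).
  rewrite /fdot (@fsum_cube d N) => [|j /fz ->]; last by rewrite mulr0.
  by apply: eq_bigr => k _; rewrite /potential /f in_cube_point.
have E3 i : fdot (shift (e_ i) f) f = \sum_(k : {ffun 'I_d -> 'I_N.+1} | k i != ord_max)
    (g (x + lattice_point theta (cube_point k) + theta *: e_ i) : R) * g (x + lattice_point theta (cube_point k)).
  rewrite /fdot (@fsum_cube d N) => [|j /fz ->]; last by rewrite mulr0.
  rewrite [RHS]big_mkcond; apply: eq_bigr => k _.
  rewrite /shift /f in_cube_point in_cube_succ; case: ifP => _; last by rewrite mul0r.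
  congr (g _ * _); rewrite -addrA; congr (_ + _); apply/rowP => j.
  by rewrite !mxE intrD mulrDr; case: (_ && _).
rewrite E1 E2 (eq_bigr _ (fun i _ => E3 i)).
congr (0 <= _).
rewrite (exchange_big_dep xpredT)//= !mulr_sumr -!sumrB -!big_split/= -!sumrB/=.
apply: eq_bigr => k _ /=; rewrite mulr_sumr.
move: (\sum_(i < d | _) _) => s; ring.
Qed.

(* Integrating [cube_form] over x costs only the neighbours across a face of the
   cube, a proportion 1/(N+1) of all pairs. *)
Lemma continuous_form g : Lsq g ->
  m * ip g g <= (2 * d)%:R * ip g g
    - 2 * \sum_(i < d) ip (tau (theta *: e_ i) g) g + ip (mulop V g) g.
Proof.
move=> Hg; rewrite -subr_ge0; set A := _ - _.
pose t i := ip (tau (theta *: e_ i) g) g.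
have AE : A = (2 * d)%:R * ip g g - 2 * \sum_(i < d) t i + ip (mulop V g) g - m * ip g g by [].
(* The boundary term does not grow with [N], so a negative [A] would violate this inequality for
   large [N]. *)
clearbody A; have key N : 0 <= N.+1%:R * A + 2 * \sum_(i < d) t i.
  pose c := #|{: {ffun 'I_d -> 'I_N.+1}}|.
  pose r (k : {ffun 'I_d -> 'I_N.+1}) := ((2 * d)%:R - m) * ip g g + ip (mulop V g) g
    - 2 * \sum_(i < d | k i != ord_max) t i.
  have rE : N.+1%:R * \sum_(k : {ffun 'I_d -> 'I_N.+1}) r k =
      c%:R * (N.+1%:R * A + 2 * \sum_(i < d) t i).
    transitivity (N.+1%:R * (\sum_(k : {ffun 'I_d -> 'I_N.+1}) (A + 2 * \sum_(i < d | k i == ord_max) t i))).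
      congr (_ * _); apply: eq_bigr => k _.
      rewrite /r AE [\sum_(i < d) t i](bigID (fun i => k i == ord_max))/=.
      by move: (\sum_(i < d | _) _) (\sum_(i < d | _) _) => p q; ring.
    rewrite big_split/= sumr_const -mulr_sumr (exchange_big_dep xpredT)//=.
    rewrite (eq_bigr (fun i => #|[pred k : {ffun 'I_d -> 'I_N.+1} | k i == ord_max]|%:R * t i)); last first.
      by move=> i _; rewrite sumr_const mulr_natl.
    rewrite -[A *+ _]mulr_natl -/c !mulrDr; congr (_ + _); first by rewrite mulrCA.
    rewrite !mulr_sumr; apply: eq_bigr => i _.
    have := congr1 (fun n => n%:R : R) (@card_cube_face d N i).
    by rewrite natrM /c => <-; ring.
  have c0 : 0 < c%:R :> R.
    by rewrite ltr0n; apply/card_gt0P; exists [ffun => ord0].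
  rewrite -(pmulr_rge0 _ c0) -rE mulr_ge0//.
  apply: (@has_integral_ge0 _ _ _ mu _ _ _ (cube_form N g)).
  (* The translation by [l] disappears on integration; only the set of admissible directions still
     depends on [k]. *)
  apply: has_integral_sum => k _; rewrite /r; set l := lattice_point theta _.
  have Htl h : Lsq h -> Lsq (tau l h) by exact: Lsq_tau.
  apply: has_integralD.
    apply: has_integralD.
      rewrite -(ip_tau l Hg Hg); apply: has_integralZ.
      exact: (has_integral_ip (Htl _ Hg) (Htl _ Hg)).
    have HV := Lsq_mulop mV VM Hg.
    rewrite -(ip_tau l HV Hg).
    exact: (has_integral_ip (Htl _ HV) (Htl _ Hg)).
  rewrite -mulNr; under eq_fun do rewrite -mulNr.
  apply: has_integralZ; apply: has_integral_sum => i _.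
  have Ht := Lsq_tau (theta *: e_ i) Hg.
  rewrite /t -(ip_tau l Ht Hg).
  have := has_integral_ip (Htl _ Ht) (Htl _ Hg).
  by congr (has_integral _ _ _); apply/funext => y; rewrite /tau addrAC.
rewrite leNgt; apply/negP => A0.
pose s := \sum_(i < d) t i; have nA : 0 < - A by rewrite oppr_gt0.
have := @archi_boundP R (`|2 * s| / - A) (divr_ge0 (normr_ge0 _) (ltW nA)).
set n := Num.bound _; have := key n; rewrite -/s => h.
rewrite ltr_pdivrMr// => h2.
have := ler_norm (2 * s); have : n%:R * - A <= n.+1%:R * - A.
  by rewrite ler_wpM2r ?(ltW nA)// ler_nat.
lra.
Qed.

End continuous_form.

(** * Test functions *)

Section flat_functions.
Context (R : realType).
Implicit Types (p : {poly R}) (x a k : R).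

(* The functions p(1/x) exp(-1/x), extended by 0, are closed under derivation. *)
Definition flat p x : R := if 0 < x then p.[x^-1] * expR (- x^-1) else 0.

(** With y = 1/x one has d/dx = - y^2 d/dy, which sends p(y) exp(-y) to y^2 (p - p')(y) exp(-y). *)
Definition flat_deriv p : {poly R} := 'X^2 * (p - p^`()).

(** From exp(y) >= y^(i+2) / (i+2)! with y = 1/x, each monomial satisfies y^i exp(-y) <= (i+2)! x^2.
    Quadratic decay makes the difference quotient at 0 tend to 0. *)
Lemma flat_bound p : exists2 C, 0 <= C & forall x, `|flat p x| <= C * x ^+ 2.
Proof.
pose C := \sum_(i < size p) `|p`_i| * (i.+2)`!%:R.
have C0 : 0 <= C by apply: sumr_ge0 => i _; rewrite mulr_ge0.
exists C => // x; rewrite /flat; case: ifPn => [x0|_]; last first.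
  by rewrite normr0 mulr_ge0// sqr_ge0.
have y0 : 0 < x^-1 by rewrite invr_gt0.
rewrite expRN normrM [X in _ * X]gtr0_norm ?invr_gt0 ?expR_gt0//.
rewrite ler_pdivrMr ?expR_gt0// horner_coef.
rewrite (le_trans (ler_norm_sum _ _ _))// mulrAC mulr_suml mulr_suml.
apply: ler_sum => i _; rewrite normrM -!mulrA ler_wpM2l//.
rewrite normrX (gtr0_norm y0) mulrA.
have := expR_ge1Dxn i.+1 (ltW y0).
set f := (i.+2)`!%:R; have f0 : 0 < f by rewrite /f ltr0n fact_gt0.
move=> h; have {h} : x^-1 ^+ i.+2 <= f * expR x^-1.
  by rewrite -ler_pdivrMl// mulrC (le_trans _ h)// lerDr.
move=> h; rewrite [leRHS](_ : _ = (f * expR x^-1) * x ^+ 2); last by ring.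
rewrite -ler_pdivrMr ?exprn_gt0// -exprVn -exprD.
by rewrite addn2.
Qed.

Lemma is_derive_flat p x : is_derive x 1 (flat p) (flat (flat_deriv p) x).
Proof.
have [x0|x0|->] := ltgtP x 0.
- rewrite [X in is_derive _ _ _ X]/flat ltNge (ltW x0)/=.
  apply: (@near_eq_is_derive _ _ _ (cst 0)).
  near=> y; rewrite /flat ifF//; apply/negbTE; rewrite -leNgt ltW//.
  by near: y; exact: lt_nbhsl.
- rewrite [X in is_derive _ _ _ X]/flat x0.
  have xn0 : x != 0 by rewrite gt_eqF.
  have dV : is_derive x 1 (fun y : R => y^-1) (- x ^- 2).
    by have := @is_deriveV R id x 1 1 xn0 (is_derive_id x 1); rewrite /GRing.scale/= mulr1.
  have d1 := @is_derive1_comp R _ (fun y : R => y^-1) x _ _ (is_derive_poly p x^-1) dV.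
  have d2 := @is_derive1_comp R _ (fun y : R => - y^-1) x _ _ (is_derive_expR (- x^-1)) (is_deriveN dV).
  have : is_derive x 1 (fun y => p.[y^-1] * expR (- y^-1))
      ((flat_deriv p).[x^-1] * expR (- x^-1)).
    apply: (@is_derive_eq _ _ _ _ _ _ _ _ (is_deriveM d1 d2)).
    rewrite /= /flat_deriv hornerM hornerXn hornerD hornerN /GRing.scale/=.
    by rewrite exprVn; ring.
  apply: near_eq_is_derive.
  by near=> y; rewrite /flat ifT//; near: y; exact: lt_nbhsr.
- rewrite [X in is_derive _ _ _ X]/flat ltxx.
  have [C C0 hC] := flat_bound p.
  have F0 : flat p 0 = 0 by rewrite /flat ltxx.
  have : h^-1 *: (flat p (h *: (1 : R) + 0) - flat p 0) @[h --> (0 : R)^'] --> (0 : R).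
    apply/cvgrPdist_le => e e0; near=> h.
    rewrite F0 subr0 addr0 sub0r normrN /GRing.scale/= mulr1 normrM normfV.
    have h0 : h != 0 by near: h; exact: nbhs_dnbhs_neq.
    have nh : 0 < `|h| by rewrite normr_gt0.
    rewrite ler_pdivrMl// (le_trans (hC h))// -(real_normK (num_real h)) expr2 mulrCA mulrC mulrC.
    rewrite ler_wpM2l// (@le_trans _ _ ((C + 1) * `|h|))//; first by rewrite ler_wpM2r// lerDl.
    rewrite -ler_pdivlMl ?ltr_wpDl// mulrC.
    by near: h; apply: dnbhs0_le; rewrite divr_gt0// ltr_wpDl.
  move=> cv; apply: DeriveDef; first by apply/cvg_ex; exists 0; exact: cv.
  exact/cvg_lim.
Unshelve. all: by end_near. Qed.

End flat_functions.

Section test_functions.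
Context (R : realType) (d : nat).
Implicit Types (phi : 'rV[R]_d -> R) (f g : R -> R).
Local Notation e_ i := (delta_mx ord0 i : 'rV[R]_d).

(** A class of one-variable functions that contains the factors of the bumps and is closed under
    derivation, so that derivatives of all orders exist without being computed. *)
Inductive flat_alg : (R -> R) -> Prop :=
| flat_alg_base p a k : flat_alg (fun x => flat p (k * (x - a)))
| flat_algZ c f of flat_alg f : flat_alg (fun x => c * f x)
| flat_algD f g of flat_alg f & flat_alg g : flat_alg (fun x => f x + g x)
| flat_algM f g of flat_alg f & flat_alg g : flat_alg (fun x => f x * g x).

Lemma flat_alg_derive f : flat_alg f ->
  exists2 f', flat_alg f' & forall x : R, is_derive x (1 : R) f (f' x).
Proof.
elim=> {f} [p a k|c f _ [f' Sf' ff']|f g Sf [f' Sf' ff'] Sg [g' Sg' gg']|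
            f g Sf [f' Sf' ff'] Sg [g' Sg' gg']].
- exists (fun x => k * flat (flat_deriv p) (k * (x - a))).
    by apply: flat_algZ; exact: flat_alg_base.
  move=> x; rewrite mulrC.
  apply: (@is_derive1_comp R (flat p) (fun y => k * (y - a))).
    exact: is_derive_flat.
  have -> : (fun y => k * (y - a)) = k *: (id - cst a) by [].
  have := is_deriveZ k (is_deriveB (is_derive_id x (1 : R)) (is_derive_cst a x (1 : R))).
  by rewrite subr0 /GRing.scale/= mulr1.
- exists (fun x => c * f' x); first exact: flat_algZ.
  by move=> x; exact: (is_deriveZ c (ff' x)).
- exists (fun x => f' x + g' x); first exact: flat_algD.
  by move=> x; exact: (is_deriveD (ff' x) (gg' x)).
- exists (fun x => f x * g' x + g x * f' x).
    by apply: flat_algD; exact: flat_algM.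
  by move=> x; exact: (is_deriveM (ff' x) (gg' x)).
Qed.

Lemma flat_alg_continuous f : flat_alg f -> continuous f.
Proof.
move=> /flat_alg_derive[f' _ ff'] x.
apply/differentiable_continuous/derivable1_diffP.
by have [] := ff' x.
Qed.

(** A partial derivative changes a single factor, so the class is stable under all of them. *)
Definition flat_product phi := exists2 G : 'I_d -> R -> R,
  (forall i, flat_alg (G i)) & phi = fun x => \prod_i G i (x ord0 i).

Lemma flat_product_derive phi (i : 'I_d) : flat_product phi ->
  exists2 psi, flat_product psi & forall x, is_derive x (e_ i) phi (psi x).
Proof.
move=> [G SG ->]; have [g' Sg' gg'] := flat_alg_derive (SG i).
pose G' j := if j == i then g' else G j.
exists (fun x => \prod_j G' j (x ord0 j)).
  by exists G' => // j; rewrite /G'; case: ifP.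
move=> x; pose c := \prod_(j < d | j != i) G j (x ord0 j).
have E h : \prod_j G j ((h *: e_ i + x) ord0 j) = c * G i (h + x ord0 i).
  rewrite (bigD1 i)//= mulrC !mxE !eqxx mulr1; congr (_ * _).
  by apply: eq_bigr => j ji; rewrite !mxE eqxx (negbTE ji) mulr0 add0r.
have E0 : \prod_j G j (x ord0 j) = c * G i (x ord0 i) by rewrite (bigD1 i)//= mulrC.
have -> : \prod_j G' j (x ord0 j) = c * g' (x ord0 i).
  rewrite (bigD1 i)//= mulrC /G' eqxx; congr (_ * _).
  by apply: eq_bigr => j /negbTE ->.
have [/cvg_ex[l gl] dg] := gg' (x ord0 i).
have gl' : l = g' (x ord0 i) by rewrite -dg; apply/esym/cvg_lim.
have cv : h^-1 *: (\prod_j G j ((h *: e_ i + x) ord0 j) - \prod_j G j (x ord0 j) : R)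
    @[h --> 0^'] --> c * g' (x ord0 i).
  rewrite (_ : (fun h => _) = (fun h => c * (h^-1 *: (G i (h *: (1 : R) + x ord0 i) - G i (x ord0 i) : R)))).
    by apply: cvgM; [exact: cvg_cst|rewrite -gl'; exact: gl].
  apply/funext => h; rewrite E E0 /GRing.scale/= mulr1; ring.
by apply: DeriveDef; [apply/cvg_ex; exists (c * g' (x ord0 i)); exact: cv|exact/cvg_lim].
Qed.

Lemma flat_product_continuous phi : flat_product phi -> continuous phi.
Proof.
move=> [G SG ->]; elim: (index_enum 'I_d) => [|i s IH] x.
  have -> : (fun y : 'rV[R]_d => \prod_(j <- [::]) G j (y ord0 j)) = cst 1.
    by apply/funext => y; rewrite big_nil.
  exact: cst_continuous.
have -> : (fun y : 'rV[R]_d => \prod_(j <- i :: s) G j (y ord0 j)) =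
    (fun y => G i (y ord0 i) * \prod_(j <- s) G j (y ord0 j)).
  by apply/funext => y; rewrite big_cons.
have Gx : {for x, continuous (G i \o (fun y : 'rV[R]_d => y ord0 i))}.
  apply: continuous_comp; first exact: coord_continuous.
  exact: flat_alg_continuous.
exact: (@cvgM _ _ (nbhs x) _ _ _ _ _ Gx (IH x)).
Qed.

Lemma flat_product_pderiv phi s : flat_product phi -> flat_product (pderiv s phi).
Proof.
move=> Pphi; elim: s => //= i s /(flat_product_derive i)[psi Ppsi psiE].
by rewrite (_ : 'D_(_) _ = psi)//; apply/funext => x; have [_ ->] := psiE x.
Qed.

Lemma flat_product_smooth phi : flat_product phi -> smooth phi.
Proof.
move=> Pphi s; have Ps := flat_product_pderiv s Pphi; split.
  exact: flat_product_continuous.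
by move=> i x; have [psi _ /(_ x)[]] := flat_product_derive i Ps.
Qed.

(** Inside the box each factor is exp(-1/(k (x_i - a_i))) exp(-1/(k (b_i - x_i))). As k tends to
    infinity the exponents vanish and the bump tends to the indicator of the box. *)
Definition bump (a b : 'I_d -> R) (k : R) : 'rV[R]_d -> R := fun x =>
  \prod_i (flat 1 (k * (x ord0 i - a i)) * flat 1 ((- k) * (x ord0 i - b i))).

Lemma flat1E (x : R) : flat 1 x = if 0 < x then expR (- x^-1) else 0.
Proof. by rewrite /flat -polyC1 hornerC mul1r. Qed.

Lemma flat_bounds (x : R) : 0 <= flat 1 x <= 1.
Proof.
rewrite flat1E; case: ifPn => [x0|_]; last by rewrite lexx ler01.
rewrite expR_ge0/=.
by rewrite -expR0 ler_expR oppr_le0 invr_ge0 ltW.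
Qed.

Lemma flat_eq0 (x : R) : x <= 0 -> flat 1 x = 0.
Proof. by rewrite /flat ltNge => ->. Qed.

Lemma bump_out a b k x : 0 < k -> x \notin open_box a b -> bump a b k x = 0.
Proof.
move=> k0; rewrite notin_setE => /existsNP[i /negP].
rewrite negb_and -!leNgt => h; rewrite /bump (bigD1 i)//=.
case/orP: h => h; rewrite [X in X * _](_ : _ = 0) ?mul0r//.
  by rewrite flat_eq0 ?mul0r// pmulr_rle0// subr_le0.
by rewrite [X in _ * X]flat_eq0 ?mulr0// mulNr oppr_le0 mulr_ge0 ?(ltW k0)// subr_ge0.
Qed.

Lemma bump_bounds a b k x : 0 <= bump a b k x <= 1.
Proof.
have h i : 0 <= flat 1 (k * (x ord0 i - a i)) * flat 1 (- k * (x ord0 i - b i)) <= 1.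
  have /andP[p0 p1] := flat_bounds (k * (x ord0 i - a i)).
  have /andP[q0 q1] := flat_bounds (- k * (x ord0 i - b i)).
  by rewrite mulr_ge0//= mulr_ile1.
rewrite /bump; apply/andP; split; first by apply: prodr_ge0 => i _; have /andP[] := h i.
by apply: prodr_ile1 => i _; exact: h.
Qed.

Lemma test_function_bump a b k : 0 < k -> test_function (bump a b k).
Proof.
move=> k0; split.
  apply: flat_product_smooth.
  exists (fun i x => flat 1 (k * (x - a i)) * flat 1 ((- k) * (x - b i))) => //.
  by move=> i; apply: flat_algM; exact: flat_alg_base.
pose K := [set x : 'rV[R]_d | forall i, `[a i, b i]%classic (x ord0 i)].
have cK : compact K.
  by apply: (@rV_compact R d (fun i => `[a i, b i]%classic)) => i; exact: segment_compact.
apply: (@subclosed_compact _ (closure _) K) => //; first exact: closed_closure.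
have Kc : closed K by apply: compact_closed => //; exact: norm_hausdorff.
rewrite closureE; apply: smallest_sub => // x /= /eqP nx i.
have : x \in open_box a b by apply: contrapT => /negP h; apply: nx; exact: bump_out.
by rewrite inE => /(_ i) /andP[h1 h2] /=; rewrite in_itv/= !ltW.
Qed.

Lemma bump_cvg a b x : bump a b n.+1%:R x @[n --> \oo] --> (\1_(open_box a b) x : R).
Proof.
rewrite indicE; have [xin|xout] := boolP (x \in open_box a b); last first.
  rewrite (_ : (fun n => _) = cst 0); first exact: cvg_cst.
  by apply/funext => n; rewrite bump_out.
move: xin; rewrite inE => xin.
have one (y : R) : 0 < y -> flat 1 (n.+1%:R * y) @[n --> \oo] --> (1 : R).
  move=> y0; rewrite (_ : (fun n => _) = (fun n => expR (- (y^-1 * n.+1%:R^-1)))).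
    rewrite -[X in _ --> X](@expR0 R) -[in X in _ --> X]oppr0.
    apply: (@cvg_comp _ _ _ (fun n => - (y^-1 * n.+1%:R^-1)) expR _ (nbhs (- 0))); last exact: continuous_expR.
    apply: cvgN; rewrite -[X in _ --> X](mulr0 y^-1); apply: cvgM; first exact: cvg_cst.
    exact: cvg_harmonic.
  apply/funext => n; by rewrite flat1E mulr_gt0// invfM mulrC.
rewrite /bump -[X in _ --> X](_ : \prod_(i < d) (1 * 1) = 1); last by rewrite big1// => i _; rewrite mulr1.
elim: (index_enum 'I_d) => [|i s IH].
  by under eq_fun do rewrite big_nil; rewrite big_nil; exact: cvg_cst.
under eq_fun do rewrite big_cons; rewrite big_cons; apply: cvgM; last exact: IH.
have /andP[h1 h2] := xin i.
apply: cvgM; first by apply: one; rewrite subr_gt0.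
under eq_fun do rewrite mulNr -mulrN opprB.
by apply: one; rewrite subr_gt0.
Qed.

End test_functions.

(** * Dominated convergence in L^2 and totality of test functions *)

Section dominated.
Context (d : measure_display) (T : measurableType d) (R : realType).
Context (mu : {measure set T -> \bar R}).
Local Notation Lsq := (@Lsq d T R mu).
Local Notation ip := (@ip d T R mu).
Local Notation ia := (@Lsq_inner_product d T R mu).
Implicit Types (f g u : T -> R^o).

Lemma Lsq_dominated (F : nat -> T -> R^o) f g :
  (forall n, measurable_fun [set: T] (F n : T -> R)) -> Lsq g ->
  (forall n x, `|F n x : R| <= `|g x : R|) ->
  (forall x, (F n x : R) @[n --> \oo] --> (f x : R)) ->
  Lsq f /\ (ip (F n - f) (F n - f) @[n --> \oo] --> (0 : R)).
Proof.
move=> mF Hg Fg Ff.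
have mf : measurable_fun [set: T] (f : T -> R).
  by apply: (@measurable_fun_cvg _ _ _ _ (F : nat -> T -> R)) => // x _; exact: Ff.
have fg x : `|f x : R| <= `|g x : R|.
  have cf : `|F n x : R| @[n --> \oo] --> `|f x : R| by apply: cvg_norm; exact: Ff.
  rewrite -(cvg_lim _ cf)//; apply: limr_le; first by apply/cvg_ex; eexists; exact: cf.
  by apply: nearW => n; exact: Fg.
have Hf : Lsq f by exact: (Lsq_le mf Hg).
split => //; have HF n : Lsq (F n) by exact: (Lsq_le (mF n) Hg).
have HB n : Lsq (F n - f) by exact: (ip_memB ia).
pose q n x : \bar R := (((F n - f) x : R) ^+ 2)%:E.
have mq n : measurable_fun [set: T] (q n).
  by apply/measurable_EFinP; apply: measurable_funX; exact: Lsq_measurable (HB n).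
(* Both [F n] and [f] are dominated by [g], so their squared difference is at most 4 g^2. *)
have ig : mu.-integrable [set: T] (EFin \o (fun x => 4 * ((g x : R) * g x))).
  by apply: (@integrableZl _ _ _ mu setT measurableT 4 (EFin \o _)); exact: integrable_ip.
have [|||||_ _ cq] := @dominated_convergence _ _ _ mu setT measurableT q (cst 0%E)
    (EFin \o (fun x => 4 * ((g x : R) * g x))) => //.
- apply: aeW => x _; apply: cvg_EFin; first exact: nearW.
  have cB : (F n x - f x : R) @[n --> \oo] --> (0 : R).
    by rewrite -(subrr (f x : R)); apply: cvgB; [exact: Ff|exact: cvg_cst].
  by rewrite -[X in _ --> X](mulr0 (0 : R)); apply: cvgM; exact: cB.
- apply: aeW => x n _; rewrite /q/= lee_fin ger0_norm; last exact: sqr_ge0.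
  have := Fg n x; have := fg x; rewrite !pointE.
  move: (F n x : R) (f x : R) (g x : R) => a b c; rewrite !ler_norml.
  have [c0|c0] := lerP 0 c; rewrite ?(ger0_norm c0) ?(ltr0_norm c0) => /andP[? ?] /andP[? ?]; nra.
rewrite /= integral0 in cq.
have /fine_cvgP[_] := cq; apply: cvg_trans; apply: near_eq_cvg.
by apply: nearW => n; rewrite /= /q ip_EFin.
Qed.

Lemma ip_cvgr u (F : nat -> T -> R^o) f : Lsq u -> Lsq f -> (forall n, Lsq (F n)) ->
  (ip (F n - f) (F n - f) @[n --> \oo] --> (0 : R)) ->
  (ip u (F n) @[n --> \oo] --> ip u f).
Proof.
move=> Hu Hf HF cF; apply/cvgrPdist_le => e e0.
pose c := ip u u + 1; have c0 : 0 < c by rewrite ltr_wpDl// (ip_ge0 ia).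
have : \forall n \near \oo, `|0 - ip (F n - f) (F n - f)| <= e ^+ 2 / c.
  by move/cvgrPdist_le : cF; apply; rewrite divr_gt0// exprn_gt0.
apply: filterS => n; rewrite sub0r normrN => h.
have HB : Lsq (F n - f) by exact: (ip_memB ia).
rewrite distrC -(ipBr ia)// -(@ler_pXn2r _ 2)// ?nnegrE// ?(ltW e0)//.
rewrite real_normK ?num_real// (le_trans (cauchy_schwarz ia Hu HB))//.
move: h; rewrite ger0_norm ?(ip_ge0 ia)// ler_pdivlMr// => h.
rewrite (le_trans _ h)// mulrC ler_wpM2l ?(ip_ge0 ia)//.
by rewrite /c lerDl.
Qed.

End dominated.

Section uniqueness.
Context (R : realType) (d : nat).
Local Notation mu := (@lebesgue_rV R d).
Local Notation Lsq := (Lsq mu).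
Local Notation ip := (ip mu).
Local Notation ia := (@Lsq_inner_product _ _ _ mu).
Implicit Types (u : 'rV[R]_d -> R^o).
Local Notation box M := (@open_box R d (fun=> - M) (fun=> M)).

Definition indic_fun (A : set 'rV[R]_d) : 'rV[R]_d -> R^o := fun x => \1_A x.

Lemma lebesgue_rV_open_box (a b : 'I_d -> R) : (mu (open_box a b) < +oo)%E.
Proof.
pose M := \sum_i (`|a i| + `|b i|).
have MM i : `|a i| + `|b i| <= M.
  by rewrite /M (bigD1 i)//= lerDl sumr_ge0// => j _; rewrite addr_ge0.
apply: le_lt_trans (lebesgue_rV_box d M).
apply: le_measure; rewrite ?inE; try exact: measurable_open_box.
move=> x h i; have /andP[h1 h2] := h i; have := MM i.
have := ler_norm (- a i); have := ler_norm (b i); rewrite normrN.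
have := normr_ge0 (a i); have := normr_ge0 (b i).
by move=> *; apply/andP; split; lra.
Qed.

Lemma Lsq_indic A a b : measurable A -> A `<=` open_box a b -> Lsq (indic_fun A).
Proof.
move=> mA AB; apply/LsqP; split; first exact: measurable_indic.
rewrite (eq_integral (fun x => (\1_A x)%:E)) => [|x _]; last first.
  by rewrite /indic_fun indicE; case: (_ \in _); rewrite ?expr1n ?expr0n.
rewrite integral_indic// setIT (le_lt_trans _ (lebesgue_rV_open_box a b))//.
by apply: le_measure; rewrite ?inE//; exact: measurable_open_box.
Qed.

(** Bumps reach indicators of boxes, boxes reach every measurable subset of a large box, and a
    function with zero integral over all of these vanishes almost everywhere there. *)
Lemma test_functions_total u : Lsq u ->
  (forall phi, test_function phi -> \int[mu]_x (u x * phi x) = 0) ->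
  ip u u = 0.
Proof.
move=> Hu hu.
have boxE a b : ip u (indic_fun (open_box a b)) = 0.
  have Hb : Lsq (indic_fun (open_box a b)).
    by apply: (@Lsq_indic _ a b) => //; exact: measurable_open_box.
  have mb n : measurable_fun setT (bump a b n.+1%:R).
    by apply: measurable_rV_continuous; have [/(_ [::])[]] := @test_function_bump R d a b n.+1%:R (ltr0Sn _ n).
  have bb n x : `|bump a b n.+1%:R x| <= `|indic_fun (open_box a b) x : R|.
    rewrite /indic_fun indicE; have /andP[b0 b1] := bump_bounds a b n.+1%:R x.
    have [xb|xb] := boolP (x \in open_box a b); first by rewrite normr1 ger0_norm.
    by rewrite bump_out.
  have [_ cb] := @Lsq_dominated _ _ _ mu (fun n => bump a b n.+1%:R) _ _ mb Hb bb (@bump_cvg R d a b).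
  have Hbn n : Lsq (bump a b n.+1%:R) by exact: Lsq_le (mb n) Hb (bb n).
  have := ip_cvgr Hu Hb Hbn cb.
  rewrite (_ : (fun n => _) = cst 0); last first.
    by apply/funext => n; apply: hu; exact: test_function_bump.
  by move=> /cvg_lim <- //; rewrite lim_cst.
(* A pi-lambda argument from the boxes; cutting by a fixed box keeps the indicators of all
   measurable sets square integrable. *)
have subE A M : measurable A -> ip u (indic_fun (A `&` box M)) = 0.
  pose D := box M; have mD : measurable D by exact: measurable_open_box.
  pose H := [set A | measurable A /\ ip u (indic_fun (A `&` D)) = 0].
  pose G := [set A | exists a b : 'I_d -> R, A = open_box a b].
  have HAD B : measurable B -> Lsq (indic_fun (B `&` D)).
    by move=> mB; apply: (@Lsq_indic _ (fun=> - M) (fun=> M)); [exact: measurableI|exact: subIsetr].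
  have GI : setI_closed G.
    move=> _ _ [a [b ->]] [a' [b' ->]].
    exists (fun i => Num.max (a i) (a' i)), (fun i => Num.min (b i) (b' i)).
    apply/seteqP; split => x /=.
      move=> [h1 h2] i; have /andP[? ?] := h1 i; have /andP[? ?] := h2 i.
      by rewrite gt_max lt_min; apply/andP; split; apply/andP; split.
    by move=> h; split => i; have := h i; rewrite gt_max lt_min => /andP[/andP[? ?] /andP[? ?]]; apply/andP.
  have GH : G `<=` H.
    move=> B GB; have [a [b BE]] := GB; split; first by rewrite BE; exact: measurable_open_box.
    have [a' [b' ->]] : G (B `&` D) by apply: GI => //; exists (fun=> - M), (fun=> M).
    exact: boxE.
  have lH : lambda_system setT H.
    split => //.
    - by split; [exact: measurableT|rewrite setTI; exact: boxE].
    - move=> B C CB [mB B0] [mC C0]; split; first exact: measurableD.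
      rewrite (_ : indic_fun _ = indic_fun (B `&` D) - indic_fun (C `&` D)).
        by rewrite (ipBr ia)// ?B0 ?C0 ?subr0//; exact: HAD.
      apply/funext => x; rewrite !pointE /indic_fun !indicE !in_setI.
      have [Cx|nCx] := pselect (C x).
        by rewrite (mem_set Cx) (mem_set (CB _ Cx)) memNset ?subrr//; apply.
      by rewrite (memNset nCx) (@mem_set _ (fun y => ~ C y) _ nCx) subr0 andbT.
    - move=> F ndF HF; have mF n : measurable (F n) by have [] := HF n.
      have mU : measurable (\bigcup_n F n) by exact: bigcupT_measurable.
      split => //.
      have HD : Lsq (indic_fun D) by rewrite -(setTI D); exact: HAD.
      have := ip_cvgr Hu (HAD _ mU) (fun n => HAD _ (mF n)).
      have [|||_ cF] := @Lsq_dominated _ _ _ mu (fun n => indic_fun (F n `&` D)) (indic_fun (\bigcup_n F n `&` D)) _ _ HD.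
      + by move=> n; apply: measurable_indic; exact: measurableI.
      + move=> n x; rewrite /indic_fun !indicE in_setI.
        by case: (x \in F n); case: (x \in D) => //=; rewrite normr0.
      + move=> x; rewrite /indic_fun.
        have [[n _ Fnx]|nFx] := pselect ((\bigcup_n F n) x).
          rewrite !indicE in_setI mem_set//=; last by exists n.
          apply: cvg_near_cst.
          exists n => // k /= nk; rewrite !indicE in_setI mem_set//.
          by move: x Fnx; exact/subsetPset/ndF.
        rewrite !indicE in_setI memNset//=.
        rewrite (_ : (fun n => _) = cst 0); first exact: cvg_cst.
        apply/funext => n; rewrite !indicE in_setI memNset//= => Fnx.
        by apply: nFx; exists n.
      move=> /(_ cF); rewrite (_ : (fun n => _) = cst 0); last first.
        by apply/funext => n; have [] := HF n.
      by move=> /cvg_lim <- //; rewrite lim_cst.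
  rewrite measurable_rV_generated => mA.
  by have [] := lambda_system_subset GI lH GH (fun X _ => @subsetT _ X) mA.
have mu' := Lsq_measurable Hu.
have ae0 (n : nat) : {ae mu, forall x, box n%:R x -> u x = 0}.
  have mD : measurable (box n%:R) by exact: measurable_open_box.
  have HI E : measurable E -> E `<=` box n%:R -> Lsq (indic_fun E).
    by move=> mE ED; exact: Lsq_indic mE ED.
  have uE E x : (u x * indic_fun E x : R)%:E = ((EFin \o (u : _ -> R)) \_ E) x.
    rewrite /indic_fun indicE patchE; case: (x \in E); by rewrite ?mulr1 ?mulr0.
  have iu : mu.-integrable (box n%:R) (EFin \o (u : _ -> R)).
    apply/(integrable_mkcond _ mD).
    rewrite (_ : _ \_ _ = EFin \o (fun x => (u x : R) * indic_fun (box n%:R) x)).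
      by apply: integrable_ip => //; exact: HI.
    by apply/funext => x; rewrite /= -uE.
  have [||N [mN N0 NP]] := @integral_ae_eq _ _ _ mu _ mD (cst 0%E) _ iu.
  - exact: measurable_cst.
  - move=> E ED mE; rewrite integral0 integral_mkcond.
    rewrite (eq_integral (fun x => ((u x : R) * indic_fun E x)%:E)) => [|x _]; last by rewrite -uE.
    have iE := integrable_ip Hu (HI _ mE ED).
    rewrite -[LHS]fineK; last exact: integrable_fin_num iE.
    congr EFin; rewrite -[RHS](subE E n%:R mE).
    by rewrite setIidl.
  exists N; split => //; apply: subset_trans NP => x /= h.
  by apply: contra_not h => + bx => /(_ bx)[].
have u0 : {ae mu, forall x, u x = (0 : 'rV[R]_d -> R^o) x}.
  have := ae_foralln ae0; apply: filterS => x h.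
  pose n := Num.bound (\sum_i `|x ord0 i|).
  apply: (h n) => i.
  have := @archi_boundP R (\sum_i `|x ord0 i|) (sumr_ge0 _ (fun _ _ => normr_ge0 _)).
  rewrite -/n => /(le_lt_trans _) => /(_ `|x ord0 i|).
  rewrite -ltr_norml; apply.
  by rewrite (bigD1 i)//= lerDl sumr_ge0.
by rewrite (ip_ae_eq Hu (Lsq0 mu) Hu (Lsq0 mu) u0 u0) (ip0l ia)//; exact: Lsq0.
Qed.

End uniqueness.

(** * Difference quotients and weak derivatives *)

Section difference_quotients.
Context (R : realType) (d : nat).
Local Notation mu := (@lebesgue_rV R d).
Local Notation Lsq := (Lsq mu).
Local Notation ip := (ip mu).
Local Notation ia := (@Lsq_inner_product _ _ _ mu).
Local Notation e_ i := (delta_mx ord0 i : 'rV[R]_d).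
Local Notation box M := (@open_box R d (fun=> - M) (fun=> M)).
Implicit Types (f g u : 'rV[R]_d -> R^o) (h : R) (s : seq 'I_d) (l : seq (R * 'I_d)).

Definition dq h i f : 'rV[R]_d -> R^o := h^-1 *: (tau (h *: e_ i) f - f).

(* The entries of [l] are pairs (c, i), c being the step in direction i in units
   of h: forward and backward differences are c = 1 and c = -1. *)
Definition diffq h l f := foldr (fun p => dq (h * p.1) p.2) f l.

Definition unit_steps l := all (fun p => (p.1 != 0) && (`|p.1| <= 1)) l.

Lemma dqE h i f x : dq h i f x = h^-1 * (f (x + h *: e_ i) - f x).
Proof. by []. Qed.

Lemma Lsq_dq h i f : Lsq f -> Lsq (dq h i f).
Proof. by move=> Hf; apply: LsqZ; apply: (ip_memB ia) => //; exact: Lsq_tau. Qed.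

Lemma Lsq_diffq h l f : Lsq f -> Lsq (diffq h l f).
Proof. by move=> Hf; elim: l => //= p l; exact: Lsq_dq. Qed.

Lemma ip_dq h i f g : Lsq f -> Lsq g -> ip (dq h i f) g = - ip f (dq (- h) i g).
Proof.
move=> Hf Hg; have Ht := Lsq_tau (h *: e_ i) Hf; have Ht' := Lsq_tau (- h *: e_ i) Hg.
rewrite /dq (ipZl ia) ?(ipZr ia) ?(ipBl ia) ?(ipBr ia)//; try exact: (ip_memB ia).
by rewrite ip_tauC// scaleNr invrN; ring.
Qed.

Lemma diffq_rcons h l p f : diffq h (rcons l p) f = diffq h l (dq (h * p.1) p.2 f).
Proof. by rewrite /diffq foldr_rcons. Qed.

Lemma ip_diffq h l f g : Lsq f -> Lsq g ->
  ip (diffq h l f) g = (-1) ^+ size l * ip f (diffq (- h) (rev l) g).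
Proof.
move=> Hf; elim: l g => [|p l IH] g Hg; first by rewrite expr0 mul1r.
rewrite rev_cons diffq_rcons /= ip_dq//; last exact: Lsq_diffq.
by rewrite IH ?exprS ?mulNr; [ring|exact: Lsq_dq].
Qed.

Lemma is_derive_dq h i f f' v : (forall x, is_derive x v (f : _ -> R) (f' x : R)) ->
  forall x, is_derive x v (dq h i f : _ -> R) (dq h i f' x : R).
Proof.
move=> ff' x.
have ft : is_derive x v (tau (h *: e_ i) f : _ -> R) (tau (h *: e_ i) f' x : R).
  have [fd fv] := ff' (x + h *: e_ i).
  have E : (fun t : R => t^-1 *: (tau (h *: e_ i) f (t *: v + x) - tau (h *: e_ i) f x : R)) =
    (fun t : R => t^-1 *: (f (t *: v + (x + h *: e_ i)) - f (x + h *: e_ i) : R)).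
    by apply/funext => t; rewrite /tau addrA.
  apply: DeriveDef; first by rewrite /derivable; have := fd; rewrite /derivable -E.
  by rewrite /tau -fv /derive; congr (lim _); rewrite -E.
exact: (is_deriveZ h^-1 (is_deriveB ft (ff' x))).
Qed.

Lemma is_derive_diffq h l f f' v : (forall x, is_derive x v (f : _ -> R) (f' x : R)) ->
  forall x, is_derive x v (diffq h l f : _ -> R) (diffq h l f' x : R).
Proof. by move=> ff'; elim: l => //= p l; exact: is_derive_dq. Qed.

Lemma segment_MVT (f f' : 'rV[R]_d -> R) v x (a b : R) : a < b ->
  (forall y, is_derive y v f (f' y)) ->
  exists2 c, a < c < b & f (x + b *: v) - f (x + a *: v) = f' (x + c *: v) * (b - a).
Proof.
move=> ab ff'; pose g t := f (x + t *: v).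
have gd t : is_derive t (1 : R) g (f' (x + t *: v)).
  have [fd fv] := ff' (x + t *: v).
  have E : (fun h : R => h^-1 *: (g (h *: (1 : R) + t) - g t : R)) =
    (fun h : R => h^-1 *: (f (h *: v + (x + t *: v)) - f (x + t *: v) : R)).
    apply/funext => h; rewrite /g (_ : h *: (1 : R) = h); last by rewrite [LHS]mulr1.
    by rewrite scalerDl addrCA.
  apply: DeriveDef; first by rewrite /derivable; have := fd; rewrite /derivable -E.
  by rewrite -fv /derive; congr (lim _); rewrite -E.
have [||c] := @MVT R g (fun t => f' (x + t *: v)) a b => //.
  apply: continuous_subspaceT => t.
  by apply/differentiable_continuous/derivable1_diffP; have [] := gd t.
by rewrite in_itv /= => cab E; exists c.
Qed.

Lemma dq_MVT h i (f f' : 'rV[R]_d -> R) x : h != 0 ->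
  (forall y, is_derive y (e_ i) f (f' y)) ->
  exists2 c, `|c| <= `|h| & dq h i f x = f' (x + c *: e_ i).
Proof.
move=> h0 ff'; rewrite dqE; have [hlt|hgt|h00] := ltgtP h 0.
- have [c /andP[c1 c2]] := segment_MVT x hlt ff'.
  rewrite scale0r addr0 sub0r => E; exists c.
    by rewrite !ltr0_norm// lerN2 ltW.
  by rewrite -opprB E; field.
- have [c /andP[c1 c2]] := segment_MVT x hgt ff'.
  rewrite scale0r addr0 subr0 => E; exists c.
    by rewrite !gtr0_norm// ltW.
  by rewrite E mulrC mulfK.
- by rewrite h00 eqxx in h0.
Qed.

Lemma smooth_pderiv1 (phi : 'rV[R]_d -> R) i : smooth phi -> smooth ('D_(e_ i) phi).
Proof.
move=> sphi s; have := sphi (rcons s i).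
by rewrite /pderiv foldr_rcons.
Qed.

(** The mean value theorem turns the outermost quotient into a derivative, which commutes with the
    remaining quotients and moves inside to [phi]; this is why the list of directions comes out
    reversed. Each step displaces the point by at most |h| in every coordinate. *)
Lemma diffq_MVT h l (phi : 'rV[R]_d -> R) (x : 'rV[R]_d) :
  h != 0 -> unit_steps l -> smooth phi ->
  exists2 y : 'rV[R]_d, (forall j, `|y ord0 j - x ord0 j| <= (size l)%:R * `|h|) &
    diffq h l phi x = pderiv (rev (unzip2 l)) phi y.
Proof.
move=> h0; elim: l phi x => [|[c0 i] l IH] phi x.
  by exists x => // j; rewrite subrr normr0 mul0r.
move=> /andP[/andP[c00 c01] ul] sphi.
have dphi : forall y, is_derive y (e_ i) phi ('D_(e_ i) phi y).
  by move=> y; have [_ /(_ i y)] := sphi [::]; exact: derivableP.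
rewrite -[diffq _ _ _ _]/(dq (h * c0) i (diffq h l phi) x).
have hc0 : h * c0 != 0 by rewrite mulf_neq0.
have [c ch ->] := dq_MVT x hc0 (is_derive_diffq h l dphi).
have [y yP ->] := IH _ (x + c *: e_ i) ul (smooth_pderiv1 i sphi).
exists y; last by rewrite rev_cons /pderiv foldr_rcons.
move=> j; rewrite /= -natr1 mulrDl mul1r.
have := yP j; rewrite !mxE eqxx /=.
have {}ch : `|c| <= `|h| by rewrite (le_trans ch)// normrM ler_piMr.
have : `|c * (j == i)%:R| <= `|h| by case: (j == i); rewrite ?mulr1// mulr0 normr0.
move: (c * _) => r rh yj.
rewrite (_ : _ - _ = (y ord0 j - (x ord0 j + r)) + r); last by ring.
by rewrite (le_trans (ler_normD _ _))// lerD.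
Qed.

Lemma pderiv_supp (phi : 'rV[R]_d -> R) s (x : 'rV[R]_d) : ~ closure [set y | phi y != 0] x -> pderiv s phi x = 0.
Proof.
have oU : open (~` closure [set y | phi y != 0]) by apply: closed_openC; exact: closed_closure.
elim: s x => [|i s IH] x nx.
  apply/eqP; apply: contrapT => /negP h; apply: nx; exact: subset_closure.
rewrite /= (@near_eq_derive _ _ _ _ (cst 0)); first by rewrite derive_cst.
by near=> y; apply: IH; near: y; exact: open_nbhs_nbhs.
Unshelve. all: by end_near. Qed.

Lemma coord_norm_le (x : 'rV[R]_d) i : `|x ord0 i| <= `|x|.
Proof.
have /mapP[j Hj ->] : `|x ord0 i| \in [seq `|x k.1 k.2| | k : 'I_1 * 'I_d].
  by apply/mapP; exists (ord0, i) => //=; rewrite mem_enum.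
by rewrite [leRHS]/Num.norm /= mx_normrE; apply/bigmax_geP; right => /=; exists j.
Qed.

(** The majorant makes every derivative of a test function square integrable and later dominates its
    difference quotients. *)
Lemma test_function_bounds (phi : 'rV[R]_d -> R) s : test_function phi ->
  exists M C, [/\ 0 <= C, 0 <= M & forall x, `|pderiv s phi x| <= C * \1_(box M) x].
Proof.
move=> [sphi cK]; set K := closure _ in cK.
have cs : continuous (pderiv s phi) by have [] := sphi s.
have bK := compact_bounded cK.
have bI : bounded_set (pderiv s phi @` K).
  apply: compact_bounded; apply: continuous_compact => //.
  exact: continuous_subspaceT.
have [M M0 MP] : exists2 M, 0 <= M & forall x, K x -> `|x| <= M.
  have [r [_ rP]] := bK; exists (`|r| + 1); first by rewrite addr_ge0.
  by apply: rP; rewrite (le_lt_trans (ler_norm _))// ltrDl.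
have [C C0 CP] : exists2 C, 0 <= C & forall x, K x -> `|pderiv s phi x| <= C.
  have [r [_ rP]] := bI; exists (`|r| + 1); first by rewrite addr_ge0.
  move=> x Kx; have := rP (`|r| + 1); apply; last by exists x.
  by rewrite (le_lt_trans (ler_norm _))// ltrDl.
(* The box is open, hence the margin 1. *)
exists (M + 1), C; split => //; first by rewrite addr_ge0.
move=> x; have [Kx|nKx] := pselect (K x); last first.
  by rewrite pderiv_supp// normr0 mulr_ge0// indicE.
rewrite indicE mem_set ?mulr1 ?CP//= => i.
rewrite -ltr_norml (le_lt_trans _ (_ : M < M + 1)) ?ltrDl//.
exact: le_trans (coord_norm_le x i) (MP _ Kx).
Qed.

Lemma Lsq_pderiv (phi : 'rV[R]_d -> R) s : test_function phi -> Lsq (pderiv s phi).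
Proof.
move=> tphi; have [M [C [C0 M0 hC]]] := test_function_bounds s tphi.
have cs : continuous (pderiv s phi) by have [/(_ s)[]] := tphi.
apply: (@Lsq_le _ _ _ mu _ (C *: @indic_fun R d (box M))).
- exact: measurable_rV_continuous.
- by apply: LsqZ; exact: Lsq_indic (measurable_open_box _ _) (@subset_refl _ _).
- by move=> x; rewrite scalefE (le_trans (hC x))// ler_norm.
Qed.

(** [diffq_MVT] and continuity give pointwise convergence, and the common bounded support gives
    domination. *)
Lemma diffq_test_cvg (phi : 'rV[R]_d -> R) l (h : nat -> R) :
  test_function phi -> unit_steps l ->
  (forall n, h n != 0) -> (forall n, `|h n| <= 1) -> h @ \oo --> (0 : R) ->
  ip (diffq (h n) l phi - pderiv (rev (unzip2 l)) phi)
     (diffq (h n) l phi - pderiv (rev (unzip2 l)) phi) @[n --> \oo] --> (0 : R).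
Proof.
move=> tphi ul h0 h1 hcvg; set s := rev _.
have [sphi _] := tphi.
have [M [C [C0 M0 hC]]] := test_function_bounds s tphi.
have Hphi : Lsq phi by exact: (@Lsq_pderiv phi [::]).
(* The point supplied by [diffq_MVT] is within [size l] of x in each coordinate since |h n| <= 1, so
   all the quotients live in this enlarged box. *)
pose B := box (M + (size l)%:R).
have mB : measurable B by exact: measurable_open_box.
have HB : Lsq (C *: @indic_fun R d B).
  by apply: LsqZ; exact: Lsq_indic mB (@subset_refl _ _).
have [|||//] := @Lsq_dominated _ _ _ mu (fun n => diffq (h n) l phi) (pderiv s phi) _ _ HB.
- by move=> n; apply: Lsq_measurable (Lsq_diffq (h n) l Hphi).
- move=> n x; have [y yx ->] := diffq_MVT x (h0 n) ul sphi.
  rewrite -/s scalefE normrM (ger0_norm C0) (le_trans (hC y))// ler_wpM2l//.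
  rewrite /indic_fun !indicE; have [yM|] := boolP (y \in box M); last by rewrite normr_ge0.
  rewrite mem_set ?normr1// => j; move: yM; rewrite inE => /(_ j).
  rewrite -!ltr_norml => yM.
  have -> : x ord0 j = y ord0 j - (y ord0 j - x ord0 j) by rewrite opprB addrC subrK.
  rewrite (le_lt_trans (ler_normB _ _))// ltr_leD// (le_trans (yx j))//.
  by rewrite ler_piMr.
- move=> x; have /choice[y yP] n : exists y : 'rV[R]_d,
      (forall j, `|y ord0 j - x ord0 j| <= (size l)%:R * `|h n|) /\
      diffq (h n) l phi x = pderiv s phi y.
    by have [y yx yE] := diffq_MVT x (h0 n) ul sphi; exists y.
  have -> : (fun n => diffq (h n) l phi x) = (fun n => pderiv s phi (y n)).
    by apply/funext => n; exact: (yP n).2.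
  have cs : continuous (pderiv s phi) by have [] := sphi s.
  apply: (@cvg_comp _ _ _ y (pderiv s phi) _ (nbhs x)); last exact: cs.
  apply/cvg_ballP => e e0.
  have e'0 : 0 < e / (size l).+1%:R by rewrite divr_gt0.
  move/cvgrPdist_lt : hcvg => /(_ _ e'0); apply: filterS => n.
  rewrite sub0r normrN ltr_pdivlMr// mulrC => hn; split => // i j.
  rewrite ord1 /ball/= distrC (le_lt_trans ((yP n).1 j))//.
  by apply: le_lt_trans hn; rewrite ler_wpM2r// ler_nat.
Qed.

(** The quotients are moved onto the test function, where they converge in norm, and a bounded
    weakly convergent sequence may be paired with a norm convergent one. Moving reverses the list
    and [diffq_test_cvg] reverses it back. *)
Lemma weak_limit_deriv (F : set_system nat) (PF : ProperFilter F) l (h : nat -> R)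
    (u : nat -> 'rV[R]_d -> R^o) v w C :
  F --> \oo -> unit_steps l ->
  (forall n, h n != 0) -> (forall n, `|h n| <= 1) -> h @ \oo --> (0 : R) ->
  (forall n, Lsq (u n)) -> (forall n, ip (u n) (u n) <= C) -> Lsq v -> Lsq w ->
  (forall f, Lsq f -> ip (u n) f @[n --> F] --> ip v f) ->
  (forall f, Lsq f -> ip (diffq (h n) l (u n)) f @[n --> F] --> ip w f) ->
  weak_deriv (unzip2 l) v w.
Proof.
move=> Foo ul h0 h1 hcvg Hu uC Hv Hw uv uw phi tphi; set s := unzip2 l.
have Hphi : Lsq phi by exact: (@Lsq_pderiv phi [::]).
have Hd : Lsq (pderiv s phi) by exact: Lsq_pderiv.
change (ip v (pderiv s phi) = (-1) ^+ size s * ip w phi).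
pose D n := diffq (- h n) (rev l) phi.
have HD n : Lsq (D n) by exact: Lsq_diffq.
have HB n : Lsq (D n - pderiv s phi) by exact: (ip_memB ia).
have cD : ip (D n - pderiv s phi) (D n - pderiv s phi) @[n --> F] --> (0 : R).
  have := @diffq_test_cvg phi (rev l) (fun n => - h n) tphi.
  rewrite /unit_steps all_rev /unzip2 map_rev revK -/(unzip2 l) -/s => /(_ ul) H.
  apply: cvg_trans; first exact: (cvg_app _ Foo).
  apply: H.
  - by move=> n; rewrite oppr_eq0.
  - by move=> n; rewrite normrN.
  - by rewrite -[X in _ --> X]oppr0; apply: cvgN.
have cu : ip (u n) (D n - pderiv s phi) @[n --> F] --> (0 : R).
  apply/cvgrPdist_le => e e0; have C0 : 0 <= C by rewrite (le_trans _ (uC 0%N))// (ip_ge0 ia).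
  have C1 : 0 < C + 1 by rewrite ltr_wpDl.
  move/cvgrPdist_le : cD => /(_ (e ^+ 2 / (C + 1))).
  rewrite divr_gt0 ?exprn_gt0// => /(_ isT); apply: filterS => n.
  rewrite !sub0r !normrN ger0_norm ?(ip_ge0 ia)// ler_pdivlMr// => hn.
  rewrite -(@ler_pXn2r _ 2)// ?nnegrE// ?(ltW e0)// real_normK ?num_real//.
  rewrite (le_trans (cauchy_schwarz ia (Hu n) (HB n)))// (le_trans _ hn)// mulrC.
  by rewrite ler_wpM2l ?(ip_ge0 ia)// (le_trans (uC n))// lerDl.
have c1 : ip (u n) (D n) @[n --> F] --> ip v (pderiv s phi).
  rewrite (_ : (fun n => _) = (fun n => ip (u n) (D n - pderiv s phi) + ip (u n) (pderiv s phi))).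
    by rewrite -[X in _ --> X]add0r; apply: cvgD => //; exact: uv.
  by apply/funext => n; rewrite (ipBr ia)// subrK.
have c2 : ip (u n) (D n) @[n --> F] --> (-1) ^+ size s * ip w phi.
  rewrite (_ : (fun n => _) = (fun n => (-1) ^+ size s * ip (diffq (h n) l (u n)) phi)).
    by apply: cvgM; [exact: cvg_cst|exact: uw].
  apply/funext => n; rewrite ip_diffq// /s size_map mulrA -exprD addnn -signr_odd odd_double.
  by rewrite expr0 mul1r.
by rewrite -(cvg_lim _ c1)// (cvg_lim _ c2).
Qed.

End difference_quotients.

(** * Second differences and the discrete Laplacian *)

Section discrete_laplacian.
Context (R : realType) (d : nat).
Local Notation mu := (@lebesgue_rV R d).
Local Notation Lsq := (Lsq mu).
Local Notation ip := (ip mu).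
Local Notation ia := (@Lsq_inner_product _ _ _ mu).
Local Notation e_ i := (delta_mx ord0 i : 'rV[R]_d).
Implicit Types (f g u v : 'rV[R]_d -> R^o) (h : R) (i j : 'I_d).

(** The symmetric second difference (f(x + h e_i) - 2 f(x) + f(x - h e_i)) / h^2. *)
Definition dq2 h i f := dq (- h) i (dq h i f).

Lemma Lsq_dq2 h i f : Lsq f -> Lsq (dq2 h i f).
Proof. by move=> Hf; apply: Lsq_dq; exact: Lsq_dq. Qed.

Lemma ip_dq2 h i f g : Lsq f -> Lsq g ->
  ip (dq2 h i f) g = - ip (dq h i f) (dq h i g).
Proof. by move=> Hf Hg; rewrite /dq2 ip_dq ?opprK//; exact: Lsq_dq. Qed.

Lemma ip_dq2C h i f g : Lsq f -> Lsq g -> ip (dq2 h i f) g = ip f (dq2 h i g).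
Proof.
move=> Hf Hg; rewrite ip_dq2// (ipC ia Hf) ?ip_dq2//; last exact: Lsq_dq2.
by congr (- _); apply: (ipC ia); exact: Lsq_dq.
Qed.

Lemma dqD h i f g : dq h i (f + g) = dq h i f + dq h i g.
Proof.
by apply/funext => x; rewrite addfE !dqE !addfE;
   move: (f x) (f _) (g x) (g _) => p q r s; ring.
Qed.

Lemma dqZ h i c f : dq h i (c *: f) = c *: dq h i f.
Proof.
by apply/funext => x; rewrite scalefE !dqE !scalefE; move: (f x) (f _) => p q; ring.
Qed.

Lemma dq_comm h k i j f : dq h i (dq k j f) = dq k j (dq h i f).
Proof.
apply/funext => x; rewrite !dqE (addrAC x).
by move: (f _) (f _) (f _) (f _) => p q r s; ring.
Qed.

Lemma dq_dq2_comm h k i j f : dq h i (dq2 k j f) = dq2 k j (dq h i f).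
Proof. by rewrite /dq2 dq_comm (dq_comm h k). Qed.

Lemma ip_sq_dq2 h i j f : Lsq f ->
  ip (dq h i (dq h j f)) (dq h i (dq h j f)) = ip (dq2 h i f) (dq2 h j f).
Proof.
move=> Hf; have Hj := Lsq_dq h j Hf; have Hi := Lsq_dq h i Hf.
rewrite [LHS](_ : _ = - ip (dq2 h i (dq h j f)) (dq h j f)); last by rewrite ip_dq2 ?opprK.
rewrite -dq_dq2_comm ip_dq//; last exact: Lsq_dq2.
by rewrite opprK.
Qed.

(** At a fixed step the discretized operator is bounded, which is what allows [lax_milgram] to be
    applied to it on all of L^2. *)
Lemma ip_sq_dq_le h i f : Lsq f -> ip (dq h i f) (dq h i f) <= 4 * h ^- 2 * ip f f.
Proof.
move=> Hf; rewrite /dq (ip_sqZ ia); last by apply: (ip_memB ia) => //; exact: Lsq_tau.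
rewrite [leRHS](_ : _ = h^-1 ^+ 2 * (4 * ip f f)); last by rewrite exprVn; ring.
apply: ler_wpM2l; first exact: sqr_ge0.
have Hn := ip_memN ia Hf; have Ht := Lsq_tau (h *: e_ i) Hf.
rewrite (le_trans (ip_sqD_le ia Ht Hn))// ip_sq_tau//.
by rewrite (ipNr ia)// (ipNl ia)// opprK; lra.
Qed.

Lemma dq_double h i f : h != 0 ->
  dq (2 * h) i f = 2^-1 *: (tau (h *: e_ i) (dq h i f) + dq h i f).
Proof.
move=> h0; apply/funext => x; rewrite scalefE addfE /tau !dqE -addrA -scalerDl.
rewrite [h + h](_ : _ = 2 * h); last by ring.
by move: (f _) (f _) (f _) => p q r; field.
Qed.

(** The quotient at step 2h is the mean of the quotient at step h and its translate, and
    translations are isometries. *)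
Lemma ip_dq_double h i f : h != 0 -> Lsq f ->
  ip (dq (2 * h) i f) (dq (2 * h) i f) <= ip (dq h i f) (dq h i f).
Proof.
move=> h0 Hf; have Hd := Lsq_dq h i Hf; have Ht := Lsq_tau (h *: e_ i) Hd.
rewrite dq_double// (ip_sqZ ia); last exact: LsqD.
have := ip_sqD_le ia Ht Hd; rewrite ip_sq_tau//; rewrite expr2; lra.
Qed.

Lemma ip_dq_halving h i f n : h != 0 -> Lsq f ->
  ip (dq h i f) (dq h i f) <= ip (dq (h / 2 ^+ n) i f) (dq (h / 2 ^+ n) i f).
Proof.
move=> h0 Hf; elim: n => [|n IH]; first by rewrite expr0 divr1.
apply: (le_trans IH); rewrite (_ : h / 2 ^+ n = 2 * (h / 2 ^+ n.+1)).
  by apply: ip_dq_double => //; rewrite mulf_neq0// invr_neq0// expf_neq0.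
by rewrite exprS; field; rewrite expf_neq0.
Qed.

Definition laplacian_h h f : 'rV[R]_d -> R^o := \sum_(i < d) dq2 h i f.

Lemma Lsq_laplacian h f : Lsq f -> Lsq (laplacian_h h f).
Proof. by move=> Hf; apply: (ip_mem_sum ia) => i _; exact: Lsq_dq2. Qed.

Lemma ip_laplacian h f g : Lsq f -> Lsq g ->
  ip (laplacian_h h f) g = - \sum_(i < d) ip (dq h i f) (dq h i g).
Proof.
move=> Hf Hg; rewrite (ip_suml ia)//; last by move=> i _; exact: Lsq_dq2.
by rewrite -sumrN; apply: eq_bigr => i _; rewrite ip_dq2.
Qed.

(** Differences commute, so summation by parts turns <D_ii f, D_jj f> into |D_i D_j f|^2. A bound on
    the Laplacian alone thus controls every second difference, mixed ones included. *)
Lemma ip_sq_laplacian h f : Lsq f -> ip (laplacian_h h f) (laplacian_h h f) =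
  \sum_(i < d) \sum_(j < d) ip (dq h i (dq h j f)) (dq h i (dq h j f)).
Proof.
move=> Hf; rewrite (ip_suml ia) ?(ip_sumr ia)//; try by move=> i _; exact: Lsq_dq2.
  apply: eq_bigr => i _; rewrite (ip_sumr ia); last 2 first.
  - by move=> j _; exact: Lsq_dq2.
  - exact: Lsq_dq2.
  by apply: eq_bigr => j _; rewrite ip_sq_dq2.
exact: Lsq_laplacian.
Qed.

Lemma ip_dq_dq_le h i j f : Lsq f -> ip (dq h i (dq h j f)) (dq h i (dq h j f)) <=
  ip (laplacian_h h f) (laplacian_h h f).
Proof.
move=> Hf; have p a b : 0 <= ip (dq h a (dq h b f)) (dq h a (dq h b f)).
  by apply: (ip_ge0 ia); apply: Lsq_dq; exact: Lsq_dq.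
rewrite ip_sq_laplacian//.
apply: (@le_trans _ _ (\sum_(b < d) ip (dq h i (dq h b f)) (dq h i (dq h b f)))).
  by rewrite [leRHS](bigD1 j)//= lerDl; apply: sumr_ge0 => b _; exact: p.
rewrite [leRHS](bigD1 i)//= lerDl; apply: sumr_ge0 => a _.
by apply: sumr_ge0 => b _; exact: p.
Qed.

Lemma ip_dq2_le h i f : Lsq f -> ip (dq2 h i f) (dq2 h i f) <=
  ip (laplacian_h h f) (laplacian_h h f).
Proof. by move=> Hf; rewrite -ip_sq_dq2//; exact: ip_dq_dq_le. Qed.

(** From |Lap_h f + f|^2 >= 0 and <Lap_h f, f> = - sum_i |D_i f|^2. *)
Lemma ip_dq_le h i f : Lsq f -> 2 * ip (dq h i f) (dq h i f) <=
  ip (laplacian_h h f) (laplacian_h h f) + ip f f.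
Proof.
move=> Hf; have HL := Lsq_laplacian h Hf.
have := ip_ge0 ia (LsqD HL Hf); rewrite (ip_sqD ia)// (ip_laplacian h Hf Hf).
rewrite (bigD1 i)//=.
have : 0 <= \sum_(j < d | j != i) ip (dq h j f) (dq h j f).
  by apply: sumr_ge0 => j _; apply: (ip_ge0 ia); exact: Lsq_dq.
lra.
Qed.

Lemma diffq_bound h s f C : Lsq f -> (size s <= 2)%N ->
  ip f f <= C -> ip (laplacian_h h f) (laplacian_h h f) <= C ->
  ip (diffq h [seq (1, i) | i <- s] f) (diffq h [seq (1, i) | i <- s] f) <= C.
Proof.
move=> Hf; case: s => [|i [|j [|]]]//= _ fC LC; rewrite ?mulr1//.
- by have := ip_dq_le h i Hf; lra.
- by rewrite (le_trans (ip_dq_dq_le h i j Hf)).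
Qed.

End discrete_laplacian.

(** * The resolvent of the continuous operator *)

Section hamiltonian.
Context (R : realType) (d : nat) (V : 'rV[R]_d -> R) (M theta m : R).
Context (mV : measurable_fun [set: 'rV[R]_d] V) (VM : forall x, 0 <= V x <= M).
Context (theta_gt0 : 0 < theta) (theta_lt1 : theta < 1).
Local Notation mu := (@lebesgue_rV R d).
Local Notation Lsq := (Lsq mu).
Local Notation ip := (ip mu).
Local Notation ia := (@Lsq_inner_product _ _ _ mu).
Local Notation e_ i := (delta_mx ord0 i : 'rV[R]_d).
Context (form_ge : forall g, Lsq g -> m * ip g g <= (2 * d)%:R * ip g g
    - 2 * \sum_(i < d) ip (tau (theta *: e_ i) g) g + ip (mulop V g) g).
Implicit Types (f g u v : 'rV[R]_d -> R^o).

Definition dyadic n : R := theta / 2 ^+ n.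

Lemma dyadic_gt0 n : 0 < dyadic n.
Proof. by rewrite divr_gt0// exprn_gt0. Qed.

Lemma dyadic_neq0 n : dyadic n != 0.
Proof. by rewrite gt_eqF// dyadic_gt0. Qed.

Lemma dyadic_le1 n : `|dyadic n| <= 1.
Proof.
rewrite ger0_norm ?(ltW (dyadic_gt0 n))// ler_pdivrMr ?exprn_gt0// mul1r.
by rewrite (le_trans (ltW theta_lt1))// exprn_ege1// ler1n.
Qed.

Lemma dyadic_cvg0 : dyadic @ \oo --> (0 : R).
Proof.
have -> : dyadic = geometric theta 2^-1.
  by apply/funext => n; rewrite /dyadic /geometric/= exprVn.
by apply: cvg_geometric; rewrite ger0_norm ?invf_lt1 ?ltr1n.
Qed.

(** At step theta, theta^2 |D_i g|^2 expands to 2 |g|^2 - 2 <tau g, g>, which is the integrated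
    lattice form; halving the step can only increase the right-hand side. *)
Lemma dyadic_form_ge n g : Lsq g -> m * ip g g <=
  theta ^+ 2 * \sum_(i < d) ip (dq (dyadic n) i g) (dq (dyadic n) i g)
  + ip (mulop V g) g.
Proof.
move=> Hg; apply: (le_trans (form_ge Hg)); rewrite lerD2r.
have t0 : theta != 0 by rewrite gt_eqF.
apply: (@le_trans _ _ (theta ^+ 2 * \sum_(i < d) ip (dq theta i g) (dq theta i g))); last first.
  rewrite ler_wpM2l ?sqr_ge0//; apply: ler_sum => i _.
  exact: ip_dq_halving.
rewrite le_eqVlt; apply/orP; left; apply/eqP.
rewrite [RHS]mulr_sumr [RHS](eq_bigr (fun i => 2 * ip g g - 2 * ip (tau (theta *: e_ i) g) g)).
  rewrite sumrB sumr_const card_ord -mulr_sumr -[_ *+ d]mulr_natl natrM; ring.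
move=> i _; have Ht := Lsq_tau (theta *: e_ i) Hg.
rewrite /dq (ip_sqZ ia); last exact: (ip_memB ia).
by rewrite (ip_sqB ia)// ip_sq_tau//; field.
Qed.

Section fixed_energy.
Context (lambda : R) (lambda_lt : lambda < m).

Let HVf f : Lsq f -> Lsq (mulop V f). Proof. exact: Lsq_mulop mV VM f. Qed.

Definition bform n u v := theta ^+ 2 * \sum_(i < d) ip (dq (dyadic n) i u) (dq (dyadic n) i v)
  + ip (mulop V u) v - lambda * ip u v.

Lemma bform_ge n u : Lsq u -> (m - lambda) * ip u u <= bform n u u.
Proof. by move=> Hu; have := dyadic_form_ge n Hu; rewrite /bform; lra. Qed.

Lemma bform_inner_product n : inner_product Lsq (bform n).
Proof.
have Hd i f : Lsq f -> Lsq (dq (dyadic n) i f) by exact: Lsq_dq.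
split; first exact: Lsq0.
- exact: LsqD.
- exact: LsqZ.
- move=> u v Hu Hv; rewrite /bform (ipC ia Hu Hv) ip_mulopC.
  rewrite (ipC ia Hu (HVf Hv)); congr (_ * _ + _ - _).
  by apply: eq_bigr => i _; apply: (ipC ia); exact: Hd.
- move=> u v w Hu Hv Hw; rewrite /bform mulopD !(ipDl ia)//; try exact: HVf.
  rewrite (eq_bigr (fun i => ip (dq (dyadic n) i u) (dq (dyadic n) i w) +
      ip (dq (dyadic n) i v) (dq (dyadic n) i w))); last first.
    by move=> i _; rewrite dqD (ipDl ia)//; exact: Hd.
  by rewrite big_split/=; ring.
- move=> c u v Hu Hv; rewrite /bform mulopZ !(ipZl ia)//; try exact: HVf.
  rewrite (eq_bigr (fun i => c * ip (dq (dyadic n) i u) (dq (dyadic n) i v))); last first.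
    by move=> i _; rewrite dqZ (ipZl ia)//; exact: Hd.
  by rewrite -mulr_sumr; ring.
- move=> u Hu; apply: le_trans (bform_ge n Hu).
  by rewrite mulr_ge0 ?(ip_ge0 ia)// subr_ge0 ltW.
Qed.

(** [K] depends on the step through [dyadic n ^- 2]; only the lower bound [bform_ge] is uniform in
    [n]. *)
Lemma bform_le n : exists K, forall u, Lsq u -> bform n u u <= K * ip u u.
Proof.
exists (theta ^+ 2 * (d%:R * (4 * dyadic n ^- 2)) + M + `|lambda|) => u Hu.
have u0 := ip_ge0 ia Hu.
have h1 : \sum_(i < d) ip (dq (dyadic n) i u) (dq (dyadic n) i u) <=
    d%:R * (4 * dyadic n ^- 2) * ip u u.
  rewrite (le_trans (ler_sum _ (fun i _ => ip_sq_dq_le (dyadic n) i Hu)))//.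
  by rewrite sumr_const card_ord -[_ *+ d]mulr_natl !mulrA.
have h2 : theta ^+ 2 * \sum_(i < d) ip (dq (dyadic n) i u) (dq (dyadic n) i u) <=
    theta ^+ 2 * (d%:R * (4 * dyadic n ^- 2)) * ip u u.
  by rewrite -[leRHS]mulrA ler_wpM2l ?sqr_ge0.
have h3 := ip_mulop_le mV VM Hu.
have h4 : - lambda * ip u u <= `|lambda| * ip u u.
  by rewrite ler_wpM2r// -normrN ler_norm.
by rewrite /bform !mulrDl; lra.
Qed.

Lemma bformE n u v : Lsq u -> Lsq v -> bform n u v =
  ip (- theta ^+ 2 *: laplacian_h (dyadic n) u + mulop V u - lambda *: u) v.
Proof.
move=> Hu Hv; have HL := Lsq_laplacian (dyadic n) Hu; have HV := HVf Hu.
rewrite (ipBl ia) ?(ipDl ia) ?(ipZl ia)//; try exact: LsqZ; last first.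
  by apply: LsqD => //; exact: LsqZ.
by rewrite ip_laplacian// /bform; ring.
Qed.

Lemma ip_sq_mulop_le u : Lsq u -> ip (mulop V u) (mulop V u) <= M ^+ 2 * ip u u.
Proof.
move=> Hu; rewrite -(ip_sqZ ia)//; apply: ip_sq_le; [exact: HVf|exact: LsqZ|move=> x].
rewrite scalefE /mulop !normrM ler_wpM2r//.
have /andP[V0 V1] := VM x; rewrite !ger0_norm//; exact: le_trans V1.
Qed.

(** The norm estimate, uniform in [n], is coercivity combined with Cauchy-Schwarz: (m - lambda)
    |u|^2 <= <f, u> <= |f| |u|. *)
Lemma discrete_solution n f : Lsq f -> exists u, [/\ Lsq u,
  forall v, Lsq v -> bform n u v = ip f v &
  (m - lambda) ^+ 2 * ip u u <= ip f f].
Proof.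
move=> Hf; have dl : 0 < m - lambda by rewrite subr_gt0.
have [K hK] := bform_le n.
have [u Hu uP] := lax_milgram ia (@Lsq_complete _ _ _ mu) (bform_inner_product n) dl
  (bform_ge n) hK Hf.
exists u; split => //; have := bform_ge n Hu; rewrite uP// => h.
have := cauchy_schwarz ia Hf Hu; have u0 := ip_ge0 ia Hu; have f0 := ip_ge0 ia Hf => cs.
have [->|un0] := eqVneq (ip u u) 0; first by rewrite mulr0.
have up : 0 < ip u u by rewrite lt_def un0.
rewrite -(ler_pM2r up) (le_trans _ cs)// -mulrA -expr2 -exprMn.
apply: lerXn2r => //; rewrite nnegrE; first by rewrite mulr_ge0// ltW.
by apply: le_trans h; rewrite mulr_ge0// ltW.
Qed.

(* The discretizations at steps theta / 2^n all inherit the lower bound m, so their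
   resolvents are uniformly bounded, and the equation bounds their second
   differences; weak limits along an ultrafilter give the solution. *)
Lemma resolvent_solution f : Lsq f -> exists u (lap : 'I_d -> 'rV[R]_d -> R^o),
  [/\ sobolev 2 u, forall i, Lsq (lap i) /\ weak_deriv [:: i; i] u (lap i) &
   let r := - theta ^+ 2 *: (\sum_(i < d) lap i) + mulop V u - lambda *: u - f in
   ip r r = 0].
Proof.
move=> Hf; have dl : 0 < m - lambda by rewrite subr_gt0.
have /choice[u uP] n := discrete_solution n Hf.
have Hu n : Lsq (u n) by have [] := uP n.
have HVu n := HVf (Hu n).
have HL n : Lsq (laplacian_h (dyadic n) (u n)) by exact: Lsq_laplacian.
pose C0 := ip f f / (m - lambda) ^+ 2.
have f0 := ip_ge0 ia Hf.
have C00 : 0 <= C0 by rewrite divr_ge0 ?sqr_ge0.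
have uC0 n : ip (u n) (u n) <= C0.
  by rewrite ler_pdivlMr ?exprn_gt0// mulrC; have [] := uP n.
(* The equation reads theta^2 Lap_h u = V u - lambda u - f; the factors 2 come from applying |x +
   y|^2 <= 2 |x|^2 + 2 |y|^2 twice. *)
pose C1 := theta ^- 4 * (2 * (2 * M ^+ 2 * C0 + 2 * lambda ^+ 2 * C0) + 2 * ip f f).
have LC1 n : ip (laplacian_h (dyadic n) (u n)) (laplacian_h (dyadic n) (u n)) <= C1.
  set L := laplacian_h _ _; have HLn : Lsq L by exact: HL.
  pose w := mulop V (u n) - lambda *: u n - f.
  have Hlu : Lsq (lambda *: u n) by exact: LsqZ.
  have Hw : Lsq w by apply: (ip_memB ia) => //; apply: (ip_memB ia).
  have Lw v : Lsq v -> theta ^+ 2 * ip L v = ip w v.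
    move=> Hv; have [_ /(_ v Hv)] := uP n; rewrite bformE// -/L => e _.
    have HLZ : Lsq (- theta ^+ 2 *: L) by exact: LsqZ.
    have Hs : Lsq (mulop V (u n) - lambda *: u n) by exact: (ip_memB ia).
    rewrite /w (ipBl ia Hs Hf Hv) (ipBl ia (HVu n) Hlu Hv) (ipZl ia lambda (Hu n) Hv) -e.
    rewrite (ipBl ia (LsqD HLZ (HVu n)) Hlu Hv) (ipDl ia HLZ (HVu n) Hv).
    by rewrite (ipZl ia _ HLn Hv) (ipZl ia lambda (Hu n) Hv); ring.
  have wC : ip w w <= 2 * (2 * M ^+ 2 * C0 + 2 * lambda ^+ 2 * C0) + 2 * ip f f.
    have Hn := ip_memN ia Hf; have Hln := ip_memN ia Hlu.
    have H1 : Lsq (mulop V (u n) - lambda *: u n) by exact: (ip_memB ia).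
    rewrite (le_trans (ip_sqD_le ia H1 Hn))// (ipNl ia) ?(ipNr ia)// opprK lerD2r.
    rewrite ler_pM2l// (le_trans (ip_sqD_le ia (HVu n) Hln))//.
    rewrite (ipNl ia) ?(ipNr ia)// opprK (ip_sqZ ia)//.
    have h1 : M ^+ 2 * ip (u n) (u n) <= M ^+ 2 * C0 by rewrite ler_wpM2l ?sqr_ge0.
    have h2 : lambda ^+ 2 * ip (u n) (u n) <= lambda ^+ 2 * C0 by rewrite ler_wpM2l ?sqr_ge0.
    have := ip_sq_mulop_le (Hu n); lra.
  have t2 : 0 < theta ^+ 2 by rewrite exprn_gt0.
  have LL0 := ip_ge0 ia HLn.
  rewrite -ler_pdivrMl; last by rewrite invr_gt0 exprn_gt0.
  rewrite invrK (le_trans _ wC)//.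
  have Lww : theta ^+ 2 * (theta ^+ 2 * ip L L) = ip w w.
    by rewrite Lw// (ipC ia Hw HLn) Lw.
  by rewrite -Lww mulrA -exprD.
pose C := Num.max C0 C1.
(* A single ultrafilter serves [u] and all its quotients, so that their weak limits belong
   together. *)
have [F [UF Foo]] := @ultraFilterLemma nat eventually _.
have PF := @ultra_proper _ _ UF.
have wl (v : nat -> 'rV[R]_d -> R^o) : (forall n, Lsq (v n)) ->
    (forall n, ip (v n) (v n) <= C) -> exists l, Lsq l /\
    forall g, Lsq g -> ip (v n) g @[n --> F] --> ip l g.
  move=> Hv vC; have [l [Hl _ lP]] := weak_limit ia (@Lsq_complete _ _ _ mu) UF Hv vC.
  by exists l.
have uC n : ip (u n) (u n) <= C by rewrite le_max uC0.
have LC n : ip (laplacian_h (dyadic n) (u n)) (laplacian_h (dyadic n) (u n)) <= C.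
  by rewrite le_max LC1 orbT.
have [U [HU UP]] := wl u Hu uC.
have /choice[lap lapP] i : exists l, Lsq l /\
    forall g, Lsq g -> ip (dq2 (dyadic n) i (u n)) g @[n --> F] --> ip l g.
  apply: wl => n; first exact: Lsq_dq2.
  exact: le_trans (ip_dq2_le (dyadic n) i (Hu n)) (LC n).
exists U, lap; split.
- split; first exact: HU.
  (* Every list of at most two directions gets its own bounded family of forward quotients, hence
     its own weak limit. *)
  move=> s s2; have [w [Hw wP]] := wl (fun n => diffq (dyadic n) [seq (1, i) | i <- s] (u n))
    (fun n => Lsq_diffq _ _ (Hu n))
    (fun n => diffq_bound (Hu n) s2 (uC n) (LC n)).
  exists w; first exact: Hw.
  have := @weak_limit_deriv R d F PF [seq (1, i) | i <- s] dyadic u U w C Foo.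
  rewrite /unzip2 -map_comp map_id; apply => //.
  + by rewrite /unit_steps all_map; apply/allP => i _ /=; rewrite oner_neq0 normr1 lexx.
  + exact: dyadic_neq0.
  + exact: dyadic_le1.
  + exact: dyadic_cvg0.
- move=> i; have [Hl lP] := lapP i; split => //.
  (* As an iterated quotient, [dq2] has the steps -1 and 1 in direction i. *)
  have := @weak_limit_deriv R d F PF [:: (-1, i); (1, i)] dyadic u U (lap i) C Foo.
  apply => //.
  + by rewrite /unit_steps /= oppr_eq0 oner_neq0 normrN normr1 lexx.
  + exact: dyadic_neq0.
  + exact: dyadic_le1.
  + exact: dyadic_cvg0.
  + by move=> g Hg; have := lP g Hg; rewrite /diffq /= ; under eq_fun do rewrite /dq2 -[- dyadic _]mulrN1 -[X in dq X _ (u _)]mulr1.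
- move=> r.
  have Hlap i : Lsq (lap i) by have [] := lapP i.
  have HVU := HVf HU.
  have Hsum : Lsq (\sum_(i < d) lap i) by apply: (ip_mem_sum ia).
  have HZ c g : Lsq g -> Lsq (c *: g) by exact: LsqZ.
  have H1 := HZ (- theta ^+ 2) _ Hsum.
  have H2 : Lsq (- theta ^+ 2 *: (\sum_(i < d) lap i) + mulop V U) by exact: LsqD.
  have H3 : Lsq (- theta ^+ 2 *: (\sum_(i < d) lap i) + mulop V U - lambda *: U).
    by apply: (ip_memB ia) => //; exact: HZ.
  have Hr : Lsq r by exact: (ip_memB ia).
  suff rv v : Lsq v -> ip r v = 0 by exact: rv.
  move=> Hv.
  (* [V] is moved onto [v], so that weak convergence of [u] is enough for the potential term. *)
  have E : ip r v = - theta ^+ 2 * (\sum_(i < d) ip (lap i) v) + ip U (mulop V v)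
      - lambda * ip U v - ip f v.
    rewrite /r (ipBl ia)// (ipBl ia)//; last exact: HZ.
    by rewrite (ipDl ia)// !(ipZl ia)// (ip_suml ia)// ip_mulopC.
  have cn : (- theta ^+ 2 * (\sum_(i < d) ip (dq2 (dyadic n) i (u n)) v) + ip (u n) (mulop V v)
      - lambda * ip (u n) v - ip f v) @[n --> F] --> ip r v.
    rewrite E; apply: cvgB; last exact: cvg_cst.
    apply: cvgB; last by apply: cvgM; [exact: cvg_cst|exact: UP].
    apply: cvgD; last by apply: UP; exact: HVf.
    apply: cvgM; first exact: cvg_cst.
    elim: (index_enum 'I_d) => [|i s IH].
      by under eq_fun do rewrite big_nil; rewrite big_nil; exact: cvg_cst.
    under eq_fun do rewrite big_cons; rewrite big_cons; apply: cvgD => //.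
    by have [_ lP] := lapP i; exact: lP.
  rewrite -(cvg_lim _ cn)// (_ : (fun n => _) = cst 0) ?lim_cst//.
  apply/funext => n; have [_ /(_ v Hv) + _] := uP n.
  rewrite bformE// (ipBl ia) ?(ipDl ia) ?(ipZl ia) ?(ip_suml ia) ?ip_mulopC//; try exact: HZ.
  + by move=> <-; rewrite /=; ring.
  + by move=> i _; exact: Lsq_dq2.
  + by apply: LsqD => //; exact: HZ.
Qed.

End fixed_energy.
End hamiltonian.

(** * Second differences of functions with weak second derivatives *)

Section weak_second_derivatives.
Context (R : realType) (d : nat).
Local Notation mu := (@lebesgue_rV R d).
Local Notation Lsq := (Lsq mu).
Local Notation ip := (ip mu).
Local Notation ia := (@Lsq_inner_product _ _ _ mu).
Local Notation e_ i := (delta_mx ord0 i : 'rV[R]_d).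
Implicit Types (f g w : 'rV[R]_d -> R^o) (h : R) (a : 'rV[R]_d) (s : seq 'I_d).

Lemma ip_sq_eq0 f g : Lsq f -> Lsq g -> ip f f = 0 -> ip f g = 0.
Proof.
move=> Hf Hg f0; apply/eqP; rewrite -sqrf_eq0 eq_le sqr_ge0 andbT.
by rewrite (le_trans (cauchy_schwarz ia Hf Hg))// f0 mul0r.
Qed.

Lemma difference_tau a (phi : 'rV[R]_d -> R) (v x : 'rV[R]_d) :
  (fun t : R => t^-1 *: (tau a phi (t *: v + x) - tau a phi x : R)) =
  (fun t : R => t^-1 *: (phi (t *: v + (x + a)) - phi (x + a) : R)).
Proof. by apply/funext => t; rewrite /tau addrA. Qed.

Lemma pderiv_tau a (phi : 'rV[R]_d -> R) s :
  pderiv s (tau a phi) = tau a (pderiv s phi).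
Proof.
elim: s => //= i s ->; apply/funext => x.
by rewrite /derive [X in lim (X @ _)]difference_tau.
Qed.

Lemma test_function_tau a (phi : 'rV[R]_d -> R) :
  test_function phi -> test_function (tau a phi).
Proof.
move=> [sphi cK]; split.
  move=> s; rewrite pderiv_tau; have [cs ds] := sphi s; split.
    move=> x; have cx : {for x, continuous (pderiv s phi \o (fun y => y + a))}.
      apply: continuous_comp; last exact: cs.
      by apply: (@cvgD _ _ _ (nbhs x) _ id (cst _) x); [exact: cvg_id|exact: cvg_cst].
    exact: cx.
  move=> i x; rewrite /derivable [X in cvg (X @ _)]difference_tau.
  exact: ds.
set K := closure _ in cK; pose K' := (fun y : 'rV[R]_d => y - a) @` K.
have cK' : compact K'.
  apply: continuous_compact => //; apply: continuous_subspaceT => x.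
  by apply: (@cvgD _ _ _ (nbhs x) _ id (cst _) x); [exact: cvg_id|exact: cvg_cst].
apply: (@subclosed_compact _ (closure _) K') => //; first exact: closed_closure.
have K'c : closed K' by apply: compact_closed => //; exact: norm_hausdorff.
rewrite closureE; apply: smallest_sub => // x /= nx.
by exists (x + a); [exact: subset_closure|rewrite addrK].
Qed.

Lemma weak_deriv_tau a s g w : Lsq g -> Lsq w ->
  weak_deriv s g w -> weak_deriv s (tau a g) (tau a w).
Proof.
move=> Hg Hw gw phi tphi.
have Hphi : Lsq phi by exact: (@Lsq_pderiv _ _ phi [::]).
have Hd : Lsq (pderiv s phi) by exact: Lsq_pderiv.
change (ip (tau a g) (pderiv s phi) = (-1) ^+ size s * ip (tau a w) phi).
rewrite !ip_tauC// -pderiv_tau.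
exact: gw (test_function_tau (- a) tphi).
Qed.

Lemma weak_derivD s g1 g2 w1 w2 : Lsq g1 -> Lsq g2 -> Lsq w1 -> Lsq w2 ->
  weak_deriv s g1 w1 -> weak_deriv s g2 w2 -> weak_deriv s (g1 + g2) (w1 + w2).
Proof.
move=> Hg1 Hg2 Hw1 Hw2 gw1 gw2 phi tphi.
have Hphi : Lsq phi by exact: (@Lsq_pderiv _ _ phi [::]).
have Hd : Lsq (pderiv s phi) by exact: Lsq_pderiv.
change (ip (g1 + g2) (pderiv s phi) = (-1) ^+ size s * ip (w1 + w2) phi).
rewrite !(ipDl ia)// mulrDr; congr (_ + _); [exact: gw1|exact: gw2].
Qed.

Lemma weak_derivZ s c g w : Lsq g -> Lsq w ->
  weak_deriv s g w -> weak_deriv s (c *: g) (c *: w).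
Proof.
move=> Hg Hw gw phi tphi.
have Hphi : Lsq phi by exact: (@Lsq_pderiv _ _ phi [::]).
have Hd : Lsq (pderiv s phi) by exact: Lsq_pderiv.
change (ip (c *: g) (pderiv s phi) = (-1) ^+ size s * ip (c *: w) phi).
rewrite !(ipZl ia)// mulrCA; congr (_ * _); exact: gw.
Qed.

(** Test functions are total, so their pairings determine a weak derivative up to a null
    function. *)
Lemma weak_deriv_unique s g w1 w2 : Lsq w1 -> Lsq w2 ->
  weak_deriv s g w1 -> weak_deriv s g w2 -> ip (w1 - w2) (w1 - w2) = 0.
Proof.
move=> Hw1 Hw2 gw1 gw2; apply: test_functions_total; first exact: (ip_memB ia).
move=> phi tphi; have Hphi : Lsq phi by exact: (@Lsq_pderiv _ _ phi [::]).
change (ip (w1 - w2) phi = 0); rewrite (ipBl ia)//.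
have sn0 : (-1) ^+ size s != 0 :> R by rewrite signr_eq0.
have := gw1 _ tphi; rewrite (gw2 _ tphi) => /(mulfI sn0) E.
by rewrite -[ip w1 phi]E subrr.
Qed.

Section average.
Context (i : 'I_d).

(** The square of the mean of the translations by h/2 and -h/2 in direction i. It carries the second
    difference at step h to the one at step 2h ([dq2_double]) and, its weights 1/4, 1/2, 1/4 summing
    to 1, contracts the norm. *)
Definition avg h f : 'rV[R]_d -> R^o :=
  4^-1 *: (tau (h *: e_ i) f + 2 *: f + tau (- h *: e_ i) f).

Lemma Lsq_avg h f : Lsq f -> Lsq (avg h f).
Proof.
move=> Hf; apply: LsqZ; apply: LsqD; last exact: Lsq_tau.
by apply: LsqD; [exact: Lsq_tau|exact: LsqZ].
Qed.

Lemma ip_avgE h f g : Lsq f -> Lsq g -> ip (avg h f) g =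
  4^-1 * (ip (tau (h *: e_ i) f) g + 2 * ip f g + ip (tau (- h *: e_ i) f) g).
Proof.
move=> Hf Hg; have H1 := Lsq_tau (h *: e_ i) Hf; have H2 := Lsq_tau (- h *: e_ i) Hf.
have H3 : Lsq (2 *: f) by exact: LsqZ.
by rewrite (ipZl ia) ?(ipDl ia) ?(ipZl ia)//; do ?apply: LsqD.
Qed.

Lemma ip_avg_le h f : Lsq f -> ip (avg h f) (avg h f) <= ip f f.
Proof.
move=> Hf; have H1 := Lsq_tau (h *: e_ i) Hf; have H2 := Lsq_tau (- h *: e_ i) Hf.
have H3 : Lsq (2 *: f) by exact: LsqZ.
rewrite (ip_sqZ ia); last by do ?apply: LsqD.
have := ip_sqD_le ia (LsqD H1 H2) H3; have := ip_sqD_le ia H1 H2.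
rewrite !ip_sq_tau// (ip_sqZ ia)// [tau _ f + 2 *: f + _]addrAC expr2; lra.
Qed.

Lemma avg_dq2 h k f : avg h (dq2 k i f) = dq2 k i (avg h f).
Proof.
have T a g : tau a (dq2 k i g) = dq2 k i (tau a g).
  by apply/funext => x; rewrite /tau /dq2 !dqE !(addrAC x a) !(addrAC _ a).
have D f1 f2 : dq2 k i (f1 + f2) = dq2 k i f1 + dq2 k i f2 by rewrite /dq2 !dqD.
have Z c f1 : dq2 k i (c *: f1) = c *: dq2 k i f1 by rewrite /dq2 !dqZ.
by rewrite /avg !T Z !D Z.
Qed.

Lemma dq2_double h f : h != 0 -> dq2 (2 * h) i f = avg h (dq2 h i f).
Proof.
move=> h0; apply/funext => x; rewrite /avg scalefE !addfE scalefE /tau /dq2 !dqE.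
rewrite -!addrA -!scalerDl.
rewrite (_ : - (2 * h) + 2 * h = 0); last by ring.
rewrite (_ : - h + h = 0); last by ring.
rewrite (_ : h + - h = 0); last by ring.
rewrite (_ : h + h = 2 * h); last by ring.
rewrite (_ : - h + - h = - (2 * h)); last by ring.
rewrite !scale0r !addr0.
move: (f x) (f _) (f _) (f _) (f _) => p q r s t.
by field.
Qed.

(** The averages at steps h/2, h/4, ..., h/2^n composed; together they carry the second difference
    at step h/2^n to the one at step h ([dq2_avgs]). *)
Fixpoint avgs n h f := if n is n'.+1 then avg (h / 2) (avgs n' (h / 2) f) else f.

Lemma Lsq_avgs n h f : Lsq f -> Lsq (avgs n h f).
Proof. by move=> Hf; elim: n h => //= n IH h; apply: Lsq_avg. Qed.

Lemma ip_avgs_le n h f : Lsq f -> ip (avgs n h f) (avgs n h f) <= ip f f.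
Proof.
move=> Hf; elim: n h => //= n IH h.
by apply: le_trans (ip_avg_le _ _) (IH _); exact: Lsq_avgs.
Qed.

Lemma avgs_dq2 n h k f : avgs n h (dq2 k i f) = dq2 k i (avgs n h f).
Proof. by elim: n h => //= n IH h; rewrite IH avg_dq2. Qed.

Lemma dq2_avgs n h f : h != 0 -> dq2 h i f = avgs n h (dq2 (h / 2 ^+ n) i f).
Proof.
elim: n h => [|n IH] h h0; first by rewrite /= expr0 divr1.
have h20 : h / 2 != 0 by rewrite mulf_neq0.
rewrite [LHS](_ : _ = dq2 (2 * (h / 2)) i f); last by congr (dq2 _ _ _); field.
by rewrite dq2_double// /= [in LHS](IH _ h20) exprS invfM mulrA.
Qed.

Lemma weak_deriv_avgs n h s g w : Lsq g -> Lsq w ->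
  weak_deriv s g w -> weak_deriv s (avgs n h g) (avgs n h w).
Proof.
move=> Hg Hw gw; elim: n h => //= n IH h; have {}IH := IH (h / 2).
have HG := Lsq_avgs n (h / 2) Hg; have HW := Lsq_avgs n (h / 2) Hw.
move: (avgs n (h / 2) g) (avgs n (h / 2) w) HG HW IH => G W HG HW GW.
have HtG a := Lsq_tau a HG; have HtW a := Lsq_tau a HW.
have HZG : Lsq (2 *: G) by exact: LsqZ.
have HZW : Lsq (2 *: W) by exact: LsqZ.
have HDG a := LsqD (HtG a) HZG; have HDW a := LsqD (HtW a) HZW.
apply: weak_derivZ; [exact: LsqD|exact: LsqD|].
apply: weak_derivD => //; last exact: weak_deriv_tau.
apply: weak_derivD => //; first exact: weak_deriv_tau.
exact: weak_derivZ.
Qed.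

(* Averaging turns the coarse second difference into an average of arbitrarily
   fine ones, hence into a weak limit of averages of the second derivative. *)
Lemma ip_dq2_weak_deriv h g w : h != 0 -> `|h| <= 1 -> Lsq g -> Lsq w ->
  weak_deriv [:: i; i] g w -> ip (dq2 h i g) (dq2 h i g) <= ip w w.
Proof.
move=> h0 h1 Hg Hw gw.
have [F [UF Foo]] := @ultraFilterLemma nat eventually _.
have PF := @ultra_proper _ _ UF.
have [W [HW Wle WP]] := weak_limit ia (@Lsq_complete _ _ _ mu) UF
  (fun n => Lsq_avgs n h Hw) (fun n => ip_avgs_le n h Hw).
have HD := Lsq_dq2 h i Hg.
have HE : Lsq (dq2 h i g - W) by exact: (ip_memB ia).
(* It suffices that the second difference agrees with the weak limit [W] of the averages of [w],
   whose norm is at most that of [w]. *)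
suff E0 : ip (dq2 h i g - W) (dq2 h i g - W) = 0.
  have e1 := ip_sq_eq0 HE HD E0; have e2 := ip_sq_eq0 HE HW E0.
  move: e1 e2; rewrite !(ipBl ia)// (ipC ia HD HW) => e1 e2.
  by apply: le_trans Wle; lra.
apply: test_functions_total => // phi tphi.
have Hphi : Lsq phi by exact: (@Lsq_pderiv _ _ phi [::]).
have Hd : Lsq (pderiv [:: i; i] phi) by exact: Lsq_pderiv.
change (ip (dq2 h i g - W) phi = 0); rewrite (ipBl ia)//; apply/eqP; rewrite subr_eq0; apply/eqP.
pose k n := h / 2 ^+ n.
have kn0 n : k n != 0 by rewrite mulf_neq0// invr_neq0// expf_neq0.
have kn1 n : `|k n| <= 1.
  rewrite /k normrM normfV normrX (ger0_norm (ler0n _ 2)) ler_pdivrMr ?exprn_gt0// mul1r.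
  by rewrite (le_trans h1)// exprn_ege1// ler1n.
have kcvg : k @ \oo --> (0 : R).
  have -> : k = geometric h 2^-1.
    by apply/funext => n; rewrite /k /geometric/= exprVn.
  by apply: cvg_geometric; rewrite ger0_norm ?invf_lt1 ?ltr1n.
have cD := @diffq_test_cvg R d phi [:: (-1, i); (1, i)] k tphi.
have {}cD : ip (dq2 (k n) i phi - pderiv [:: i; i] phi)
    (dq2 (k n) i phi - pderiv [:: i; i] phi) @[n --> \oo] --> (0 : R).
  rewrite (_ : (fun n => _) = (fun n => ip (diffq (k n) [:: (-1, i); (1, i)] phi - pderiv [:: i; i] phi)
    (diffq (k n) [:: (-1, i); (1, i)] phi - pderiv [:: i; i] phi))).
    apply: cD => //.
    by rewrite /unit_steps /= oppr_eq0 oner_neq0 normrN normr1 lexx.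
  by apply/funext => n; rewrite /diffq/= mulrN1 mulr1.
(* [avgs n h g] has weak second derivative [avgs n h w], and its difference at the fine step [k n]
   is the coarse difference of [g]. Both are moved onto [phi], where they approach each other. *)
have diff n : ip (dq2 h i g) phi - ip (avgs n h w) phi =
    ip (avgs n h g) (dq2 (k n) i phi - pderiv [:: i; i] phi).
  have HA := Lsq_avgs n h Hg.
  rewrite (ipBr ia)//; last exact: Lsq_dq2.
  rewrite -ip_dq2C// -avgs_dq2 -dq2_avgs//; congr (_ - _).
  have := weak_deriv_avgs n h Hg Hw gw tphi => /=.
  by rewrite -signr_odd /= expr0 mul1r.
have c0 : ip (dq2 h i g) phi - ip (avgs n h w) phi @[n --> \oo] --> (0 : R).
  apply/cvgrPdist_le => e e0; have G0 := ip_ge0 ia Hg.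
  have G1 : 0 < ip g g + 1 by rewrite ltr_wpDl.
  move/cvgrPdist_le : cD => /(_ (e ^+ 2 / (ip g g + 1))).
  rewrite divr_gt0 ?exprn_gt0// => /(_ isT); apply: filterS => n.
  have HA := Lsq_avgs n h Hg.
  have HB : Lsq (dq2 (k n) i phi - pderiv [:: i; i] phi).
    by apply: (ip_memB ia) => //; exact: Lsq_dq2.
  rewrite !sub0r !normrN diff ger0_norm ?(ip_ge0 ia)// ler_pdivlMr// => hn.
  rewrite -(@ler_pXn2r _ 2)// ?nnegrE// ?(ltW e0)// real_normK ?num_real//.
  rewrite (le_trans (cauchy_schwarz ia HA HB))// (le_trans _ hn)// mulrC.
  by rewrite ler_wpM2l ?(ip_ge0 ia)// (le_trans (ip_avgs_le n h Hg))// lerDl.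
have c1 : ip (dq2 h i g) phi - ip (avgs n h w) phi @[n --> F] -->
    ip (dq2 h i g) phi - ip W phi.
  by apply: cvgB; [exact: cvg_cst|exact: WP].
have c2 : ip (dq2 h i g) phi - ip (avgs n h w) phi @[n --> F] --> (0 : R).
  by apply: cvg_trans c0; exact: (cvg_app _ Foo).
by apply/eqP; rewrite -subr_eq0 -(cvg_lim _ c1)// (cvg_lim _ c2).
Qed.

End average.
End weak_second_derivatives.

Section sobolev_form.
Context (R : realType) (d : nat) (V : 'rV[R]_d -> R) (theta m : R).
Context (theta_gt0 : 0 < theta) (theta_lt1 : theta < 1).
Local Notation mu := (@lebesgue_rV R d).
Local Notation Lsq := (Lsq mu).
Local Notation ip := (ip mu).
Local Notation ia := (@Lsq_inner_product _ _ _ mu).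
Local Notation e_ i := (delta_mx ord0 i : 'rV[R]_d).
Context (form_ge : forall g, Lsq g -> m * ip g g <= (2 * d)%:R * ip g g
    - 2 * \sum_(i < d) ip (tau (theta *: e_ i) g) g + ip (mulop V g) g).

(** For fixed [g] the second differences at steps theta / 2^n are bounded by [ip_dq2_weak_deriv].
    Their weak limit is again a weak second derivative, so by uniqueness it pairs with [g] as [w i]
    does, and [dyadic_form_ge] passes to the limit. *)
Lemma sobolev_form_ge (g : 'rV[R]_d -> R^o) (w : 'I_d -> 'rV[R]_d -> R^o) :
  Lsq g -> (forall i, Lsq (w i) /\ weak_deriv [:: i; i] g (w i)) ->
  m * ip g g <= - theta ^+ 2 * \sum_(i < d) ip (w i) g + ip (mulop V g) g.
Proof.
move=> Hg hw; have Hw i : Lsq (w i) by have [] := hw i.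
have [F [UF Foo]] := @ultraFilterLemma nat eventually _.
have PF := @ultra_proper _ _ UF.
pose h := dyadic theta.
have h0 n : h n != 0 by exact: dyadic_neq0.
have h1 n : `|h n| <= 1 by exact: dyadic_le1.
have cw i : ip (dq2 (h n) i g) g @[n --> F] --> ip (w i) g.
  have [_ gw] := hw i.
  have [l [Hl _ lP]] := weak_limit ia (@Lsq_complete _ _ _ mu) UF
    (fun n => Lsq_dq2 (h n) i Hg)
    (fun n => ip_dq2_weak_deriv (h0 n) (h1 n) Hg (Hw i) gw).
  suff -> : ip (w i) g = ip l g by exact: lP.
  have gl : weak_deriv [:: i; i] g l.
    have := @weak_limit_deriv R d F PF [:: (-1, i); (1, i)] h (fun=> g) g l (ip g g) Foo.
    apply => //.
    + by rewrite /unit_steps /= oppr_eq0 oner_neq0 normrN normr1 lexx.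
    + exact: dyadic_cvg0.
    + by move=> f Hf; exact: cvg_cst.
    + move=> f Hf; have := lP f Hf; rewrite /diffq /=.
      by under eq_fun do rewrite /dq2 -[- h _]mulrN1 -[X in dq X _ g]mulr1.
  have E := weak_deriv_unique (Hw i) Hl gw gl.
  have := ip_sq_eq0 (ip_memB ia (Hw i) Hl) Hg E.
  by rewrite (ipBl ia)// => /eqP; rewrite subr_eq0 => /eqP.
have cs : - theta ^+ 2 * (\sum_(i < d) ip (dq2 (h n) i g) g) + ip (mulop V g) g @[n --> F] -->
    - theta ^+ 2 * \sum_(i < d) ip (w i) g + ip (mulop V g) g.
  apply: cvgD; last exact: cvg_cst.
  apply: cvgM; first exact: cvg_cst.
  elim: (index_enum 'I_d) => [|i s IH].
    by under eq_fun do rewrite big_nil; rewrite big_nil; exact: cvg_cst.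
  by under eq_fun do rewrite big_cons; rewrite big_cons; exact: cvgD.
rewrite -(cvg_lim _ cs)//; apply: limr_ge; first by apply/cvg_ex; eexists; exact: cs.
apply: nearW => n; rewrite (le_trans (dyadic_form_ge theta_gt0 form_ge n Hg))// lerD2r.
rewrite le_eqVlt; apply/orP; left; apply/eqP.
rewrite mulNr -mulrN; congr (_ * _); rewrite -sumrN.
by apply: eq_bigr => i _; rewrite ip_dq2// opprK.
Qed.

End sobolev_form.

(** * The spectrum of the continuous operator lies above m *)

Section spectral_bottom.
Context (R : realType) (d : nat) (V : 'rV[R]_d -> R) (theta : R).
Context (V_ge0 : forall x, 0 <= V x) (V_cont : continuous V).
Context (V_per : forall (x : 'rV[R]_d) (k : 'rV[int]_d), V (x + map_mx intr k) = V x).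
Local Notation mu := (@lebesgue_rV R d).
Local Notation Lsq := (Lsq mu).
Local Notation ip := (ip mu).
Local Notation ia := (@Lsq_inner_product _ _ _ mu).
Local Notation e_ i := (delta_mx ord0 i : 'rV[R]_d).

Lemma periodic_bounded : exists M, forall x, 0 <= V x <= M.
Proof.
pose K := [set x : 'rV[R]_d | forall i, `[0, 1]%classic (x ord0 i)].
have cK : compact K.
  by apply: (@rV_compact R d (fun=> `[0, 1]%classic)) => i; exact: segment_compact.
have cVK : compact (V @` K).
  by apply: continuous_compact => //; exact: continuous_subspaceT.
have [r [_ rP]] := compact_bounded cVK.
exists (`|r| + 1) => x; rewrite V_ge0/=.
pose k : 'rV[int]_d := \row_j Num.floor (x ord0 j).
rewrite -(subrK (map_mx intr k) x) V_per.
apply: (le_trans (ler_norm _)); apply: rP.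
  by rewrite (le_lt_trans (ler_norm _))// ltrDl.
exists (x - map_mx intr k) => // i /=; rewrite !mxE in_itv/=.
have := floor_le_tmp (x ord0 i); have := lt_succ_floor (x ord0 i).
by rewrite intrD; lra.
Qed.

Lemma L2norm_ip f : Lsq f -> L2norm f = (Num.sqrt (ip f f))%:E.
Proof. exact: Lnorm2_ip. Qed.

(** The form bound on the domain gives injectivity and the inverse bound [(m - lambda)^-1];
    surjectivity is [resolvent_solution]. *)
Lemma resolvent_set_B (m lambda : R) :
  0 < theta -> theta < 1 -> lambda < m ->
  (forall g, Lsq g -> m * ip g g <= (2 * d)%:R * ip g g
    - 2 * \sum_(i < d) ip (tau (theta *: e_ i) g) g + ip (mulop V g) g) ->
  resolvent_set (@L2 R d) (@L2norm R d) (B_graph V theta) lambda.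
Proof.
move=> t0 t1 lm form_ge; have [M VM] := periodic_bounded.
have mV := measurable_rV_continuous V_cont.
have dl : 0 < m - lambda by rewrite subr_gt0.
(* From (m - lambda) |g|^2 <= <v, g> <= |v| |g|, squared and divided by |g|^2. *)
have op_subE g v : op_sub (B_graph V theta) lambda g v ->
    [/\ Lsq g, Lsq v & (m - lambda) ^+ 2 * ip g g <= ip v v].
  move=> [U [[Hg _] [lap [hlap UE]]] vE].
  change (Lsq g) in Hg; have Hlap i : Lsq (lap i) by have [] := hlap i.
  have Hsum : Lsq (\sum_(i < d) (lap i : 'rV[R]_d -> R^o)) by apply: (ip_mem_sum ia).
  have HV := Lsq_mulop mV VM Hg.
  have {}vE : v = - theta ^+ 2 *: (\sum_(i < d) (lap i : 'rV[R]_d -> R^o))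
      + mulop V g - lambda *: (g : _ -> R^o).
    by rewrite vE UE; apply/funext => x; rewrite !pointE fct_sumE.
  have HZ c f : Lsq f -> Lsq (c *: f) by exact: LsqZ.
  have Hv : Lsq v by rewrite vE; apply: (ip_memB ia); [apply: LsqD => //; exact: HZ|exact: HZ].
  have gv : (m - lambda) * ip g g <= ip v g.
    have := sobolev_form_ge t0 t1 form_ge Hg hlap.
    rewrite vE (ipBl ia (LsqD (HZ _ _ Hsum) HV) (HZ _ _ Hg) Hg).
    rewrite (ipDl ia (HZ _ _ Hsum) HV Hg) !(ipZl ia)// (ip_suml ia)//.
    lra.
  split => //; have := cauchy_schwarz ia Hv Hg.
  have g0 := ip_ge0 ia Hg; have v0 := ip_ge0 ia Hv => cs.
  have [->|gn0] := eqVneq (ip g g) 0; first by rewrite mulr0.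
  have gp : 0 < ip g g by rewrite lt_def gn0.
  rewrite -(ler_pM2r gp) (le_trans _ cs)// -mulrA -expr2 -exprMn.
  apply: lerXn2r => //; rewrite nnegrE; first by rewrite mulr_ge0// ltW.
  by apply: le_trans gv; rewrite mulr_ge0// ltW.
split.
- move=> g v /op_subE[Hg Hv gv]; rewrite !L2norm_ip// => -[] /eqP.
  rewrite sqrtr_eq0 => v0; congr EFin; apply/eqP; rewrite sqrtr_eq0.
  by rewrite -(pmulr_rle0 _ (_ : 0 < (m - lambda) ^+ 2)) ?exprn_gt0// (le_trans gv).
- move=> f Hf; change (Lsq f) in Hf.
  have [u [lap [Hu hlap r0]]] := resolvent_solution mV VM t0 t1 form_ge lm Hf.
  have Hlap i : Lsq (lap i) by have [] := hlap i.
  exists u, (fun x => (- theta ^+ 2 * (\sum_(i < d) lap i x) + V x * u x) - lambda * u x).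
  split.
    exists (fun x => - theta ^+ 2 * (\sum_(i < d) lap i x) + V x * u x) => //.
    by split => //; exists lap.
  have Hu0 : Lsq u by have [] := Hu.
  have HZ c g : Lsq g -> Lsq (c *: g) by exact: LsqZ.
  have Hsum : Lsq (\sum_(i < d) lap i) by apply: (ip_mem_sum ia).
  rewrite [X in L2norm X](_ : _ = - theta ^+ 2 *: (\sum_(i < d) lap i) + mulop V u
     - lambda *: u - f); last first.
    by apply/funext => x; rewrite !pointE fct_sumE.
  rewrite L2norm_ip ?r0 ?sqrtr0//.
  apply: (ip_memB ia) => //; apply: (ip_memB ia); last exact: HZ.
  by apply: LsqD; [exact: HZ|exact: (Lsq_mulop mV VM Hu0)].
- exists (m - lambda)^-1 => g v /op_subE[Hg Hv gv].
  rewrite !L2norm_ip// -EFinM lee_fin -ler_pdivrMl ?invr_gt0// invrK.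
  rewrite -(ger0_norm (ltW dl)) -sqrtr_sqr -sqrtrM ?sqr_ge0//.
  exact: ler_wsqrtr.
Qed.

End spectral_bottom.

Theorem theorem1p1 (R : realType) (d : nat) (hd : (1 <= d)%N)
  (V : 'rV[R]_d -> R) (V_ge0 : forall x, 0 <= V x) (V_cont : continuous V)
  (V_per : forall (x : 'rV[R]_d) (k : 'rV[int]_d), V (x + map_mx intr k) = V x)
  (theta : R) (theta_gt0 : 0 < theta) (theta_lt1 : theta < 1)
  (theta_irr : irrational theta) :
  (mu_A V theta <= mu_B V theta)%E.
Proof.
have [M VM] := periodic_bounded V_ge0 V_cont V_per.
have mV := measurable_rV_continuous V_cont.
have [m [mA mform]] := mu_A_le_form theta VM.
have shifted := shifted_form V_cont V_per theta_irr mform.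
apply: le_ereal_inf_tmp => _ [lambda lspec <-].
rewrite (le_trans mA)// lee_fin leNgt; apply/negP => lm; apply: lspec.
apply: (resolvent_set_B V_ge0 V_cont V_per theta_gt0 theta_lt1 lm).
exact: continuous_form mV VM shifted.
Qed.
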